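(* Let $R$ be a Noetherian normal domain containing $\mathbb{Q}$, let $B$ be an $\mathbb{A}^2$-fibration over $R$, and let $D$ be a non-zero locally nilpotent $R$-derivation of $B$. Then $A:=\operatorname{Ker}(D)$ has the structure of a graded ring $\bigoplus_{i\ge 0}A_i$ with $A_0=R$ and such that for each $i\ge 1$, $A_i$ is a finite reflexive $R$-module of rank one. In fact, when $R$ is not a field, there exists an ideal $I$ of unmixed height one in $R$ such that $A$ is isomorphic to the symbolic Rees algebra $\bigoplus_{n\ge 0}I^{(n)}T^n$.
   Context: All rings are commutative with unity; isomorphisms are of $R$-algebras. An $R$-algebra $B$ is an $\mathbb{A}^n$-fibration over $R$ if $B$ is finitely generated as an $R$-algebra, flat as an $R$-module, and for each $\mathfrak{p}\in\operatorname{Spec}(R)$, $B\otimes_R k(\mathfrak{p})$ is isomorphic as a $k(\mathfrak p)$-algebra to a polynomial ring in $n$ variables over $k(\mathfrak{p})=R_{\mathfrak p}/\mathfrak pR_{\mathfrak p}$. An $R$-derivation $D:B\to B$ is an $R$-linear map satisfying the Leibniz rule; it is locally nilpotent if for each $b\in B$ there is $n\ge 0$ with $D^n(b)=0$; $\operatorname{Ker}(D)=\{b\in B:D(b)=0\}$. An ideal $I$ of $R$ is unmixed of height one if every associated prime of $R/I$ has height one. For such $I$, the $n$-th symbolic power is $I^{(n)}=R\cap\bigcap_{\mathfrak p\in\operatorname{Ass}(R/I)}I^nR_{\mathfrak p}$ (with $I^{(0)}=R$), and the symbolic Rees algebra $\bigoplus_{n\ge0}I^{(n)}T^n$ is the corresponding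 graded subring of the polynomial ring $R[T]$. *)

(* Defs.v *)
From HB Require Import structures.
From mathcomp Require Import all_boot all_order all_algebra.
From mathcomp Require Import ring_quotient generic_quotient fraction mxpoly.
From mathcomp Require Import boolp functions.
From mathcomp Require mpoly.
(* The notations of mpoly clash with those of boolp and functions. *)
Import -(notations) mpoly.

Set Implicit Arguments.
Unset Strict Implicit.
Unset Printing Implicit Defensive.

Import GRing.Theory.
Local Open Scope ring_scope.
Local Open Scope quotient_scope.

Local Notation "x %:F" := (FracField.tofrac x).

Record submod (R : pzRingType) (V : lmodType R) (S : submodClosed V) :=
  Submod { submod_val :> V; submod_valP : submod_val \in S }.

Section Submod.
Variables (R : pzRingType) (V : lmodType R) (S : submodClosed V).
HB.instance Definition _ := [isSub for @submod_val R V S].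
HB.instance Definition _ := [Choice of submod S by <:].
HB.instance Definition _ := [SubChoice_isSubLmodule of submod S by <:].
End Submod.

Record subalg (R : pzRingType) (A : comAlgType R) (S : subalgClosed A) :=
  Subalg { subalg_val :> A; subalg_valP : subalg_val \in S }.

Section Subalg.
Variables (R : pzRingType) (A : comAlgType R) (S : subalgClosed A).
HB.instance Definition _ := [isSub for @subalg_val R A S].
HB.instance Definition _ := [Choice of subalg S by <:].
HB.instance Definition _ := [SubChoice_isSubAlgebra of subalg S by <:].
HB.instance Definition _ := [SubNzRing_isSubComNzRing of subalg S by <:].
End Subalg.

Definition alg_isomorphic (R : pzRingType) (A B : algType R) : Prop :=
  exists f : {lrmorphism A -> B}, bijective f.

Definition finite_module (R : pzRingType) (M : lmodType R) : Prop :=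
  exists (n : nat) (g : 'I_n -> M),
    forall m : M, exists c : 'I_n -> R, m = \sum_(i < n) c i *: g i.

(* The ideals of [R] are the submodules of the regular module [R^o]. *)
Definition noetherian (R : comNzRingType) : Prop :=
  forall I : submodClosed R^o, finite_module (submod I).

Definition normal_domain (R : idomainType) : Prop :=
  forall x : {fraction R}, integralOver (@FracField.tofrac R) x -> exists r : R, x = r%:F.

Definition contains_rat (R : comNzRingType) : Prop :=
  inhabited {rmorphism rat -> R}.

Section Tensor.
Variables (R : comNzRingType) (M N : lmodType R).

(* A formal sum of elementary tensors is a list of pairs; [tensor_eq] is the
   congruence generated by the bilinearity relations.  Opposites need no
   generator of their own, since [(- m, n)] is opposite to [(m, n)]. *)
Inductive tensor_eq : seq (M * N) -> seq (M * N) -> Prop :=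
| tensor_refl x : tensor_eq x x
| tensor_sym x y : tensor_eq x y -> tensor_eq y x
| tensor_trans x y z : tensor_eq x y -> tensor_eq y z -> tensor_eq x z
| tensor_cat x x' y y' :
    tensor_eq x x' -> tensor_eq y y' -> tensor_eq (x ++ y) (x' ++ y')
| tensor_swap x y : tensor_eq (x ++ y) (y ++ x)
| tensor_zero n : tensor_eq [:: (0, n)] [::]
| tensor_addl m m' n : tensor_eq [:: (m + m', n)] [:: (m, n); (m', n)]
| tensor_addr m n n' : tensor_eq [:: (m, n + n')] [:: (m, n); (m, n')]
| tensor_scale a m n : tensor_eq [:: (a *: m, n)] [:: (m, a *: n)].

Definition tensor_eqb (x y : seq (M * N)) : bool := `[< tensor_eq x y >].

Lemma tensor_eqb_equiv : equiv_class_of tensor_eqb.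
Proof.
split=> [x|x y|y x z].
- by apply/asboolP; exact: tensor_refl.
- by apply/asboolP/asboolP; exact: tensor_sym.
- by move=> /asboolP xy /asboolP yz; apply/asboolP; exact: tensor_trans xy yz.
Qed.

Canonical tensor_equiv := EquivRelPack tensor_eqb_equiv.
Canonical tensor_encModRel := defaultEncModRel tensor_eqb.

Definition tensor := {eq_quot tensor_eqb}.
HB.instance Definition _ : EqQuotient _ tensor_eqb tensor :=
  EqQuotient.on tensor.
HB.instance Definition _ := Choice.on tensor.

Lemma tensorP x y : \pi_tensor x = \pi_tensor y <-> tensor_eq x y.
Proof.
by split=> [/eqmodP/asboolP|h]; [|apply/eqmodP/asboolP].
Qed.

Lemma repr_tensor x : tensor_eq (repr (\pi_tensor x)) x.
Proof. by apply/tensorP; rewrite reprK. Qed.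

Definition tensor_add (x y : tensor) : tensor := \pi_tensor (repr x ++ repr y).
Definition tensor_opp (x : tensor) : tensor :=
  \pi_tensor [seq (- p.1, p.2) | p <- repr x].

Lemma tensor_addE x y : tensor_add (\pi_tensor x) (\pi_tensor y) = \pi_tensor (x ++ y).
Proof. by apply/tensorP/tensor_cat; apply: repr_tensor. Qed.

Lemma tensor_surj x : exists s, x = \pi_tensor s.
Proof. by exists (repr x); rewrite reprK. Qed.

Lemma tensor_addA : associative tensor_add.
Proof.
move=> x y z.
have [[[s ->] [t ->]] [u ->]] :=
  (tensor_surj x, tensor_surj y, tensor_surj z).
by rewrite !tensor_addE catA.
Qed.

Lemma tensor_addC : commutative tensor_add.
Proof.
move=> x y; have [[s ->] [t ->]] := (tensor_surj x, tensor_surj y).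
by rewrite !tensor_addE; apply/tensorP/tensor_swap.
Qed.

Lemma tensor_add0 : left_id (\pi_tensor [::]) tensor_add.
Proof. by move=> x; have [s ->] := tensor_surj x; rewrite tensor_addE. Qed.

Lemma tensor_addN : left_inverse (\pi_tensor [::]) tensor_opp tensor_add.
Proof.
move=> x; rewrite /tensor_opp -[X in tensor_add _ X]reprK tensor_addE.
apply/tensorP; elim: (repr x) => [|[m n] s IHs] /=; first exact: tensor_refl.
set t := [seq _ | _ <- s] in IHs *.
rewrite -[_ :: t ++ _]/([:: (- m, n)] ++ (t ++ _)) -[_ :: s]/([:: (m, n)] ++ s).
have h : tensor_eq [:: (- m, n); (m, n)] [::].
  apply: tensor_trans (tensor_zero n).
  by rewrite -(addNr m); apply/tensor_sym/tensor_addl.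
apply: tensor_trans (tensor_cat (tensor_refl _) (tensor_swap _ _)) _.
rewrite -catA catA; apply: (tensor_trans (tensor_cat h (tensor_refl _))) => /=.
exact: tensor_trans (tensor_swap _ _) IHs.
Qed.

HB.instance Definition _ :=
  GRing.isZmodule.Build tensor tensor_addA tensor_addC tensor_add0 tensor_addN.

Definition pure (m : M) (n : N) : tensor := \pi_tensor [:: (m, n)].

Lemma tensor_piE s : \pi_tensor s = \sum_(p <- s) pure p.1 p.2.
Proof.
elim: s => [|p s IHs]; first by rewrite big_nil.
by case: p => m n; rewrite big_cons -IHs -[_ :: s]cat1s -tensor_addE.
Qed.

Lemma tensor_ind (P : tensor -> Prop) :
  P 0 -> (forall x y, P x -> P y -> P (x + y)) ->
  (forall m n, P (pure m n)) -> forall x, P x.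
Proof.
move=> P0 PD Pp x; rewrite -[x]reprK tensor_piE.
by apply: big_ind => // p _; apply: Pp.
Qed.

Lemma pureDl m m' n : pure (m + m') n = pure m n + pure m' n.
Proof.
by rewrite /pure [RHS]tensor_addE; apply/tensorP/tensor_addl.
Qed.
Lemma pureDr m n n' : pure m (n + n') = pure m n + pure m n'.
Proof.
by rewrite /pure [RHS]tensor_addE; apply/tensorP/tensor_addr.
Qed.
Lemma pureZ a m n : pure (a *: m) n = pure m (a *: n).
Proof. by apply/tensorP/tensor_scale. Qed.

Definition balanced (V : zmodType) (b : M -> N -> V) : Prop :=
  [/\ forall m m' n, b (m + m') n = b m n + b m' n,
      forall m n n', b m (n + n') = b m n + b m n' &
      forall a m n, b (a *: m) n = b m (a *: n)].

(* Compatible with the tensor relations, hence meaningful, only when [b] is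
   balanced. *)
Definition tensor_lift (V : zmodType) (b : M -> N -> V) (x : tensor) : V :=
  \sum_(p <- repr x) b p.1 p.2.

Section Lift.
Variables (V : zmodType) (b : M -> N -> V) (bb : balanced b).

Lemma tensor_lift_pi s : tensor_lift b (\pi_tensor s) = \sum_(p <- s) b p.1 p.2.
Proof.
have [bDl bDr bZ] := bb.
rewrite /tensor_lift; move: (repr_tensor s); move: (repr _) => t.
elim=> {s t} //=.
- by move=> x y z _ -> _ ->.
- by move=> x x' y y' _ hx _ hy; rewrite !big_cat /= hx hy.
- by move=> x y; rewrite !big_cat /= addrC.
- move=> n; rewrite big_seq1 big_nil /=; apply: (addrI (b 0 n)).
  by rewrite -bDl !addr0.
- by move=> m m' n; rewrite !big_cons !big_nil /= !addr0.
- by move=> m n n'; rewrite !big_cons !big_nil /= !addr0.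
- by move=> a m n; rewrite !big_seq1 /=.
Qed.

Lemma tensor_liftD x y :
  tensor_lift b (x + y) = tensor_lift b x + tensor_lift b y.
Proof.
rewrite -[x]reprK -[y]reprK [_ + _]tensor_addE !tensor_lift_pi.
by rewrite big_cat.
Qed.

Lemma tensor_lift0 : tensor_lift b 0 = 0.
Proof. by rewrite -[0]/(\pi_tensor [::]) tensor_lift_pi big_nil. Qed.

Lemma tensor_lift_pure m n : tensor_lift b (pure m n) = b m n.
Proof. by rewrite tensor_lift_pi big_seq1. Qed.
End Lift.

End Tensor.

Definition tensor_map (R : comNzRingType) (M M' N : lmodType R)
    (f : M -> M') : tensor M N -> tensor M' N :=
  tensor_lift (fun m n => pure (f m) n).

Definition flat (R : comNzRingType) (N : lmodType R) : Prop :=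
  forall (M M' : lmodType R) (f : {linear M -> M'}),
    injective f -> injective (tensor_map (N := N) f).

Section TensorRing.
Variables (R : comNzRingType) (A B : comAlgType R).
Local Notation T := (tensor A B).

Definition tensor_mul (x y : T) : T :=
  tensor_lift (fun a b =>
    tensor_lift (fun a' b' => pure (a * a') (b * b') : T) y) x.

Let inner_balanced (a : A) (b : B) :
  balanced (fun a' b' => pure (a * a') (b * b') : T).
Proof.
split=> [c c' d|c d d'|r c d]; first by rewrite mulrDr pureDl.
  by rewrite mulrDr pureDr.
by rewrite -!scalerAr pureZ.
Qed.

Let outer_balanced (y : T) : balanced (fun a b =>
    tensor_lift (fun a' b' => pure (a * a') (b * b') : T) y).
Proof.
split=> [c c' d|c d d'|r c d]; rewrite /tensor_lift -?big_split /=;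
  apply: eq_bigr => p _.
- by rewrite mulrDl pureDl.
- by rewrite mulrDl pureDr.
- by rewrite -!scalerAl pureZ.
Qed.

Lemma tensor_mul_pure a b a' b' :
  tensor_mul (pure a b) (pure a' b') = pure (a * a') (b * b').
Proof.
rewrite /tensor_mul (tensor_lift_pure (outer_balanced _)).
by rewrite (tensor_lift_pure (inner_balanced _ _)).
Qed.

Lemma tensor_mulDl : left_distributive tensor_mul +%R.
Proof. by move=> x y z; rewrite /tensor_mul (tensor_liftD (outer_balanced _)). Qed.

Lemma tensor_mulDr : right_distributive tensor_mul +%R.
Proof.
move=> x y z; rewrite /tensor_mul /tensor_lift -big_split /=.
by apply: eq_bigr => p _; exact: tensor_liftD (inner_balanced _ _) y z.
Qed.

Lemma tensor_mul0x x : tensor_mul 0 x = 0.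
Proof. by rewrite /tensor_mul (tensor_lift0 (outer_balanced _)). Qed.

Lemma tensor_mulC : commutative tensor_mul.
Proof.
have mulx0 x : tensor_mul x 0 = 0.
  by apply: (addrI (tensor_mul x 0)); rewrite -tensor_mulDr !addr0.
move=> x y; elim/tensor_ind: x => [|x x' hx hx'|a b].
- by rewrite tensor_mul0x mulx0.
- by rewrite tensor_mulDl tensor_mulDr hx hx'.
elim/tensor_ind: y => [|y y' hy hy'|a' b'].
- by rewrite tensor_mul0x mulx0.
- by rewrite tensor_mulDl tensor_mulDr hy hy'.
- by rewrite !tensor_mul_pure mulrC [b * _]mulrC.
Qed.

Lemma tensor_mulx0 x : tensor_mul x 0 = 0.
Proof. by rewrite tensor_mulC tensor_mul0x. Qed.

Lemma tensor_mulA : associative tensor_mul.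
Proof.
move=> x y z.
elim/tensor_ind: x => [|x x' hx hx'|a b]; first by rewrite !tensor_mul0x.
  by rewrite !tensor_mulDl hx hx'.
elim/tensor_ind: y => [|y y' hy hy'|a' b'].
- by rewrite tensor_mulx0 !tensor_mul0x tensor_mulx0.
- by rewrite tensor_mulDr !tensor_mulDl tensor_mulDr hy hy'.
elim/tensor_ind: z => [|z z' hz hz'|a'' b''].
- by rewrite !tensor_mulx0.
- by rewrite !tensor_mulDr hz hz'.
- by rewrite !tensor_mul_pure !mulrA.
Qed.

Lemma tensor_mul1 : left_id (pure 1 1) tensor_mul.
Proof.
elim/tensor_ind=> [|x y hx hy|a b]; first by rewrite tensor_mulx0.
  by rewrite tensor_mulDr hx hy.
by rewrite tensor_mul_pure !mul1r.
Qed.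

End TensorRing.

(* [S] seen as an [R]-algebra along [f]. *)
Definition scalar_restr (R S : comNzRingType) (f : {rmorphism R -> S}) : Type := S.

Section ScalarRestr.
Variables (R S : comNzRingType) (f : {rmorphism R -> S}).
Local Notation Sf := (scalar_restr f).
HB.instance Definition _ := GRing.ComNzRing.copy Sf S.

Definition restr_scale (a : R) (x : Sf) : Sf := f a * (x : S).

Lemma restr_scaleA a b x : restr_scale a (restr_scale b x) = restr_scale (a * b) x.
Proof. by rewrite /restr_scale mulrA rmorphM. Qed.
Lemma restr_scale1 : left_id 1 restr_scale.
Proof. by move=> x; rewrite /restr_scale rmorph1 mul1r. Qed.
Lemma restr_scaleDr : right_distributive restr_scale +%R.
Proof. by move=> a x y; rewrite /restr_scale mulrDr. Qed.
Lemma restr_scaleDl x : {morph restr_scale^~ x : a b / a + b}.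
Proof. by move=> a b; rewrite /restr_scale rmorphD mulrDl. Qed.

HB.instance Definition _ := GRing.Zmodule_isLmodule.Build R Sf
  restr_scaleA restr_scale1 restr_scaleDr restr_scaleDl.

Lemma restr_scaleAl (a : R) (x y : Sf) : a *: (x * y) = (a *: x) * y.
Proof. by rewrite /GRing.scale /= /restr_scale mulrA. Qed.

HB.instance Definition _ := GRing.Lmodule_isLalgebra.Build R Sf restr_scaleAl.
HB.instance Definition _ := GRing.Lalgebra_isComAlgebra.Build R Sf.
End ScalarRestr.

(* The [S]-module obtained by tensoring [M] with [S] over [R].  When [M] is an
   [R]-algebra it is also a commutative ring; as that ring may be zero, it has no
   [algType] structure, and algebra morphisms out of it are spelled out as
   multiplicative linear maps. *)
Definition base_change (R S : comNzRingType) (f : {rmorphism R -> S})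
  (M : lmodType R) : Type := tensor (scalar_restr f) M.

Section BaseChange.
Variables (R S : comNzRingType) (f : {rmorphism R -> S}) (M : lmodType R).
Local Notation Sf := (scalar_restr f).
Local Notation SM := (base_change f M).
HB.instance Definition _ := GRing.Zmodule.copy SM (tensor Sf M).

Definition bc_scale (s : S) (x : SM) : SM :=
  tensor_lift (fun (t : Sf) m => pure ((s : Sf) * t) m) x.

Let bc_balanced (s : S) : balanced (fun (t : Sf) (m : M) => pure ((s : Sf) * t) m).
Proof.
split=> [t t' m|t m m'|a t m]; first by rewrite mulrDr pureDl.
  by rewrite pureDr.
by rewrite -scalerAr pureZ.
Qed.

Lemma bc_scale_pure s (t : Sf) m :
  bc_scale s (pure t m) = pure ((s : Sf) * t) m.
Proof. exact: tensor_lift_pure (bc_balanced s) _ _. Qed.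
Lemma bc_scale0 s : bc_scale s 0 = 0.
Proof. exact: tensor_lift0 (bc_balanced s). Qed.
Lemma bc_scaleDr : right_distributive bc_scale +%R.
Proof. by move=> s x y; exact: tensor_liftD (bc_balanced s) x y. Qed.

Lemma bc_scaleA s t x : bc_scale s (bc_scale t x) = bc_scale (s * t) x.
Proof.
elim/tensor_ind: x => [|x y hx hy|u m]; first by rewrite !bc_scale0.
  by rewrite !bc_scaleDr hx hy.
by rewrite !bc_scale_pure mulrA.
Qed.
Lemma bc_scale1 : left_id 1 bc_scale.
Proof.
elim/tensor_ind=> [|x y hx hy|u m]; first by rewrite !bc_scale0.
  by rewrite !bc_scaleDr hx hy.
by rewrite !bc_scale_pure mul1r.
Qed.
Lemma bc_scaleDl x : {morph bc_scale^~ x : s t / s + t}.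
Proof.
move=> s t; elim/tensor_ind: x => [|x y hx hy|u m].
- by rewrite !bc_scale0 addr0.
- by rewrite !bc_scaleDr hx hy addrACA.
- by rewrite !bc_scale_pure -pureDl -mulrDl.
Qed.

HB.instance Definition _ := GRing.Zmodule_isLmodule.Build S SM
  bc_scaleA bc_scale1 bc_scaleDr bc_scaleDl.
End BaseChange.

Section BaseChangeRing.
Variables (R S : comNzRingType) (f : {rmorphism R -> S}) (B : comAlgType R).
HB.instance Definition _ := GRing.Zmodule_isComPzRing.Build (base_change f B)
  (@tensor_mulA R (scalar_restr f) B) (@tensor_mulC R (scalar_restr f) B)
  (@tensor_mul1 R (scalar_restr f) B) (@tensor_mulDl R (scalar_restr f) B).
End BaseChangeRing.

Definition ideal_gen (R : comNzRingType) (X : R -> Prop) : {pred R} :=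
  fun x => `[< exists s : seq (R * R),
    (forall c, c \in s -> X c.2) /\ x = \sum_(c <- s) c.1 * c.2 >].

Section IdealGen.
Variables (R : comNzRingType).
Implicit Types X Y Z : R -> Prop.

Lemma ideal_gen_mem X x : X x -> x \in ideal_gen X.
Proof.
move=> Xx; apply/asboolP; exists [:: (1, x)]; split.
  by move=> c; rewrite inE => /eqP->.
by rewrite big_seq1 mul1r.
Qed.

Lemma ideal_gen0 X : 0 \in ideal_gen X.
Proof. by apply/asboolP; exists [::]; split=> //; rewrite big_nil. Qed.

Lemma ideal_genD X : {in ideal_gen X &, forall x y, x + y \in ideal_gen X}.
Proof.
move=> x y /asboolP[s [Xs ->]] /asboolP[t [Xt ->]]; apply/asboolP.
exists (s ++ t); split; last by rewrite big_cat.
by move=> c; rewrite mem_cat => /orP[]; [apply: Xs|apply: Xt].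
Qed.

Lemma ideal_genMl X a : {in ideal_gen X, forall x, a * x \in ideal_gen X}.
Proof.
move=> x /asboolP[s [Xs ->]]; apply/asboolP.
exists [seq (a * c.1, c.2) | c <- s]; split.
  by move=> _ /mapP[c /Xs Xc ->].
by rewrite big_map mulr_sumr; apply: eq_bigr => c _; rewrite mulrA.
Qed.

Lemma ideal_gen_sub X (P : R -> Prop) :
  P 0 -> (forall a x y, X x -> P y -> P (a * x + y)) ->
  {in ideal_gen X, forall x, P x}.
Proof.
move=> P0 PD x /asboolP[s [Xs ->]].
elim: s Xs => [|c s IHs] Xs; first by rewrite big_nil.
rewrite big_cons; apply: PD; first by apply: Xs; rewrite mem_head.
by apply: IHs => d ds; apply: Xs; rewrite inE ds orbT.
Qed.

Lemma ideal_genM X Y Z :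
  (forall x y, X x -> Y y -> x * y \in ideal_gen Z) ->
  forall x y, x \in ideal_gen X -> y \in ideal_gen Y -> x * y \in ideal_gen Z.
Proof.
move=> XYZ x y xX yY; elim/ideal_gen_sub: x / xX => [|a x x' Xx IH].
  by rewrite mul0r ideal_gen0.
rewrite mulrDl ideal_genD // -mulrA; apply: ideal_genMl.
elim/ideal_gen_sub: y / yY {IH} => [|b y y' Yy IH].
  by rewrite mulr0 ideal_gen0.
by rewrite mulrDr ideal_genD // mulrCA ideal_genMl // XYZ.
Qed.
End IdealGen.

(* For [n = 0] the empty product generates the unit ideal. *)
Definition ideal_pow (R : comNzRingType) (I : {pred R}) (n : nat) : {pred R} :=
  ideal_gen (fun x => exists t : n.-tuple R, all [in I] t /\ x = \prod_(y <- t) y).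

Definition extension (R S : comNzRingType) (f : R -> S) (I : {pred R}) : {pred S} :=
  ideal_gen (fun y => exists2 x, x \in I & y = f x).

Section Localization.
Variables (R : idomainType) (p : prime_idealr R).

(* The localization [R_p] is realized inside the fraction field of [R]. *)
Definition loc_pred : {pred {fraction R}} :=
  fun x => `[< exists a s : R, s \notin p /\ x = a%:F / s%:F >].

Lemma loc_tofracP (a : R) : a%:F \in loc_pred.
Proof.
by apply/asboolP; exists a, 1; rewrite idealr1 tofrac1 divr1.
Qed.

Lemma notin_neq0 (s : R) : s \notin p -> s%:F != 0.
Proof. by apply: contraNneq => /eqP; rewrite tofrac_eq0 => /eqP->; rewrite rpred0. Qed.

Lemma loc_subring : subring_closed loc_pred.
Proof.
split; first by rewrite -tofrac1; apply: loc_tofracP.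
  move=> x y /asboolP[a [s [ps ->]]] /asboolP[b [t [pt ->]]].
  apply/asboolP; exists (a * t - b * s), (s * t).
  rewrite prime_idealrM negb_or ps pt; split=> //.
  have [s0 t0] := (notin_neq0 ps, notin_neq0 pt).
  by rewrite tofracB !tofracM -mulNr addf_div // mulNr.
move=> x y /asboolP[a [s [ps ->]]] /asboolP[b [t [pt ->]]].
apply/asboolP; exists (a * b), (s * t).
by rewrite prime_idealrM negb_or ps pt !tofracM mulf_div.
Qed.

HB.instance Definition _ := GRing.isSubringClosed.Build {fraction R} loc_pred loc_subring.

Record localization := Localization {
  loc_val :> {fraction R}; loc_valP : loc_val \in loc_pred }.

HB.instance Definition _ := [isSub for loc_val].
HB.instance Definition _ := [Choice of localization by <:].
HB.instance Definition _ := [SubChoice_isSubComNzRing of localization by <:].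

Definition to_loc (a : R) : localization := Localization (loc_tofracP a).

Lemma to_loc_zmod : zmod_morphism to_loc.
Proof. by move=> a b; apply: val_inj; rewrite /= tofracB. Qed.
Lemma to_loc_monoid : monoid_morphism to_loc.
Proof. by split=> [|a b]; apply: val_inj; rewrite /= (tofrac1, tofracM). Qed.
HB.instance Definition _ := GRing.isZmodMorphism.Build R localization to_loc to_loc_zmod.
HB.instance Definition _ := GRing.isMonoidMorphism.Build R localization to_loc to_loc_monoid.

Definition loc_max : {pred localization} := extension to_loc p.

Lemma loc_max_idealr : idealr_closed loc_max.
Proof.
split; first exact: ideal_gen0; last first.
  by move=> a x y hx hy; rewrite ideal_genD // ideal_genMl.
apply/negP => h1.
have : exists a s : R, [/\ a \in p, s \notin p & val (1 : localization) = a%:F / s%:F].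
  elim/ideal_gen_sub: _ / h1 => [|c _ y [x px ->] [a [s [pa ps hy]]]].
    by exists 0, 1; rewrite rpred0 idealr1 tofrac0 mul0r.
  have /asboolP[b [t [pt hc]]] := loc_valP c.
  exists (b * x * s + a * t), (t * s); split.
  - rewrite rpredD //; first by rewrite mulrC !idealMr.
    by rewrite mulrC idealMr.
  - by rewrite prime_idealrM negb_or pt.
  - have [s0 t0] := (notin_neq0 ps, notin_neq0 pt).
    rewrite /= hy hc tofracD !tofracM mulrAC addf_div //.
move=> [a [s [pa ps /= h]]].
have : s%:F = a%:F by rewrite -[RHS](divfK (notin_neq0 ps)) -h mul1r.
by move/eqP; rewrite tofrac_eq => /eqP sa; rewrite sa pa in ps.
Qed.

HB.instance Definition _ := isIdealr.Build localization loc_max loc_max_idealr.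

(* Only its ring structure is needed; it is the quotient of [localization] by the
   ideal generated by [p], which is the maximal one. *)
Definition residue_field : Type := {ideal_quot loc_max}.
HB.instance Definition _ := GRing.ComNzRing.on residue_field.

Definition to_residue (a : R) : residue_field := \pi_{ideal_quot loc_max} (to_loc a).
Lemma to_residue_zmod : zmod_morphism to_residue.
Proof. by move=> a b; rewrite /to_residue !rmorphB. Qed.
Lemma to_residue_monoid : monoid_morphism to_residue.
Proof. by split=> [|a b]; rewrite /to_residue (rmorph1, rmorphM) ?rmorph1 ?rmorphM. Qed.
HB.instance Definition _ := GRing.isZmodMorphism.Build R residue_field to_residue to_residue_zmod.
HB.instance Definition _ := GRing.isMonoidMorphism.Build R residue_field to_residue to_residue_monoid.
End Localization.

Definition associated_prime (R : comNzRingType) (I : idealr R)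
    (p : prime_idealr R) : Prop :=
  exists x : {ideal_quot I},
    forall r : R, (r \in p) = (\pi_{ideal_quot I} r * x == 0).

Definition prime_chain (R : comNzRingType) (p : prime_idealr R) (n : nat) : Prop :=
  exists q : nat -> prime_idealr R, q n =i p /\
    forall i, (i < n)%N ->
      {subset q i <= q i.+1} /\ ~ {subset q i.+1 <= q i}.

Definition height_eq (R : comNzRingType) (p : prime_idealr R) (n : nat) : Prop :=
  prime_chain p n /\ forall m, prime_chain p m -> (m <= n)%N.

(* The unit ideal, for which the condition on associated primes is vacuous, is
   excluded: [idealr R] consists of proper ideals. *)
Definition unmixed_height_one (R : comNzRingType) (I : idealr R) : Prop :=
  forall p : prime_idealr R, associated_prime I p -> height_eq p 1.

Definition symbolic_power (R : idomainType) (I : idealr R) (n : nat) : {pred R} :=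
  fun r => `[< forall p : prime_idealr R, associated_prime I p ->
    to_loc p r \in extension (to_loc p) (ideal_pow I n) >].

Definition symbolic_rees_pred (R : idomainType) (I : idealr R) : {pred {poly R}} :=
  fun f => `[< forall n, f`_n \in symbolic_power I n >].

Section SymbolicRees.
Variables (R : idomainType) (I : idealr R).

Lemma ideal_powM m n x y :
  x \in ideal_pow I m -> y \in ideal_pow I n -> x * y \in ideal_pow I (m + n).
Proof.
apply: ideal_genM => _ _ [s [Is ->]] [t [It ->]]; apply: ideal_gen_mem.
exists [tuple of s ++ t]; split; last by rewrite big_cat.
by rewrite all_cat Is It.
Qed.

Lemma symbolic_power0 n : 0 \in symbolic_power I n.
Proof. by apply/asboolP => p _; rewrite rmorph0 ideal_gen0. Qed.

Lemma symbolic_powerD n :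
  {in symbolic_power I n &, forall x y, x + y \in symbolic_power I n}.
Proof.
move=> x y /asboolP hx /asboolP hy; apply/asboolP => p Ip.
by rewrite rmorphD ideal_genD ?hx ?hy.
Qed.

Lemma symbolic_power_mull n a :
  {in symbolic_power I n, forall x, a * x \in symbolic_power I n}.
Proof.
move=> x /asboolP hx; apply/asboolP => p Ip.
by rewrite rmorphM ideal_genMl ?hx.
Qed.

Lemma symbolic_powerM m n x y : x \in symbolic_power I m ->
  y \in symbolic_power I n -> x * y \in symbolic_power I (m + n).
Proof.
move=> /asboolP hx /asboolP hy; apply/asboolP => p Ip; rewrite rmorphM.
apply: ideal_genM (hx p Ip) (hy p Ip) => _ _ [u hu ->] [v hv ->].
by apply: ideal_gen_mem; exists (u * v); rewrite ?rmorphM ?ideal_powM.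
Qed.

Lemma symbolic_power_1 : 1 \in symbolic_power I 0.
Proof.
apply/asboolP => p _; apply: ideal_gen_mem; exists 1 => //.
by apply: ideal_gen_mem; exists [tuple]; rewrite big_nil.
Qed.

Lemma symbolic_rees_subalg : subalg_closed (symbolic_rees_pred I).
Proof.
split.
- apply/asboolP => -[|n]; rewrite coef1 ?symbolic_power0 //.
  exact: symbolic_power_1.
- move=> a f g /asboolP hf /asboolP hg; apply/asboolP => n.
  by rewrite coefD coefZ symbolic_powerD ?symbolic_power_mull.
- move=> f g /asboolP hf /asboolP hg; apply/asboolP => n; rewrite coefM.
  apply: (big_ind (fun x => x \in symbolic_power I n)) => [||i _].
  - exact: symbolic_power0.
  - by move=> x y; apply: symbolic_powerD.
  - by rewrite -[n in symbolic_power I n](@subnKC i) ?symbolic_powerM // -ltnS.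
Qed.

HB.instance Definition _ :=
  GRing.isSubalgClosed.Build R {poly R} (symbolic_rees_pred I) symbolic_rees_subalg.
End SymbolicRees.

Definition symbolic_rees (R : idomainType) (I : idealr R) : Type :=
  subalg (symbolic_rees_pred I).
HB.instance Definition _ (R : idomainType) (I : idealr R) :=
  GRing.ComAlgebra.on (symbolic_rees I).

Definition finitely_generated_alg (R : comNzRingType) (B : comAlgType R) : Prop :=
  exists (n : nat) (g : 'I_n -> B),
    forall b : B, exists P : mpoly.mpoly n R, b = mpoly.mmap (in_alg B) g P.

Definition affine_fibration (R : idomainType) (n : nat) (B : comAlgType R) : Prop :=
  [/\ finitely_generated_alg B, flat B &
      forall p : prime_idealr R,
        exists f : {linear base_change (to_residue p) B ->
                      mpoly.mpoly n (residue_field p)},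
          monoid_morphism f /\ bijective f].

Record derivation (R : pzRingType) (B : comAlgType R) := Derivation {
  der_fun :> {linear B -> B};
  der_leibniz : forall x y, der_fun (x * y) = der_fun x * y + x * der_fun y }.

Definition locally_nilpotent (R : pzRingType) (B : comAlgType R)
    (D : derivation B) : Prop :=
  forall b : B, exists n : nat, iter n D b = 0.

Definition ker_pred (R : pzRingType) (B : comAlgType R) (D : derivation B) :
  {pred B} := fun b => D b == 0.

Section DerivationKernel.
Variables (R : pzRingType) (B : comAlgType R) (D : derivation B).

Lemma ker_subalg : subalg_closed (ker_pred D).
Proof.
split=> [|a x y|x y]; rewrite !unfold_in.
- by apply/eqP/(addrI (D 1)); rewrite addr0 -{3}[1]mulr1 der_leibniz mulr1 mul1r.
- by move=> /eqP hx /eqP hy; rewrite linearP hx hy scaler0 addr0.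
- by move=> /eqP hx /eqP hy; rewrite der_leibniz hx hy mulr0 mul0r addr0.
Qed.
HB.instance Definition _ := GRing.isSubalgClosed.Build R B (ker_pred D) ker_subalg.
End DerivationKernel.

Definition ker (R : pzRingType) (B : comAlgType R) (D : derivation B) : Type :=
  subalg (ker_pred D).
HB.instance Definition _ (R : pzRingType) (B : comAlgType R) (D : derivation B) :=
  GRing.ComAlgebra.on (ker D).

Record is_grading (R : pzRingType) (A : comAlgType R)
    (A_ : nat -> submodClosed A) : Prop := IsGrading {
  grading_one : 1 \in A_ 0%N;
  grading_mul : forall i j x y, x \in A_ i -> y \in A_ j -> x * y \in A_ (i + j)%N;
  grading_sum : forall a : A, exists (n : nat) (c : nat -> A),
    (forall i, c i \in A_ i) /\ a = \sum_(i < n) c i;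
  grading_direct : forall (n : nat) (c : nat -> A),
    (forall i, c i \in A_ i) -> \sum_(i < n) c i = 0 ->
    forall i, (i < n)%N -> c i = 0 }.

(* The structure map of [A] is an isomorphism of [R] onto [A0]. *)
Definition is_base (R : pzRingType) (A : comAlgType R) (A0 : {pred A}) : Prop :=
  injective (fun r : R => r%:A : A) /\ forall a, a \in A0 <-> exists r : R, a = r%:A.

Definition linear_form_pred (R : comNzRingType) (M : lmodType R) :
  {pred (M -> R^o)} := fun f => `[< linear f >].
Arguments linear_form_pred {R} M _.

Section Dual.
Variables (R : comNzRingType) (M : lmodType R).

Lemma linear_form_submod : submod_closed (linear_form_pred M).
Proof.
split; first by apply/asboolP => a x y; rewrite scaler0 addr0.
move=> a f g /asboolP hf /asboolP hg; apply/asboolP => b x y.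
rewrite !fctE /= hf hg /GRing.scale /= mulrDr !mulrA [a * b]mulrC addrACA.
by rewrite mulrDr !mulrA.
Qed.
HB.instance Definition _ :=
  GRing.isSubmodClosed.Build R (M -> R^o) (linear_form_pred M) linear_form_submod.
End Dual.

Definition dual (R : comNzRingType) (M : lmodType R) : Type :=
  submod (linear_form_pred M).
HB.instance Definition _ (R : comNzRingType) (M : lmodType R) :=
  GRing.Lmodule.on (dual M).

Definition evaluation (R : comNzRingType) (M : lmodType R) (m : M) (f : dual M) : R^o :=
  submod_val f m.

Lemma evaluation_linear (R : comNzRingType) (M : lmodType R) (m : M) :
  @evaluation R M m \in linear_form_pred (dual M).
Proof. by apply/asboolP. Qed.

Definition biduality (R : comNzRingType) (M : lmodType R) (m : M) : dual (dual M) :=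
  Submod (evaluation_linear m).

Definition reflexive_module (R : comNzRingType) (M : lmodType R) : Prop :=
  bijective (@biduality R M).

Definition rank_eq (R : idomainType) (M : lmodType R) (n : nat) : Prop :=
  exists f : {linear base_change (@FracField.tofrac R) M -> 'rV[{fraction R}]_n},
    bijective f.

(* Main.v *)
(** Over the fraction field [K] of [R] the fibration becomes [K[X, Y]], and the kernel
    of the extended derivation is [K[F]]: it is factorially closed of transcendence
    degree one, so a nonconstant element of least degree vanishing at the origin is
    prime and divides every other kernel element vanishing there.  At a height-one
    prime [p], the fibre is a polynomial ring, so either [F] is transcendental modulo
    [p], and then generates the localized kernel, or [F] is constant modulo [p] and can
    be replaced by [(F - r) / pi].  The replacement stops, because repeated partial
    derivatives send [F] to a nonzero constant, which bounds all denominators.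

    The constants [r] met at the various primes come from one [c] in [R]: they are
    the solutions of a finite linear system that is solvable in [B], hence in [R] by
    faithful flatness.  With [T = F - c], the homogeneous parts in [T] of a kernel
    element again lie in [B], since this holds locally in height one.  Hence the kernel
    is graded, its degree [n] part is [J_n T ^ n] with [J_n] a divisorial fractional
    ideal that is at each height-one prime the [n]-th power of [J_1], and [I = x J_1],
    for a suitable [x] in [R], has [x ^ n J_n] as its symbolic powers. *)

Require Import Defs.
From HB Require Import structures.
From mathcomp Require Import all_boot all_order all_algebra.
From mathcomp Require Import ring_quotient generic_quotient fraction mxpoly polyXY.
From mathcomp Require Import boolp functions.
From mathcomp Require Import ring zify.
From mathcomp Require mpoly.
Import -(notations) mpoly.

Set Implicit Arguments.
Unset Strict Implicit.
Unset Printing Implicit Defensive.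

Import GRing.Theory.
Local Open Scope ring_scope.
Local Open Scope quotient_scope.

Local Notation "x %:F" := (FracField.tofrac x).

(** Dividing [F] at a height-one prime as far as possible gives [t = (v F - r) / pi^n], and both the
    scaling and the constant [r] depend on the prime. Scalings respect the powers of the generator,
    translations do not: a grading can appear only once all translations are replaced by a single
    one, so [c] is found before any component is defined. What makes this a finite problem is one
    nonzero [k] in [R] such that [b] divides [k u] whenever [b] divides some [u F - r] in [B]. Only
    congruences modulo [k] then matter, and the [u] for which [u F] is constant modulo [k] form a
    finitely generated ideal. No localization of [B] and no extended derivation is constructed: a
    statement at [p] is an equation in [B] with a multiplier outside [p], and a statement over [K]
    is one with a nonzero multiplier. Flatness enters through its equational criterion, which yields
    both descents: from [B] to [R], and from all height-one primes to divisibility in [B]. *)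

(** * Ideals and primes of a noetherian ring *)

(** Unlike [idealr], this allows the unit ideal: ideals of multipliers are often shown to contain
    1. *)
Definition ideal_closed (R : comNzRingType) (I : R -> Prop) : Prop :=
  I 0 /\ forall a x y, I x -> I y -> I (a * x + y).

Section IdealClosed.
Variables (R : comNzRingType) (I : R -> Prop).
Hypothesis I_ideal : ideal_closed I.

Lemma ideal_closedD x y : I x -> I y -> I (x + y).
Proof. by move=> Ix Iy; rewrite -[x]mul1r; apply: I_ideal.2. Qed.

Lemma ideal_closedM a x : I x -> I (a * x).
Proof. by move=> Ix; rewrite -[a * x]addr0; apply: I_ideal.2 => //; apply: I_ideal.1. Qed.

Lemma ideal_closed_sum (J : finType) (F : J -> R) :
  (forall j, I (F j)) -> I (\sum_j F j).
Proof. by move=> IF; elim/big_ind: _ => //; [apply: I_ideal.1 | apply: ideal_closedD]. Qed.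

Lemma ideal_closed_fg : noetherian R ->
  exists n (g : 'I_n -> R), (forall i, I (g i)) /\
    forall x, I x -> exists c : 'I_n -> R, x = \sum_i c i * g i.
Proof.
move=> noeth; pose P : {pred R^o} := fun x => `[< I x >].
have Pc : submod_closed P.
  split; first by apply/asboolP; apply: I_ideal.1.
  by move=> a x y /asboolP Ix /asboolP Iy; apply/asboolP; apply: I_ideal.2.
pose S : submodClosed R^o :=
  HB.pack_for (submodClosed R^o) P (GRing.isSubmodClosed.Build R R^o P Pc).
have [n [g gP]] := noeth S.
exists n, (fun i => submod_val (g i)); split=> [i|x Ix].
  by have /asboolP := submod_valP (g i).
have Sx : x \in S by apply/asboolP.
have [c cP] := gP (Submod Sx).
exists c; transitivity (\val (Submod Sx)); first by [].
by rewrite cP raddf_sum.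
Qed.
End IdealClosed.

(* A strictly increasing sequence of ideals has a finitely generated union. *)
Lemma noetherian_max (R : comNzRingType) (P : (R -> Prop) -> Prop) (I : R -> Prop) :
    noetherian R -> (forall J, P J -> ideal_closed J) -> P I ->
  exists J, [/\ P J, (forall x, I x -> J x) &
    forall J', P J' -> (forall x, J x -> J' x) -> forall x, J' x -> J x].
Proof.
move=> noeth Pid PI; apply: contrapT => nomax.
pose T := {J : R -> Prop | P J /\ forall x, I x -> J x}.
have next (J : T) : exists J' : T,
    (forall x, sval J x -> sval J' x) /\ exists x, sval J' x /\ ~ sval J x.
  case: J => J [PJ IJ] /=; apply: contrapT => noJ'.
  apply: nomax; exists J; split=> // J' PJ' JJ' x J'x; apply: contrapT => nJx.
  apply: noJ'; exists (exist _ J' (conj PJ' (fun y Iy => JJ' y (IJ y Iy)))).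
  by split=> //; exists x.
pose J0 : T := exist _ I (conj PI (fun x Ix => Ix)).
pose s n := iter n (fun J => sval (cid (next J))) J0.
have sS n : (forall x, sval (s n) x -> sval (s n.+1) x) /\
    exists x, sval (s n.+1) x /\ ~ sval (s n) x.
  by rewrite /s iterS; case: cid.
have smono m n x : (m <= n)%N -> sval (s m) x -> sval (s n) x.
  move=> /subnKC <-; elim: (n - m)%N => [|k IH]; first by rewrite addn0.
  by rewrite addnS => /IH; apply: (sS _).1.
pose U x := exists n, sval (s n) x.
have U_ideal : ideal_closed U.
  split; first by exists 0%N; apply: (Pid _ (svalP (s 0%N)).1).1.
  move=> a x y [m mx] [n ny]; exists (maxn m n).
  apply: (Pid _ (svalP (s _)).1).2.
    exact: smono (leq_maxl _ _) mx.
  exact: smono (leq_maxr _ _) ny.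
have [k [g [Ug gen]]] := ideal_closed_fg U_ideal noeth.
have [f fP] := choice Ug.
pose N := (\max_i f i)%N.
have [_ [x [Sx]]] := sS N; apply.
have [c ->] := gen x (ex_intro (fun n => sval (s n) x) N.+1 Sx).
have idN := Pid _ (svalP (s N)).1.
apply: ideal_closed_sum => // i; apply: ideal_closedM => //.
apply: smono (fP i); exact: leq_bigmax.
Qed.

Lemma prime_idealr_of (R : comNzRingType) (P : R -> Prop) :
    ideal_closed P -> ~ P 1 -> (forall x y, P (x * y) -> P x \/ P y) ->
  exists p : prime_idealr R, forall x, (x \in p) = `[< P x >].
Proof.
move=> [P0 PD] P1 PM; pose Q : {pred R} := fun x => `[< P x >].
have Qid : idealr_closed Q.
  split; [exact/asboolP | by apply/asboolP |].
  by move=> a x y /asboolP Px /asboolP Py; apply/asboolP/PD.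
have Qp : prime_idealr_closed Q.
  move=> x y /asboolP/PM [Px|Py]; apply/orP; [left|right]; exact/asboolP.
have [Qz Qpr] := (idealr_closedB Qid, idealr_closed_nontrivial Qid).
pose p : prime_idealr R := HB.pack_for (prime_idealr R) Q
  (GRing.isZmodClosed.Build R Q Qz) (isProperIdeal.Build R Q Qpr)
  (isPrimeIdealrClosed.Build R Q Qp).
by exists p.
Qed.

Section PrimeIdealr.
Variables (R : comNzRingType) (p : idealr R).

Lemma idealr_ideal_closed : ideal_closed (fun x => x \in p).
Proof. by split=> [|a x y px py]; rewrite ?rpred0 // rpredD // idealMr. Qed.

End PrimeIdealr.

Lemma prod_notin_prime (R : comNzRingType) (p : prime_idealr R) (J : finType) (s : J -> R) :
  (forall j, s j \notin p) -> \prod_j s j \notin p.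
Proof.
move=> ps; elim/big_ind: _ => // [|x y px py]; first by rewrite idealr1.
by rewrite prime_idealrM negb_or px.
Qed.

Lemma exp_notin_prime (R : comNzRingType) (p : prime_idealr R) s n :
  s \notin p -> s ^+ n \notin p.
Proof.
by move=> ps; elim: n => [|n IH]; rewrite ?expr0 ?idealr1 // exprS prime_idealrM negb_or ps.
Qed.

Lemma zero_prime (R : idomainType) : exists p : prime_idealr R, forall x, (x \in p) = (x == 0).
Proof.
have [||x y /eqP|p pE] := @prime_idealr_of R (fun x => x = 0).
- by split=> // a x y -> ->; rewrite mulr0 addr0.
- by apply/eqP; rewrite oner_eq0.
- by rewrite mulf_eq0 => /orP[/eqP|/eqP]; [left|right].
by exists p => x; rewrite pE; apply/asboolP/eqP.
Qed.

(** Noetherianity provides an ideal maximal among the proper ones containing [I], and such an ideal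
    is prime. *)
Lemma exists_prime (R : comNzRingType) (I : R -> Prop) :
    noetherian R -> ideal_closed I -> ~ I 1 ->
  exists p : prime_idealr R, forall x, I x -> x \in p.
Proof.
move=> noeth Iid I1.
have [J [[Jid J1] IJ Jmax]] :=
  @noetherian_max R (fun J => ideal_closed J /\ ~ J 1) I noeth (fun J h => h.1) (conj Iid I1).
have JN x : ~ J x -> exists a j, J j /\ 1 = a * x + j.
  move=> nJx; apply: contrapT => h; apply: nJx.
  apply: (Jmax (fun y => exists a j, J j /\ y = a * x + j)).
  - split=> //; split; first by exists 0, 0; split; [apply: Jid.1 | rewrite mul0r addr0].
    move=> b _ _ [a [j [Jj ->]]] [a' [j' [Jj' ->]]].
    exists (b * a + a'), (b * j + j'); split; first exact: Jid.2.
    by rewrite mulrDr mulrDl -!mulrA addrACA.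
  - by move=> y Jy; exists 0, y; rewrite mul0r add0r.
  - by exists 1, 0; split; [apply: Jid.1 | rewrite mul1r addr0].
have [//|//|x y Jxy|p pE] := @prime_idealr_of R J.
  apply: contrapT => /not_orP[/JN[a [j [Jj e]]] /JN[b [k [Jk e']]]].
  apply: J1; rewrite -[1]mulr1 {1}e e' mulrDl !mulrDr.
  rewrite mulrACA; apply: ideal_closedD => //; apply: ideal_closedD => //; do ?exact: ideal_closedM.
  by rewrite mulrC; apply: ideal_closedM.
by exists p => x /IJ Jx; rewrite pE; apply/asboolP.
Qed.

(* [p] is an associated prime of a nonzero principal ideal, [p = (aR : b)].  Over
   a noetherian normal domain these are exactly the primes of height one. *)
Definition good_prime (R : idomainType) (p : prime_idealr R) : Prop :=
  exists a b : R, a != 0 /\ forall r, r \in p <-> exists y, r * b = a * y.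

(** * Height-one primes of a noetherian normal domain *)

Section NormalNoetherian.
Variable R : idomainType.
Hypotheses (R_noetherian : noetherian R) (R_normal : normal_domain R).

Lemma colon_ideal (a b : R) : ideal_closed (fun r => exists y, r * b = a * y).
Proof.
split=> [|c r s [y hy] [z hz]]; first by exists 0; rewrite mul0r mulr0.
by exists (c * y + z); rewrite mulrDl -mulrA hy hz mulrDr mulrCA.
Qed.

(** A maximal one among the proper colon ideals [(aR : b')] containing [(aR : b)] is prime: if [x y]
    lies in it and [y b'] is not in [aR], then [(aR : y b')] is at least as large and contains [x].
    Good primes thus detect any failure of divisibility by [a]. *)
Lemma exists_good_prime (a b : R) : a != 0 -> (forall y, b <> a * y) ->
  exists2 p, good_prime p & forall r y, r * b = a * y -> r \in p.
Proof.
move=> a0 ba; pose Q b' r := exists y, r * b' = a * y.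
have [J||J [[b' [b'a ->]] bb' Jmax]] := @noetherian_max R
  (fun J => exists b', (forall y, b' <> a * y) /\ J = Q b') (Q b) R_noetherian.
- by move=> [b' [_ ->]]; apply: colon_ideal.
- by exists b.
have [||x y [z hz]|p pE] := @prime_idealr_of R (Q b').
- exact: colon_ideal.
- by move=> [y]; rewrite mul1r => /b'a.
- have [[w hw]|h] := pselect (exists w, y * b' = a * w); [by right; exists w | left].
  apply: (Jmax (Q (y * b'))).
  + by exists (y * b'); split=> // w e; apply: h; exists w.
  + by move=> r [w e]; exists (y * w); rewrite mulrCA e mulrCA.
  + by exists z; rewrite mulrA.
exists p; first by exists a, b'; split=> // r; rewrite pE; split=> /asboolP.
by move=> r y e; rewrite pE; apply/asboolP/bb'; exists y.
Qed.

(* If [y = b / a] mapped [p] into itself it would be integral, by Cayley-Hamilton;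
   hence [y * pi] is a unit at [p] for some [pi] in [p]. *)
Lemma good_prime_uniformizer (p : prime_idealr R) : good_prime p ->
  exists pi u, [/\ pi != 0, pi \in p, u \notin p &
    forall x, x \in p -> exists y, u * x = pi * y].
Proof.
move=> [a [b [a0 pE]]].
have aF : a%:F != 0 by rewrite tofrac_eq0.
have [[pi [u [ppi up e]]]|h] :=
  pselect (exists pi u, [/\ pi \in p, u \notin p & pi * b = a * u]).
  exists pi, u; split=> // [|x /pE[y hy]].
    apply/eqP => pi0; move/eqP: e; rewrite pi0 mul0r eq_sym mulf_eq0 (negPf a0) /=.
    by apply/negP; apply: contraNneq up => ->; rewrite rpred0.
  exists y; apply: (mulfI a0); transitivity (pi * b * x); first by rewrite e mulrA.
  by rewrite -mulrA [b * x]mulrC hy mulrCA.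
have {}h x : x \in p -> exists2 y, y \in p & x * b = a * y.
  move=> px; have [y hy] := (pE x).1 px; exists y => //.
  by apply/negPn/negP => py; apply: h; exists x, y.
have pa : a \in p by apply/pE; exists b.
have [n [g [pg gen]]] := ideal_closed_fg (idealr_ideal_closed p) R_noetherian.
have [c cP] : exists c : 'I_n -> 'I_n -> R, forall i, g i * b = a * \sum_j c i j * g j.
  have /choice[c cP] : forall i, exists c : 'I_n -> R, g i * b = a * \sum_j c j * g j.
    by move=> i; have [y /gen[c ->] e] := h _ (pg i); exists c.
  by exists c.
pose M := \matrix_(i, j) c i j; pose z := b%:F / a%:F.
(* The generators of [p] form an eigenvector for the eigenvalue [b / a]; it is nonzero because [a]
   itself lies in [p]. *)
have zroot : root (char_poly (map_mx (@FracField.tofrac R) M)^T) z.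
  rewrite -eigenvalue_root_char; apply/eigenvalueP.
  exists (\row_i (g i)%:F).
    apply/rowP => i; rewrite !mxE /z mulrAC -tofracM mulrC [b * _]mulrC cP tofracM mulKf //.
    by rewrite rmorph_sum /=; apply: eq_bigr => j _; rewrite !mxE tofracM mulrC.
  apply/negP => /eqP g0; have [d ad] := gen a pa; case/eqP: a0; rewrite ad.
  rewrite big1 // => i _; have /rowP/(_ i) := g0; rewrite !mxE => /eqP.
  by rewrite tofrac_eq0 => /eqP->; rewrite mulr0.
have [|r rE] := R_normal (x := z).
  exists (char_poly M^T); first exact: char_poly_monic.
  by rewrite map_char_poly -map_trmx.
have : 1 \in p.
  apply/pE; exists r; rewrite mul1r; apply/eqP; rewrite -tofrac_eq tofracM -rE.
  by rewrite /z mulrC divfK.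
by rewrite idealr1.
Qed.

Section Uniformizer.
Variables (p : prime_idealr R) (pi u : R).
Hypotheses (ppi : pi \in p) (up : u \notin p)
  (pi_gen : forall x, x \in p -> exists y, u * x = pi * y).

Lemma notin_prime_neq0 s : s \notin p -> s != 0.
Proof. by apply: contraNneq => ->; rewrite rpred0. Qed.

(** [pi_gen] says that [pi] generates [p R_p], and [S x] is the contraction of [x R_p]. Among the
    nonzero elements without valuation take [x] with [S x] maximal. Then [x] lies in [p],
    [u x = pi y], and [y] has no valuation either; so [y] lies in [S x], which makes [pi] a unit at
    [p]. *)
Lemma uniformizer_valuation r : r != 0 ->
  exists n v w, [/\ v \notin p, w \notin p & v * r = pi ^+ n * w].
Proof.
move=> r0; apply: contrapT => h.
pose Z x := x != 0 /\ ~ exists n v w, [/\ v \notin p, w \notin p & v * x = pi ^+ n * w].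
pose S x y := exists s z, s \notin p /\ s * y = x * z.
have Sid x : ideal_closed (S x).
  split; first by exists 1, 0; rewrite idealr1 !mulr0.
  move=> c y y' [s [z [ps e]]] [s' [z' [ps' e']]].
  exists (s * s'), (s' * c * z + s * z'); split; first by rewrite prime_idealrM negb_or ps.
  transitivity (s' * c * (s * y) + s * (s' * y')); first by ring.
  by rewrite e e'; ring.
have [J||J [[x [[x0 Zx] ->]] _ Jmax]] := @noetherian_max R
    (fun J => exists x, Z x /\ J = S x) (S r) R_noetherian.
- by move=> [x [_ ->]].
- by exists r.
have px : x \in p.
  by apply/negPn/negP => px; apply: Zx; exists 0%N, 1, x; rewrite idealr1 px expr0.
have [y e] := pi_gen px.
have y0 : y != 0.
  apply/eqP => y0; move/eqP: e; rewrite y0 mulr0 mulf_eq0 (negPf x0) orbF.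
  by rewrite (negPf (notin_prime_neq0 up)).
have /(_ _ _ y) [|||s [z [ps e']]] := Jmax (S y).
- exists y; split=> //; split=> // -[n [v [w [pv pw e']]]]; apply: Zx.
  exists n.+1, (v * u), w; split=> //; first by rewrite prime_idealrM negb_or pv.
  by rewrite -mulrA e mulrCA e' exprS mulrA.
- move=> a [s [z [ps es]]]; exists (s * u), (pi * z); split.
    by rewrite prime_idealrM negb_or ps.
  by transitivity (u * (s * a)); [ring | rewrite es mulrA e; ring].
- by exists 1, 1; rewrite idealr1 mulr1 mul1r.
have /negP[] : s * u \notin p by rewrite prime_idealrM negb_or ps.
have -> : s * u = pi * z; last by rewrite mulrC idealMr.
by apply: (mulfI x0); transitivity (s * (u * x)); [ring | rewrite e mulrCA e'; ring].
Qed.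

Lemma uniformizer_exp_dvd n m w y : pi != 0 -> w \notin p ->
  pi ^+ n * y = pi ^+ m * w -> (n <= m)%N.
Proof.
move=> pi0 pw; case: leqP => // lt_mn e.
have ew : pi ^+ (n - m) * y = w.
  by apply: (mulfI (expf_neq0 m pi0)); rewrite mulrA -exprD subnKC // (ltnW lt_mn).
by move: pw; rewrite -ew -(subnSK lt_mn) exprS -mulrA mulrC idealMr.
Qed.

(** A nonzero element of [q] is a power of [pi] up to elements outside [p], which are also outside
    [q]; hence [pi] lies in [q], and with it all of [p]. *)
Lemma uniformizer_subprime (q : prime_idealr R) x : x \in q -> x != 0 ->
  {subset q <= p} -> {subset p <= q}.
Proof.
move=> qx /uniformizer_valuation[n [v [w [pv pw e]]]] qp y py.
have pq s : s \notin p -> s \notin q by apply: contra; apply: qp.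
have qpi : pi \in q.
  have : pi ^+ n * w \in q by rewrite -e idealMr.
  rewrite prime_idealrM (negPf (pq _ pw)) orbF; apply: contraLR; exact: exp_notin_prime.
have [z ez] := pi_gen py.
have : u * y \in q by rewrite ez mulrC idealMr.
by rewrite prime_idealrM (negPf (pq _ up)).
Qed.
End Uniformizer.

Lemma good_prime_neq0 (p : prime_idealr R) : good_prime p -> exists2 x, x \in p & x != 0.
Proof. by move=> [a [b [a0 pE]]]; exists a => //; apply/pE; exists b. Qed.

Lemma good_prime_min (p q : prime_idealr R) x : good_prime p -> x \in q -> x != 0 ->
  {subset q <= p} -> {subset p <= q}.
Proof.
move=> /good_prime_uniformizer[pi [u [_ ppi pu pi_gen]]] qx x0 qp.
exact: (uniformizer_subprime ppi pu pi_gen qx x0 qp).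
Qed.

Lemma good_prime_height (p : prime_idealr R) : good_prime p -> height_eq p 1.
Proof.
move=> good_p; have [x px x0] := good_prime_neq0 good_p.
have [p0 p0E] := zero_prime R; split.
  exists (fun i => if i is 0%N then p0 else p); split=> // -[|//] _; split=> [y|h].
    by rewrite p0E => /eqP->; rewrite rpred0.
  by have := h _ px; rewrite p0E (negPf x0).
move=> m [q [qm qS]]; case: m qm qS => [|[|m]] // qm qS; exfalso.
(* In a chain of length at least two, the last prime before [p] is nonzero and strictly contained in
   [p]. *)
have [sub0 /existsNP[y /not_implyP[q1y /negP q0y]]] := qS m (ltnW (ltnSn _)).
have [sub1] := qS m.+1 (ltnSn _); apply => z; rewrite qm => pz.
apply: (@good_prime_min p (q m.+1) y) => //.
- by apply: contraNneq q0y => ->; rewrite rpred0.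
- by move=> w /sub1; rewrite qm.
Qed.
End NormalNoetherian.

(** * Tensor products and the equational criterion of flatness *)

Section TensorSum.
Variables (R : comNzRingType) (M N : lmodType R).

Lemma pure0l (n : N) : pure (0 : M) n = 0.
Proof. by apply: (addrI (pure (0 : M) n)); rewrite -pureDl !addr0. Qed.

Lemma pure0r (m : M) : pure m (0 : N) = 0.
Proof. by apply: (addrI (pure m (0 : N))); rewrite -pureDr !addr0. Qed.

Lemma pure_suml (J : finType) (F : J -> M) (n : N) :
  pure (\sum_j F j) n = \sum_j pure (F j) n.
Proof. by apply: (big_morph (fun m => pure m n)) => [x y|]; rewrite (pureDl, pure0l). Qed.

Lemma pure_sumr (J : finType) (m : M) (F : J -> N) :
  pure m (\sum_j F j) = \sum_j pure m (F j).
Proof. by apply: (big_morph (pure m)) => [x y|]; rewrite (pureDr, pure0r). Qed.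

Lemma tensor_lift_sum (V : zmodType) (b : M -> N -> V) (bb : balanced b)
    (J : finType) (F : J -> tensor M N) :
  tensor_lift b (\sum_j F j) = \sum_j tensor_lift b (F j).
Proof. by apply: big_morph => [x y|]; rewrite (tensor_liftD bb, tensor_lift0 bb). Qed.

Lemma tensor_map_balanced (M' : lmodType R) (f : {linear M -> M'}) :
  balanced (fun m (n : N) => pure (f m) n).
Proof.
split=> [m m' n|m n n'|a m n]; first by rewrite raddfD pureDl.
  by rewrite pureDr.
by rewrite linearZ pureZ.
Qed.
End TensorSum.

Section EquationalFlatness.
Variables (R : comNzRingType) (N : lmodType R).
Hypothesis N_flat : flat N.

Section System.
Variables (n m : nat) (A : 'M[R]_(n, m)).

Definition image_pred : {pred 'cV[R]_n} := fun y => `[< exists x : 'cV[R]_m, y = A *m x >].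
Lemma image_submod : submod_closed image_pred.
Proof.
split; first by apply/asboolP; exists 0; rewrite mulmx0.
move=> a _ _ /asboolP[x ->] /asboolP[y ->]; apply/asboolP; exists (a *: x + y).
by rewrite mulmxDr scalemxAr.
Qed.
HB.instance Definition _ := GRing.isSubmodClosed.Build R 'cV[R]_n image_pred image_submod.

(** The image in [N^m] of the tensor product of [ker A] with [N]. *)
Definition syzygy_pred : {pred {ffun 'I_m -> N}} := fun b =>
  `[< exists s : seq ('cV[R]_m * N), (forall c, c \in s -> A *m c.1 = 0) /\
        forall j, b j = \sum_(c <- s) c.1 j 0 *: c.2 >].
Lemma syzygy_zmod : zmod_closed syzygy_pred.
Proof.
split; first by apply/asboolP; exists [::]; split=> // j; rewrite big_nil ffunE.
move=> b b' /asboolP[s [sP bE]] /asboolP[s' [sP' bE']]; apply/asboolP.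
exists (s ++ [seq (- c.1, c.2) | c <- s']); split.
  move=> c; rewrite mem_cat => /orP[/sP //|/mapP[d /sP' d0 ->]].
  by rewrite mulmxN d0 oppr0.
move=> j; rewrite big_cat /= !ffunE bE bE' big_map -sumrN; congr (_ + _).
by apply: eq_bigr => c _; rewrite mxE scaleNr.
Qed.
HB.instance Definition _ := GRing.isZmodClosed.Build {ffun 'I_m -> N} syzygy_pred syzygy_zmod.

Let lift_image (w : submod image_pred) : 'cV[R]_m :=
  sval (cid ((asboolP _) (submod_valP w))).
Let lift_imageP w : submod_val w = A *m lift_image w.
Proof. by rewrite /lift_image; case: cid. Qed.

Let outer (x : 'cV[R]_m) (b : N) : {ffun 'I_m -> N} := [ffun j => x j 0 *: b].

Let outer_syzygy x b : A *m x = 0 -> outer x b \in syzygy_pred.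
Proof.
move=> x0; apply/asboolP; exists [:: (x, b)]; split=> [c|j]; first by rewrite inE => /eqP->.
by rewrite big_seq1 ffunE.
Qed.

(** The sum [X] of the tensors of [A e_j] with [b_j] lives over the image of [A]. It vanishes over
    [R^n], where its coordinates are those of [A b], hence it vanishes by flatness. As the image of
    [A] is [R^m] modulo [ker A], this makes [b] a combination of syzygies. *)
Lemma flat_syzygy (b : 'I_m -> N) : (forall i, \sum_j A i j *: b j = 0) ->
  exists s : seq ('cV[R]_m * N), (forall c, c \in s -> A *m c.1 = 0) /\
    forall j, b j = \sum_(c <- s) c.1 j 0 *: c.2.
Proof.
move=> Ab.
have memA x : A *m x \in image_pred by apply/asboolP; exists x.
pose e j : submod image_pred := Submod (memA (delta_mx j 0)).
pose X := \sum_j pure (e j) (b j).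
pose f : {linear submod image_pred -> 'cV[R]_n} := (\val : submod image_pred -> 'cV[R]_n).
have X0 : X = 0.
  apply: (N_flat (f := f) val_inj).
  rewrite /tensor_map (tensor_lift0 (tensor_map_balanced N f)).
  rewrite /X (tensor_lift_sum (tensor_map_balanced N f)).
  transitivity (\sum_j \sum_i pure (delta_mx i 0 : 'cV[R]_n) (A i j *: b j)).
    apply: eq_bigr => j _; rewrite (tensor_lift_pure (tensor_map_balanced N f)) /=.
    have -> : A *m delta_mx j 0 = \sum_i A i j *: delta_mx i 0 :> 'cV[R]_n.
      rewrite -colE; apply/colP => i; rewrite mxE summxE (bigD1 i) //= !mxE !eqxx mulr1.
      by rewrite big1 ?addr0 // => k /negPf ki; rewrite !mxE eq_sym ki mulr0.
    by rewrite pure_suml; apply: eq_bigr => i _; rewrite pureZ.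
  by rewrite exchange_big big1 //= => i _; rewrite -pure_sumr Ab pure0r.
pose Q := Quotient.quot syzygy_pred.
(* [lift_image] is a mere choice of preimages and is not linear; its defects lie in [ker A], so they
   disappear in the quotient [Q]. *)
pose beta w b0 : Q := \pi_Q (outer (lift_image w) b0).
have piW x : x \in syzygy_pred -> \pi_Q x = 0.
  by move=> Wx; apply/eqP; rewrite -[0](raddf0 \pi_Q) -Quotient.idealrBE subr0.
have piE x y : x - y \in syzygy_pred -> \pi_Q x = \pi_Q y.
  by move=> Wxy; apply/eqP; rewrite -Quotient.idealrBE.
have bb : balanced beta.
  split=> [w w' c|w c c'|a w c]; rewrite /beta -?raddfD; apply: piE.
  - have -> : outer (lift_image (w + w')) c - (outer (lift_image w) c + outer (lift_image w') c)
        = outer (lift_image (w + w') - lift_image w - lift_image w') c.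
      by apply/ffunP => j; rewrite !ffunE !mxE !scalerBl opprD addrA.
    by apply: outer_syzygy; rewrite !mulmxBr -!lift_imageP /= addrAC addrK subrr.
  - have -> : outer (lift_image w) (c + c') - (outer (lift_image w) c + outer (lift_image w) c') = 0.
      by apply/ffunP => j; rewrite !ffunE scalerDr subrr.
    exact: rpred0.
  - have -> : outer (lift_image (a *: w)) c - outer (lift_image w) (a *: c)
        = outer (lift_image (a *: w) - a *: lift_image w) c.
      by apply/ffunP => j; rewrite !ffunE !mxE scalerBl scalerA mulrC.
    by apply: outer_syzygy; rewrite mulmxBr -scalemxAr -!lift_imageP /= subrr.
have := congr1 (tensor_lift beta) X0.
rewrite (tensor_lift0 bb) /X (tensor_lift_sum bb).
under eq_bigr do rewrite (tensor_lift_pure bb).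
rewrite -raddf_sum -[RHS](raddf0 \pi_Q) => /eqP; rewrite -Quotient.idealrBE subr0.
set b1 := \sum_i _ => Wb1.
(* [b1] is built from the chosen lifts of the [A e_j] instead of the [e_j]; the differences are
   killed by [A]. *)
have : [ffun j => b j] \in syzygy_pred.
  have -> : [ffun j => b j] = b1 + \sum_j outer (delta_mx j 0 - lift_image (e j)) (b j).
    apply/ffunP => j; rewrite ffunE /b1 -big_split /= sum_ffunE (bigD1 j) //=.
    rewrite !ffunE !mxE !eqxx -scalerDl subrKC scale1r big1 ?addr0 // => k kj.
    by rewrite !ffunE !mxE eq_sym (negPf kj) -scalerDl subrKC scale0r.
  rewrite rpredD // rpred_sum // => j _.
  by apply: outer_syzygy; rewrite mulmxBr -lift_imageP /= subrr.
by move=> /asboolP[s [sP bE]]; exists s; split=> // j; rewrite -bE ffunE.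
Qed.
End System.
End EquationalFlatness.

(** * Descent along flat and faithfully flat algebras *)

(** Membership in [pB]. *)
Definition extended (R : comNzRingType) (B : lmodType R) (p : {pred R}) (b : B) : Prop :=
  exists s : seq (R * B), (forall c, c \in s -> c.1 \in p) /\ b = \sum_(c <- s) c.1 *: c.2.

Section FaithfullyFlat.
Variables (R : idomainType) (B : comAlgType R).
Hypotheses (R_noetherian : noetherian R) (R_normal : normal_domain R).
Hypotheses (B_flat : flat B) (B_faithful : forall p : prime_idealr R, ~ extended p (1 : B)).

(** The vector [(b, 1)] is annihilated by [[A | -v]], so by flatness 1 is a combination of last
    entries [c] of syzygies over [R]. Each such [c] has [c v] in the image of [A]. If the ideal of
    these multipliers were proper, a prime [p] above it would have 1 in [pB]. *)
Lemma solve_system n m (A : 'M[R]_(n, m)) (v : 'cV[R]_n) (b : 'I_m -> B) :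
  (forall i, \sum_j A i j *: b j = (v i 0)%:A) -> exists x, A *m x = v.
Proof.
move=> Ab; pose A' : 'M[R]_(n, m + 1) := row_mx A (- v).
pose b' (j : 'I_(m + 1)) := if fintype.split j is inl k then b k else 1.
have b'l j : b' (lshift 1 j) = b j by rewrite /b' (fintype.unsplitK (inl j)).
have b'r j : b' (rshift m j) = 1 by rewrite /b' (fintype.unsplitK (inr j)).
have [|s [sP bE]] := @flat_syzygy _ _ B_flat _ _ A' b'.
  move=> i; rewrite big_split_ord /= big_ord1.
  under eq_bigr do rewrite row_mxEl b'l.
  by rewrite Ab row_mxEr b'r mxE -scalerDl subrr scale0r.
pose I c := exists x, A *m x = c *: v.
have [I1|nI1] := pselect (I 1); first by case: I1 => x; rewrite scale1r; exists x.
have I_ideal : ideal_closed I.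
  split; first by exists 0; rewrite mulmx0 scale0r.
  move=> a c d [x hx] [y hy]; exists (a *: x + y).
  by rewrite mulmxDr -scalemxAr hx hy scalerDl scalerA.
have [p pI] := exists_prime R_noetherian I_ideal nI1.
have [] := B_faithful (p := p); rewrite -(b'r 0) bE.
exists [seq (c.1 (rshift m ord0) 0, c.2) | c : 'cV[R]_(m + 1) * B <- s]; split; last by rewrite big_map.
move=> _ /mapP[c /sP + ->] /=; rewrite -[c.1]vsubmxK mul_row_col mulNmx => /eqP.
rewrite subr_eq0 => /eqP cE; apply: pI; exists (usubmx c.1); rewrite cE.
by rewrite col_mxEd [X in v *m X]mx11_scalar mul_mx_scalar.
Qed.

(** The single equation [b x = a], solvable in [B]. *)
Lemma pure_subring a b (y : B) : a%:A = b *: y -> exists r, a = b * r.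
Proof.
move=> e; have [|x /matrixP/(_ 0 0)] :=
    @solve_system 1 1 (const_mx b) (const_mx a) (fun=> y).
  by move=> i; rewrite big_ord1 !mxE e.
by rewrite !mxE big_ord1 mxE => <-; exists (x 0 0).
Qed.

(** Let [J] be the ideal of the [r] with [r b] in [aB], generated by the [r_i]. Flatness writes [b]
    as a combination with coefficients [c] in [R] such that every [r_i c] lies in [aR]. Such a [c]
    is a multiple of [a]: otherwise some good prime contains [(aR : c)], hence [J], while the
    hypothesis puts an element of [J] outside it. *)
Lemma dvd_of_good_primes a (b : B) : a != 0 ->
    (forall p, good_prime p -> exists s y, s \notin p /\ s *: b = a *: y) ->
  exists y, b = a *: y.
Proof.
move=> a0 loc; pose J r := exists y, r *: b = a *: y.
have J_ideal : ideal_closed J.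
  split; first by exists 0; rewrite scale0r scaler0.
  move=> c r r' [y hy] [y' hy']; exists (c *: y + y').
  by rewrite scalerDl -scalerA hy hy' scalerDr !scalerA mulrC.
have [k [r [Jr gen]]] := ideal_closed_fg J_ideal R_noetherian.
have [y yP] := choice Jr.
pose A : 'M[R]_(k, 1 + k) := row_mx (\col_i r i) (- a%:M).
pose b' (j : 'I_(1 + k)) := if fintype.split j is inr i then y i else b.
have b'l j : b' (lshift k j) = b by rewrite /b' (fintype.unsplitK (inl j)).
have b'r j : b' (rshift 1 j) = y j by rewrite /b' (fintype.unsplitK (inr j)).
have [|s [sP bE]] := @flat_syzygy _ _ B_flat _ _ A b'.
  move=> i; rewrite big_split_ord /= big_ord1 row_mxEl mxE b'l yP (bigD1 i) //=.
  rewrite row_mxEr b'r !mxE eqxx scaleNr big1 ?addr0 ?subrr // => j ji.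
  by rewrite row_mxEr !mxE eq_sym (negPf ji) oppr0 scale0r.
have dvd c : c \in s -> exists z, c.1 (lshift k 0) 0 = a * z.
  move=> cs; apply: contrapT => ndvd.
  have [|p good_p colon_p] := exists_good_prime R_noetherian a0 (b := c.1 (lshift k 0) 0).
    by move=> z cz; apply: ndvd; exists z.
  have [t [z [pt tz]]] := loc p good_p; move/negP: pt; apply.
  have [|d ->] := gen t; first by exists z.
  apply: (ideal_closed_sum (idealr_ideal_closed p)) => i; apply: idealMr.
  apply: (colon_p _ (c.1 (rshift 1 i) 0)).
  have /colP/(_ i) := sP c cs; rewrite -{1}[c.1]vsubmxK mul_row_col mulNmx mul_scalar_mx.
  by rewrite !mxE big_ord1 !mxE => /eqP; rewrite subr_eq0 => /eqP.
rewrite -(b'l 0) bE big_seq.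
apply: (big_ind (fun x => exists y, x = a *: y)) => [|_ _ [y1 ->] [y2 ->]|c cs].
- by exists 0; rewrite scaler0.
- by exists (y1 + y2); rewrite scalerDr.
- by have [z ->] := dvd c cs; exists (z *: c.2); rewrite scalerA.
Qed.
End FaithfullyFlat.

(** * Residue fields and the fibres of [B] *)

Section ResidueField.
Variables (R : idomainType) (p : prime_idealr R).

Lemma loc_maxP (x : localization p) : x \in @loc_max R p <->
  exists a s, [/\ a \in p, s \notin p & loc_val x = a%:F / s%:F].
Proof.
split=> [|[a [s [pa ps xE]]]].
  elim/ideal_gen_sub: x / => [|c _ y [a pa ->] [b [s [pb ps yE]]]].
    by exists 0, 1; rewrite rpred0 idealr1 tofrac0 mul0r.
  have /asboolP[d [t [pt cE]]] := loc_valP c.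
  exists (d * a * s + b * t), (t * s); split.
  - by rewrite rpredD //; [rewrite mulrC !idealMr | rewrite mulrC idealMr].
  - by rewrite prime_idealrM negb_or pt.
  - have [s0 t0] := (notin_neq0 ps, notin_neq0 pt).
    by rewrite /= yE cE tofracD !tofracM mulrAC addf_div.
have hs : 1%:F / s%:F \in loc_pred p by apply/asboolP; exists 1, s.
have -> : x = Localization hs * to_loc p a.
 apply: val_inj; change (loc_val x = 1%:F / s%:F * a%:F).
  by rewrite xE tofrac1 mul1r mulrC.
by apply/ideal_genMl/ideal_gen_mem; exists a.
Qed.

Lemma to_residue_eq0 a : (to_residue p a == 0) = (a \in p).
Proof.
rewrite /to_residue -[0](raddf0 \pi_{ideal_quot (@loc_max R p)}) -Quotient.idealrBE subr0.
apply/idP/idP => [/loc_maxP[b [s [pb ps e]]]|pa]; last first.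
  by apply/loc_maxP; exists a, 1; rewrite idealr1 tofrac1 divr1.
have {}e : a%:F = b%:F / s%:F := e.
have abs : a * s = b by apply/eqP; rewrite -tofrac_eq tofracM e divfK ?(notin_neq0 ps).
have : a * s \in p by rewrite abs.
by rewrite prime_idealrM (negPf ps) orbF.
Qed.

Lemma residue_repr (x : residue_field p) :
  exists a s, s \notin p /\ to_residue p s * x = to_residue p a.
Proof.
rewrite -[x]reprK; move: (repr x) => l {x}.
have /asboolP[a [s [ps lE]]] := loc_valP l.
exists a, s; split=> //; rewrite /to_residue -rmorphM; congr (\pi _).
by apply: val_inj; change (s%:F * loc_val l = a%:F); rewrite lE mulrC divfK ?(notin_neq0 ps).
Qed.

Lemma residue_inv (x : residue_field p) : x != 0 -> exists y, y * x = 1.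
Proof.
have [a [s [ps e]]] := residue_repr x; move=> x0.
have pa : a \notin p.
  apply/negP; rewrite -to_residue_eq0 -e => /eqP sx0.
  have hs : 1%:F / s%:F \in loc_pred p by apply/asboolP; exists 1, s.
  have : (\pi_{ideal_quot (@loc_max R p)} (Localization hs) * to_residue p s) * x == 0.
    by rewrite -mulrA sx0 mulr0.
  rewrite /to_residue -rmorphM.
  have -> : Localization hs * to_loc p s = 1.
    apply: val_inj; change (1%:F / s%:F * s%:F = 1).
    by rewrite tofrac1 divfK ?(notin_neq0 ps).
  by rewrite rmorph1 mul1r (negPf x0).
have ha : 1%:F / a%:F \in loc_pred p by apply/asboolP; exists 1, a.
exists (\pi_{ideal_quot (@loc_max R p)} (Localization ha) * to_residue p s).
rewrite -mulrA e /to_residue -rmorphM.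
have -> : Localization ha * to_loc p a = 1.
  apply: val_inj; change (1%:F / a%:F * a%:F = 1).
  by rewrite tofrac1 divfK ?(notin_neq0 pa).
by rewrite rmorph1.
Qed.

End ResidueField.

Lemma base_change_ind (R S : comNzRingType) (f : {rmorphism R -> S}) (M : lmodType R)
    (P : base_change f M -> Prop) :
  P 0 -> (forall x y, P x -> P y -> P (x + y)) -> (forall c m, P (pure c m)) ->
  forall x, P x.
Proof. exact: tensor_ind. Qed.

Section Fibre.
Variables (R : idomainType) (B : comAlgType R) (p : prime_idealr R).
Variables (k : comNzRingType) (rho : {rmorphism R -> k}).
Hypothesis B_flat : flat B.
Hypothesis rho_eq0 : forall a, (rho a == 0) = (a \in p).
Hypothesis rho_repr : forall x, exists a s, s \notin p /\ rho s * x = rho a.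
Local Notation Sk := (scalar_restr rho).

Definition base_pred : {pred Sk} := fun x => `[< exists r, x = rho r >].
Lemma base_submod : submod_closed base_pred.
Proof.
split; first by apply/asboolP; exists 0; rewrite raddf0.
move=> a _ _ /asboolP[r ->] /asboolP[r' ->]; apply/asboolP; exists (a * r + r').
by rewrite rmorphD rmorphM.
Qed.
HB.instance Definition _ := GRing.isSubmodClosed.Build R Sk base_pred base_submod.

Definition extended_pred : {pred B} := fun b => `[< extended p b >].
Lemma extended_zmod : zmod_closed extended_pred.
Proof.
split; first by apply/asboolP; exists [::]; split=> //; rewrite big_nil.
move=> b b' /asboolP[s [sP ->]] /asboolP[s' [sP' ->]]; apply/asboolP.
exists (s ++ [seq (- c.1, c.2) | c <- s']); split.
  by move=> c; rewrite mem_cat => /orP[/sP //|/mapP[d /sP' pd ->]]; rewrite rpredN.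
rewrite big_cat big_map -sumrN /=; congr (_ + _).
by apply: eq_bigr => c _; rewrite scaleNr.
Qed.
HB.instance Definition _ := GRing.isZmodClosed.Build B extended_pred extended_zmod.

(** The image of [R] in [k] is [R/p], and flatness embeds its tensor product with [B], which is
    [B/pB], into the fibre. The map [beta] goes to [B/pB]; it is balanced although the lifts to [R]
    are arbitrary choices. *)
Lemma extended_pure (b : B) : pure (1 : Sk) b = 0 -> extended p b.
Proof.
move=> b0.
have mem1 : (1 : Sk) \in base_pred by apply/asboolP; exists 1; rewrite rmorph1.
pose f : {linear submod base_pred -> Sk} := (\val : submod base_pred -> Sk).
have e0 : pure (Submod mem1) b = 0.
  apply: (B_flat (f := f) val_inj); rewrite /tensor_map.
  rewrite (tensor_lift_pure (tensor_map_balanced B f)).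
  by rewrite (tensor_lift0 (tensor_map_balanced B f)).
pose lift (w : submod base_pred) : R := sval (cid ((asboolP _) (submod_valP w))).
have liftP w : submod_val w = rho (lift w) by rewrite /lift; case: cid.
pose Q := Quotient.quot extended_pred.
pose beta w c : Q := \pi_Q (lift w *: c).
have piE x y : x - y \in extended_pred -> \pi_Q x = \pi_Q y.
  by move=> Wxy; apply/eqP; rewrite -Quotient.idealrBE.
have mem_p r (c : B) : rho r = 0 -> r *: c \in extended_pred.
  move=> /eqP; rewrite rho_eq0 => pr; apply/asboolP; exists [:: (r, c)].
  by split=> [d|]; rewrite ?big_seq1 // inE => /eqP->.
have bb : balanced beta.
  split=> [w w' c|w c c'|a w c]; rewrite /beta -?raddfD; apply: piE.
  - rewrite -scalerDl -scalerBl mem_p // raddfB raddfD /= -!liftP.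
    by apply/eqP; rewrite subr_eq0.
  - by rewrite subrr rpred0.
  - rewrite scalerA -scalerBl mem_p // raddfB /= rmorphM /= -!liftP.
    by apply/eqP; rewrite subr_eq0 mulrC.
have := congr1 (tensor_lift beta) e0.
rewrite (tensor_lift0 bb) (tensor_lift_pure bb) /beta -[RHS](raddf0 \pi_Q) => /eqP.
rewrite -Quotient.idealrBE subr0; set r := lift _ => Wr.
suff : b \in extended_pred by move=> /asboolP.
rewrite -[b](subrK (r *: b)) rpredD // -{1}[b]scale1r -scalerBl mem_p //.
by rewrite raddfB /= -liftP rmorph1; apply/eqP; rewrite subr_eq0.
Qed.

(** Restricting the isomorphism to the tensors of 1 with [b] gives a ring morphism out of [B]. The
    fibre is used only through it: its kernel lies in [pB], and its image is everything up to
    multipliers outside [p]. *)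
Lemma fibre_morphism (f : {linear base_change rho B -> mpoly 2 k}) :
  monoid_morphism f -> bijective f -> exists phi : {rmorphism B -> mpoly 2 k},
  [/\ forall r b, phi (r *: b) = mpolyC 2 (rho r) * phi b,
      forall b, phi b = 0 -> extended p b &
      forall x, exists s b, s \notin p /\ mpolyC 2 (rho s) * x = phi b].
Proof.
move=> [f1 fM] [f' fK f'K].
pose one b : base_change rho B := pure (1 : Sk) b.
pose phi b := f (one b).
have phi_zmod : zmod_morphism phi.
  have oneD x y : one (x + y) = one x + one y by exact: pureDr.
  move=> x y; rewrite /phi -raddfB; congr (f _).
  by apply: (addIr (one y)); rewrite -oneD !subrK.
have phi_monoid : monoid_morphism phi.
  split; first exact: f1.
  by move=> x y; rewrite /phi -fM; congr (f _); rewrite [RHS]tensor_mul_pure mul1r.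
pose phiM : {rmorphism B -> mpoly 2 k} := HB.pack_for {rmorphism B -> mpoly 2 k} phi
  (GRing.isZmodMorphism.Build _ _ phi phi_zmod) (GRing.isMonoidMorphism.Build _ _ phi phi_monoid).
have phiZ r b : phiM (r *: b) = mpolyC 2 (rho r) * phiM b.
  rewrite mul_mpolyC /= /phi -linearZ; congr (f _); rewrite [RHS]bc_scale_pure /one.
  by rewrite -pureZ; congr (pure _ _).
have f_pure c b : exists s b', s \notin p /\
    mpolyC 2 (rho s) * f (pure c b) = phiM b'.
  have [a [s [ps e]]] := rho_repr c.
  exists s, (a *: b); split=> //; rewrite phiZ -e mpolyCM -mulrA; congr (_ * _).
  rewrite mul_mpolyC /= /phi -linearZ; congr (f _); rewrite [RHS]bc_scale_pure.
  by congr (pure _ _); rewrite mulr1.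
have phi_ker b : phiM b = 0 -> extended p b.
  by move=> fb0; apply: extended_pure; apply: (can_inj fK); rewrite raddf0.
have [F [F0 FD F_pure FK]] : exists F : base_change rho B -> mpoly 2 k,
    [/\ F 0 = 0, {morph F : x y / x + y},
      forall c b, exists s b', s \notin p /\ mpolyC 2 (rho s) * F (pure c b) = phiM b' &
      cancel f' F].
  exists f; split.
  - exact: (raddf0 f).
  - exact: (raddfD f).
  - exact: f_pure.
  - exact: f'K.
exists phiM; split=> //; move: phiM phiZ {phi_ker f_pure} F_pure => {phi_zmod phi_monoid} phiM phiZ F_pure.
move=> x; rewrite -[x]FK; elim/base_change_ind: (f' x) => [|y y' [s [b [ps e]]] [s' [b' [ps' e']]]|//].
  exists 1, 0; split; first by rewrite idealr1.
  rewrite F0.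
  rewrite mulr0.
  by rewrite (raddf0 phiM).
exists (s * s'), (s' *: b + s *: b'); split; first by rewrite prime_idealrM negb_or ps.
rewrite FD raddfD /= !phiZ -e -e' rmorphM /= mpolyCM.
by rewrite mulrDr !mulrA [X in _ = X * _ + _]mulrC.
Qed.
End Fibre.

(* A copy of the residue field on which division is available; the instance is not
   put on [residue_field] itself, where it would compete with the one from which
   the type of the fibre is built. *)
Section ResidueDivision.
Variables (R : idomainType) (p : prime_idealr R).

Definition residue_div : Type := residue_field p.
HB.instance Definition _ := GRing.ComNzRing.copy residue_div (residue_field p).

Definition residue_div_inv (x : residue_div) : residue_div :=
  if pselect (exists y, y * x = 1) is left h then sval (cid h) else 0.

Lemma residue_div_mulVf x : x != 0 -> residue_div_inv x * x = 1.
Proof.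
by move=> x0; rewrite /residue_div_inv; case: pselect => [h|[]]; [case: cid | apply: residue_inv].
Qed.

Lemma residue_div_inv0 : residue_div_inv 0 = 0.
Proof.
rewrite /residue_div_inv; case: pselect => // h; have [y /esym/eqP] := h.
by rewrite mulr0 oner_eq0.
Qed.

HB.instance Definition _ := GRing.ComNzRing_isField.Build residue_div
  residue_div_mulVf residue_div_inv0.
End ResidueDivision.

Lemma fraction_repr (R : idomainType) (x : {fraction R}) :
  exists a s, s != 0 /\ x = a%:F / s%:F.
Proof.
exists \n_(repr x), \d_(repr x); have d0 := denom_ratioP (repr x); split=> //.
have dF0 : (\d_(repr x))%:F != 0 by rewrite tofrac_eq0.
apply: (mulIf dF0); rewrite divfK // -{1}[x]reprK; set r := repr x in d0 *.
unlock FracField.tofrac; rewrite -[LHS]FracField.pi_mul; apply/eqmodP.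
rewrite /= FracField.equivfE /FracField.mulf /= !numden_Ratio ?oner_neq0 ?mulr1 //.
by rewrite mulrC.
Qed.

Section ToFraction.
Variables (R : idomainType) (p : prime_idealr R).
Hypothesis p0 : forall x, x \in p -> x = 0.

Definition residue_to_frac (x : residue_field p) : {fraction R} := loc_val (repr x).

Lemma residue_to_frac_pi (l : localization p) :
  residue_to_frac (\pi_{ideal_quot (@loc_max R p)} l) = loc_val l.
Proof.
rewrite /residue_to_frac; set l' := repr _.
have : l' - l \in @loc_max R p by rewrite Quotient.idealrBE reprK.
move=> /loc_maxP[a [s [/p0 -> _]]]; rewrite tofrac0 mul0r /= => /eqP.
by rewrite subr_eq0 => /eqP.
Qed.

Lemma residue_to_frac_zmod : zmod_morphism residue_to_frac.
Proof. by move=> x y; rewrite -[x]reprK -[y]reprK -rmorphB !residue_to_frac_pi. Qed.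
Lemma residue_to_frac_monoid : monoid_morphism residue_to_frac.
Proof.
split=> [|x y]; first by rewrite -(rmorph1 \pi_{ideal_quot (@loc_max R p)}) residue_to_frac_pi.
by rewrite -[x]reprK -[y]reprK -rmorphM !residue_to_frac_pi.
Qed.

(** At the zero ideal the maximal ideal of the localization is zero, so taking representatives is
    additive and multiplicative. *)
Lemma residue_to_frac_morphism : exists j : {rmorphism residue_field p -> {fraction R}},
  (forall a, j (to_residue p a) = a%:F) /\ forall x, exists y, j y = x.
Proof.
pose j : {rmorphism residue_field p -> {fraction R}} :=
  HB.pack_for {rmorphism residue_field p -> {fraction R}} residue_to_frac
    (GRing.isZmodMorphism.Build _ _ residue_to_frac residue_to_frac_zmod)
    (GRing.isMonoidMorphism.Build _ _ residue_to_frac residue_to_frac_monoid).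
have jE a : j (to_residue p a) = a%:F by rewrite /= residue_to_frac_pi.
exists j; split=> // x; have [a [s [s0 ->]]] := fraction_repr x.
have [|y ys] := @residue_inv _ p (to_residue p s).
  by rewrite to_residue_eq0; apply: contraNN s0 => /p0/eqP.
exists (to_residue p a * y); rewrite rmorphM jE; congr (_ * _).
by apply: (mulIf (x := s%:F)); rewrite ?tofrac_eq0 // mulVf ?tofrac_eq0 // -jE -rmorphM ys rmorph1.
Qed.
End ToFraction.

(** * Fibres as nested polynomial rings *)

Section BivariateEmbedding.
Variables (k : comNzRingType) (L : idomainType) (j : {rmorphism k -> L}).
Hypothesis j_inj : injective j.

Let const : {rmorphism k -> {poly {poly L}}} := polyC \o (polyC \o j).

(** Nested univariate polynomials give access to degrees, gcds and [swapXY]. The variable of index 0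
    becomes the inner one, the other the outer one. *)
Definition bivariate : mpoly 2 k -> {poly {poly L}} :=
  mmap const (fun i : 'I_2 => if i == 0 then 'X%:P else 'X).
HB.instance Definition _ := GRing.RMorphism.copy bivariate (mmap const _).

Lemma bivariateC c : bivariate (mpolyC 2 c) = (j c)%:P%:P.
Proof. by rewrite /bivariate mmapC. Qed.

Lemma coef_bivariate q (m0 : multinom 2) :
  (bivariate q)`_(m0 (lift ord0 ord0))`_(m0 ord0) = j (mcoeff m0 q).
Proof.
rewrite /bivariate /mmap !coef_sum.
have E m : (const (mcoeff m q) *
     mmap1 (fun i : 'I_2 => if i == 0 then 'X%:P else 'X) m)`_(m0 (lift ord0 ord0))`_(m0 ord0)
     = j (mcoeff m q) *+ (m == m0).
  rewrite /mmap1 big_ord_recl big_ord1 /= mulrA -polyC_exp -polyCM mul_polyC coefZ coefXn.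
  have [e|ne] := eqVneq m m0; first by rewrite e eqxx mulr1 mul_polyC coefZ coefXn eqxx mulr1.
  have [e1|] := eqVneq (m0 (lift ord0 ord0)) (m (lift ord0 ord0)); last by rewrite mulr0 coef0.
  rewrite mulr1 mul_polyC coefZ coefXn; have [e0|] := eqVneq (m0 ord0) (m ord0); last by rewrite mulr0.
  case/eqP: ne; apply/mnmP => i; case: (unliftP ord0 i) => [i'|] ->; last by [].
  by rewrite (ord1 i').
have [m0q|m0q] := boolP (m0 \in msupp q); last first.
  rewrite memN_msupp_eq0 // rmorph0 big_seq big1 // => m mq; rewrite E.
  by case: eqP mq m0q => // -> ->.
rewrite (bigD1_seq m0) ?msupp_uniq //= E eqxx big1 ?addr0 // => m /negPf mm0.
by rewrite E mm0.
Qed.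

Lemma bivariate_inj : injective bivariate.
Proof.
apply/raddf_inj => q q0; apply/mpolyP => m; apply: j_inj.
by rewrite -coef_bivariate q0 !coef0 mcoeff0 rmorph0.
Qed.

Lemma bivariate_surj : (forall x, exists c, j c = x) -> forall f, exists q, bivariate q = f.
Proof.
move=> j_surj.
have bivX (i : 'I_2) : bivariate (mpolyX k (mnm1 i)) = if i == 0 then 'X%:P else 'X.
  by rewrite /bivariate mmapX mmap1U.
elim/poly_ind => [|f c [q <-]]; first by exists 0; rewrite rmorph0.
suff [q' <-] : exists q', bivariate q' = c%:P.
  by exists (q * mpolyX k (mnm1 1) + q'); rewrite rmorphD rmorphM /= bivX.
elim/poly_ind: c => [|c x [q' qE]]; first by exists 0; rewrite rmorph0.
have [y yE] := j_surj x.
exists (q' * mpolyX k (mnm1 0) + mpolyC 2 y).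
by rewrite rmorphD rmorphM /= bivX bivariateC qE yE polyCD polyCM.
Qed.
End BivariateEmbedding.

Section Fibres.
Variables (R : idomainType) (B : comAlgType R).
Hypothesis B_fibration : affine_fibration 2 B.

(** This is the fibre at the zero ideal, where [pB] is zero; hence the injectivity. *)
Lemma generic_fibre : exists g : {rmorphism B -> {poly {poly {fraction R}}}},
  [/\ injective g, forall r b, g (r *: b) = r%:F%:P%:P * g b &
      forall c, exists s b, s != 0 /\ s%:F%:P%:P * c = g b].
Proof.
have [p pE] := zero_prime R.
have p0 x : x \in p -> x = 0 by rewrite pE => /eqP.
have [j [jE j_surj]] := residue_to_frac_morphism p0.
have j_inj : injective j.
  apply/raddf_inj => x jx0; have [a [s [ps e]]] := residue_repr x.
  have /eqP := congr1 j e; rewrite rmorphM !jE jx0 mulr0 eq_sym tofrac_eq0 => /eqP a0.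
  have [y yP] : exists y, y * to_residue p s = 1.
    by apply: residue_inv; rewrite to_residue_eq0.
  by rewrite -[x]mul1r -yP -mulrA e a0 rmorph0 mulr0.
have [_ B_flat /(_ p)[f [fM f_bij]]] := B_fibration.
have [phi [phiZ phi_ker phi_surj]] :=
  fibre_morphism B_flat (@to_residue_eq0 R p) (@residue_repr R p) fM f_bij.
exists (bivariate j \o phi); split=> /=.
- apply/raddf_inj => b /= /eqP; rewrite -[0](rmorph0 (bivariate j)) (inj_eq (bivariate_inj j_inj)).
  move=> /eqP /phi_ker[s [sP ->]]; rewrite big_seq big1 // => c /sP /p0 ->.
  by rewrite scale0r.
- by move=> r b; rewrite phiZ rmorphM /= bivariateC jE.
- move=> c; have [q <-] := bivariate_surj j_surj c.
  have [s [b [ps e]]] := phi_surj q; exists s, b; rewrite -pE; split=> //.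
  by rewrite -e rmorphM /= bivariateC jE.
Qed.

Lemma fibre_kernel (p : prime_idealr R) : exists (L : fieldType) (ib : {rmorphism R -> L})
    (phi : {rmorphism B -> {poly {poly L}}}),
  [/\ forall r b, phi (r *: b) = (ib r)%:P%:P * phi b,
      forall r, ib r = 0 <-> r \in p,
      forall x, exists a s, s \notin p /\ ib s * x = ib a &
      forall b, phi b = 0 <-> extended p b].
Proof.
have [_ B_flat /(_ p)[f [fM f_bij]]] := B_fibration.
have [phi [phiZ phi_ker _]] :=
  fibre_morphism B_flat (@to_residue_eq0 R p) (@residue_repr R p) fM f_bij.
pose j : {rmorphism residue_field p -> residue_div p} := idfun.
pose ib : {rmorphism R -> residue_div p} := j \o to_residue p.
have ibE r : ib r = 0 <-> r \in p by rewrite -to_residue_eq0; split=> /eqP.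
have j_inj : injective j by [].
pose psi : {rmorphism B -> {poly {poly residue_div p}}} := bivariate j \o phi.
have psiZ r b : psi (r *: b) = (ib r)%:P%:P * psi b.
  by rewrite /= phiZ rmorphM /= bivariateC.
have psi_ker b : psi b = 0 -> extended p b.
  move=> /= /eqP; rewrite -[0](rmorph0 (bivariate j)) (inj_eq (bivariate_inj j_inj)).
  by move=> /eqP /phi_ker.
exists (residue_div p), ib, psi; split=> //; first exact: residue_repr.
move=> b; split=> [|[s [sP ->]]]; first exact: psi_ker.
rewrite rmorph_sum big_seq big1 // => c /sP /ibE c0.
by rewrite psiZ c0 mul0r.
Qed.
End Fibres.

(** * Factorization in two variables over a field *)

Section Bivariate.
Variable L : fieldType.
Local Notation C := {poly {poly L}}.

Definition bicst (c : L) : C := c%:P%:P.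
HB.instance Definition _ := GRing.RMorphism.copy bicst (polyC \o polyC).

Lemma bicst_eq0 c : (bicst c == 0) = (c == 0).
Proof. by rewrite !polyC_eq0. Qed.

(** The sum of the two partial degrees rather than the total degree: it is additive on nonzero
    products because each partial degree is, and it vanishes exactly on constants. *)
Definition bidegree (f : C) : nat := (size f).-1 + (sizeY f).-1.

Lemma bidegreeM f h : f != 0 -> h != 0 -> bidegree (f * h) = (bidegree f + bidegree h)%N.
Proof.
move=> f0 h0; rewrite /bidegree !sizeYE rmorphM /= !size_mul ?swapXY_eq0 //.
have : [/\ (0 < size f)%N, (0 < size h)%N, (0 < size (swapXY f))%N & (0 < size (swapXY h))%N].
  by rewrite !size_poly_gt0 !swapXY_eq0 f0 h0.
move: (size f) (size h) (size (swapXY f)) (size (swapXY h)) => a b c d [].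
case: a b c d => [|a] [|b] [|c] [|d] // _ _ _ _.
by rewrite !addSn !addnS /= addnACA.
Qed.

Lemma bidegree_bicst c : bidegree (bicst c) = 0%N.
Proof.
rewrite /bidegree sizeYE swapXY_polyC map_polyC /= !size_polyC.
by case: (_ == 0).
Qed.

Lemma bidegree_eq0 f : bidegree f = 0%N -> exists c, f = bicst c.
Proof.
move/eqP; rewrite addn_eq0 => /andP[/eqP s1 /eqP s2].
have f1 : (size f <= 1)%N by case: (size f) s1 => [|[]].
rewrite (size1_polyC f1); exists f`_0`_0; congr (_%:P); apply: size1_polyC.
by have := max_size_coefXY f 0; case: (sizeY f) s2 => [|[|//]] // _; case: (size _).
Qed.

Lemma bidegree_gt0P f : (forall c, f <> bicst c) -> (0 < bidegree f)%N.
Proof. by move=> nc; rewrite lt0n; apply/eqP => /bidegree_eq0[c /nc]. Qed.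

Lemma horner_bicst_transcendental f (q : {poly L}) :
  (0 < bidegree f)%N -> (map_poly bicst q).[f] = 0 -> q = 0.
Proof.
move=> f1; elim/poly_ind: q => // q c IH.
rewrite rmorphD rmorphM /= map_polyX map_polyC /= hornerMXaddC => /eqP.
have f0 : f != 0 by apply: contraTneq f1 => ->; rewrite -(rmorph0 bicst) bidegree_bicst.
have [q0|q0] := eqVneq (map_poly bicst q).[f] 0.
  by rewrite q0 mul0r add0r bicst_eq0 => /eqP->; rewrite (IH q0) mul0r add0r.
rewrite addr_eq0 => /eqP e; exfalso; have := bidegreeM q0 f0.
by rewrite e -rmorphN bidegree_bicst => /esym/eqP; rewrite addn_eq0 -[bidegree f == _]negbK -lt0n f1 andbF.
Qed.

Definition content_dvd (f : {poly L}) (a : C) : Prop := forall i, f %| a`_i.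

Lemma content_dvdP f a : content_dvd f a <-> exists a', a = f%:P * a'.
Proof.
split=> [fa|[a' -> i]]; last by rewrite coefCM dvdp_mulr.
exists (\poly_(i < size a) (a`_i %/ f)); apply/polyP => i; rewrite coefCM coef_poly.
case: ltnP => [_|le_ai]; first by rewrite mulrC divpK.
by rewrite mulr0 nth_default.
Qed.

Lemma irreducible_prime (f x y : {poly L}) : irreducible_poly f ->
  f %| x * y -> (f %| x) \/ (f %| y).
Proof.
move=> irr_f fxy; have [co|nco] := boolP (coprimep f x).
  by right; rewrite -(Gauss_dvdpr _ co).
left; have := irr_f.2 (gcdp f x); rewrite -coprimep_def => /(_ nco (dvdp_gcdl _ _)).
by move=> /eqp_dvdl <-; apply: dvdp_gcdr.
Qed.

(** Gauss's lemma. [f] divides the product of the two constant terms, hence one of them; dropping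
    that term lowers the sum of the sizes. *)
Lemma irreducible_content_prime f a b : irreducible_poly f ->
  content_dvd f (a * b) -> content_dvd f a \/ content_dvd f b.
Proof.
move=> irr_f; have [n] := ubnP (size a + size b); elim: n a b => // n IH a b.
have [-> _ _|a0] := eqVneq a 0; first by left=> i; rewrite coef0 dvdp0.
have [-> _ _|b0] := eqVneq b 0; first by right=> i; rewrite coef0 dvdp0.
elim/poly_ind: a a0 => [/eqP//|a c _ a0]; elim/poly_ind: b b0 => [/eqP//|b d _ b0].
rewrite !size_MXaddC.
have -> : (a == 0) && (c == 0) = false.
  by apply: contraNF a0 => /andP[/eqP-> /eqP->]; rewrite mul0r addr0.
have -> : (b == 0) && (d == 0) = false.
  by apply: contraNF b0 => /andP[/eqP-> /eqP->]; rewrite mul0r addr0.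
rewrite addSn addnS !ltnS => leS fab.
have extX (h : C) e : content_dvd f h -> f %| e -> content_dvd f (h * 'X + e%:P).
  by move=> fh fe [|i]; rewrite coefD coefMX coefC /= ?add0r // addr0.
have dropX (h h' : C) e : f %| e -> content_dvd f ((h * 'X + e%:P) * h') -> content_dvd f (h * h').
  move=> fe fh i; have := fh i.+1.
  rewrite mulrDl mulrAC coefD coefMX coefCM /= dvdp_addl //; exact: dvdp_mulr.
have : f %| c * d by have := fab 0; rewrite coef0M !coefD !coefMX !coefC !add0r.
move=> /(irreducible_prime irr_f) [fc|fd].
  have := IH a (b * 'X + d%:P); case.
  - by rewrite size_MXaddC; case: ifP => _; lia.
  - exact: dropX fab.
  - by move=> fa; left; apply: extX.
  - by right.
have := IH (a * 'X + c%:P) b; case.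
- by rewrite size_MXaddC; case: ifP => _; lia.
- by move: fab; rewrite mulrC => /dropX; rewrite mulrC; apply.
- by left.
- by move=> fb; right; apply: extX.
Qed.

Lemma exists_irreducible_factor (c : {poly L}) : (1 < size c)%N ->
  exists2 f, irreducible_poly f & f %| c.
Proof.
move=> c1; pose P n := `[< exists2 f : {poly L}, size f = n.+2 & f %| c >].
have exP : exists n, P n.
  by exists (size c).-2; apply/asboolP; exists c => //; case: (size c) c1 => [|[]].
case: (ex_minnP exP) => n /asboolP[f fn fc] minn; exists f => //; split; first by rewrite fn.
move=> q q1 qf; have f0 : f != 0 by rewrite -size_poly_eq0 fn.
have q0 : q != 0 by apply: contraTneq qf => ->; rewrite dvd0p.
have [m qm] : exists m, size q = m.+2.
  have : size q != 0 by rewrite size_poly_eq0.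
  by case: (size q) q1 => [|[|m]] // _ _; exists m.
rewrite -dvdp_size_eqp // eqn_leq dvdp_leq // fn qm ltnS.
by apply: minn; apply/asboolP; exists q => //; apply: dvdp_trans fc.
Qed.

(** Pseudo-division gives identities only up to a factor [c] from the coefficient ring. It is
    removed one irreducible divisor at a time, each dividing [d] or [q] by Gauss's lemma. *)
Lemma clear_content (c : {poly L}) (F d q : C) : c != 0 -> c%:P * F = d * q ->
  exists c1 c2 d' q', [/\ c1 != 0, c2 != 0, d = c1%:P * d', q = c2%:P * q' & F = d' * q'].
Proof.
have [n] := ubnP (size c); elim: n c d q => // n IH c d q.
rewrite ltnS => le_cn c0 e; have [c1|c1] := leqP (size c) 1.
  have cE := size1_polyC c1; set x := c`_0 in cE.
  have x0 : x != 0 by apply: contraNneq c0 => x0; rewrite cE x0.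
  exists c, 1, (bicst x^-1 * d), q; rewrite oner_neq0 polyC1 mul1r; split=> //.
    by rewrite cE mulrA -(rmorphM bicst) mulfV // rmorph1 mul1r.
  by rewrite -mulrA -e cE mulrA -(rmorphM bicst) mulVf // rmorph1 mul1r.
have [f irr_f /dvdpP[c' cE]] := exists_irreducible_factor c1.
have f0 := irredp_neq0 irr_f; have fP0 : f%:P != 0 :> C by rewrite polyC_eq0.
have c'0 : c' != 0 by apply: contraNneq c0 => c'0; rewrite cE c'0 mul0r.
have lt_c'n : (size c' < n)%N.
  apply: leq_trans le_cn; rewrite cE size_mul //.
  by have := irr_f.1; case: (size f) => [|[|m]] // _; rewrite !addnS ltnS leq_addr.
have [] := @irreducible_content_prime f d q irr_f.
- by rewrite -e cE => i; rewrite coefCM -mulrA dvdp_mull // dvdp_mulr.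
- move=> /content_dvdP[d' dE].
  have [|c1' [c2 [d'' [q' [c10 c20 d'E qE FE]]]]] := IH c' d' q lt_c'n c'0.
    by apply: (mulfI fP0); rewrite mulrA -polyCM [f * _]mulrC -cE e dE mulrA.
  exists (f * c1'), c2, d'', q'; split=> //; first by rewrite mulf_neq0.
  by rewrite dE d'E polyCM mulrA.
- move=> /content_dvdP[q' qE].
  have [|c1' [c2 [d'' [q'' [c10 c20 dE q'E FE]]]]] := IH c' d q' lt_c'n c'0.
    by apply: (mulfI fP0); rewrite mulrA -polyCM [f * _]mulrC -cE e qE mulrCA.
  exists c1', (f * c2), d'', q''; split=> //; first by rewrite mulf_neq0.
  by rewrite qE q'E polyCM mulrA.
Qed.

(** True divisibility, whereas [%|] over the coefficient ring [{poly L}] holds up to a nonzero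
    factor of that ring. *)
Definition divides (F a : C) : Prop := exists c, a = F * c.

Definition indecomposable (F : C) : Prop := (0 < bidegree F)%N /\
  forall a b, F = a * b -> bidegree a = 0%N \/ bidegree b = 0%N.

Lemma bidegree_size (f : C) : (1 < size f)%N -> (0 < bidegree f)%N.
Proof. by rewrite /bidegree; case: (size f) => [|[|n]]. Qed.

Lemma divides_of_dvdp F a : indecomposable F -> (1 < size F)%N -> F %| a -> divides F a.
Proof.
move=> [_ irrF] F1 /Pdiv.WeakIdomain.dvdpP[[c q] /= c0]; rewrite -mul_polyC [q * _]mulrC => e.
have [c1 [c2 [F' [q' [c10 c20 FE qE aE]]]]] := clear_content c0 e.
have sF' : (1 < size F')%N by move: F1; rewrite FE size_Cmul.
have [/bidegree_eq0[x xE]|F'0] := irrF _ _ FE; last by have := bidegree_size sF'; rewrite F'0.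
have x0 : x != 0 by rewrite -bicst_eq0 -xE polyC_eq0.
exists (bicst x^-1 * q').
by rewrite aE FE xE mulrACA -(rmorphM bicst) mulfV // rmorph1 mul1r.
Qed.

(** If [F] is free of the outer variable, Gauss's lemma applies. Otherwise [F] is compared with [a]
    by a gcd taken up to coefficients: either they are coprime and [F] divides [b], or the gcd has
    positive degree and, once contents are cleared, agrees with [F] up to a constant. *)
Lemma indecomposable_prime F a b : indecomposable F -> divides F (a * b) ->
  divides F a \/ divides F b.
Proof.
move=> indF [c abE]; have [F_gt0 irrF] := indF; have [F1|F1] := leqP (size F) 1.
  have FE := size1_polyC F1; set f := F`_0 in FE.
  have sf : (1 < size f)%N.
    rewrite ltnNge; apply/negP => f1; move: F_gt0.
    by rewrite FE (size1_polyC f1) (bidegree_bicst f`_0).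
  have f0 : f != 0 by rewrite -size_poly_gt0 ltnW.
  have size0 (x : {poly L}) : x != 0 -> bidegree x%:P = 0%N -> size x = 1%N.
    move=> x0 /bidegree_eq0[y /polyC_inj xE]; move: x0; rewrite xE polyC_eq0 => y0.
    by rewrite size_polyC y0.
  have irr_f : irreducible_poly f.
    split=> // q q1 qf; have /dvdpP[r fE] := qf.
    have /andP[r0 q0] : (r != 0) && (q != 0) by move: f0; rewrite fE mulf_eq0 negb_or.
    have [|/(size0 _ r0) rs|/(size0 _ q0) qs] := irrF r%:P q%:P.
    - by rewrite FE fE polyCM.
    - by rewrite -dvdp_size_eqp // fE size_mul // rs.
    - by rewrite qs in q1.
  have [] := @irreducible_content_prime f a b irr_f.
  - by apply/content_dvdP; exists c; rewrite -FE.
  - by move=> /content_dvdP[a' aE]; left; exists a'; rewrite FE.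
  - by move=> /content_dvdP[b' bE]; right; exists b'; rewrite FE.
have F0 : F != 0 by rewrite -size_poly_gt0 ltnW.
have Fab : F %| a * b by rewrite abE dvdp_mulr.
pose d := gcdp F a; have [co|nco] := boolP (coprimep F a).
  by right; apply: divides_of_dvdp => //; rewrite -(Gauss_dvdpr _ co).
have d0 : d != 0 by rewrite gcdp_eq0 (negPf F0).
have d1 : (1 < size d)%N.
  by rewrite ltn_neqAle size_poly_gt0 d0 eq_sym andbT.
have /Pdiv.WeakIdomain.dvdpP[[e q] /= e0] : d %| F := dvdp_gcdl _ _.
rewrite -mul_polyC [q * d]mulrC => dq.
have [c1 [c2 [d' [q' [c10 c20 dE qE FE]]]]] := clear_content e0 dq.
left; apply: divides_of_dvdp => //.
have d'1 : (1 < size d')%N by move: d1; rewrite dE size_Cmul.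
have [d'0|/bidegree_eq0[x xE]] := irrF _ _ FE.
  by have := bidegree_size d'1; rewrite d'0.
have x0 : x != 0.
  by apply: contraNneq F0 => x0; rewrite FE xE x0 rmorph0 mulr0.
have -> : F = x%:P *: d' by rewrite FE xE mulrC mul_polyC.
rewrite dvdpZl ?polyC_eq0 //; apply: dvdp_trans (dvdp_gcdr F a).
by rewrite -/d dE mul_polyC dvdpZr.
Qed.
End Bivariate.

(** * Algebraic dependence by counting dimensions *)

Lemma wide_system_ker (L : fieldType) (I J : finType) (f : I -> J -> L) :
  (#|J| < #|I|)%N -> exists2 x : I -> L, exists i, x i != 0 & forall j, \sum_i x i * f i j = 0.
Proof.
move=> ltJI; pose M := \matrix_(i < #|I|, j < #|J|) f (enum_val i) (enum_val j).
have : kermx M != 0.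
  rewrite -mxrank_eq0 mxrank_ker subn_eq0 -ltnNge.
  exact: leq_ltn_trans (rank_leq_col M) ltJI.
move=> /rowV0Pn[v /sub_kermxP vM v0]; exists (fun i => v 0 (enum_rank i)).
  have /rV0Pn[i vi] := v0; exists (enum_val i); by rewrite enum_valK.
move=> j; have /rowP/(_ (enum_rank j)) := vM; rewrite !mxE => vMj; rewrite -[RHS]vMj.
rewrite [RHS](reindex_onto enum_rank enum_val) /=; last by move=> i _; rewrite enum_valK.
rewrite [RHS](eq_bigl xpredT) => [|i]; last by rewrite enum_rankK eqxx.
by apply: eq_bigr => i _; rewrite !mxE !enum_rankK.
Qed.

Section Dependence.
Variable L : fieldType.
Local Notation C := {poly {poly L}}.

Definition bisize_le (n : nat) (f : C) := (size f <= n.+1)%N && (size (swapXY f) <= n.+1)%N.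

Lemma bisize_leM m n f h : bisize_le m f -> bisize_le n h -> bisize_le (m + n) (f * h).
Proof.
move=> /andP[f1 f2] /andP[h1 h2]; rewrite /bisize_le rmorphM /=.
have aux (x y : nat) : (x <= m.+1 -> y <= n.+1 -> (x + y).-1 <= (m + n).+1)%N by lia.
by apply/andP; split; apply: leq_trans (size_polyMleq _ _) _; apply: aux.
Qed.

Lemma bisize_leX m n f : bisize_le m f -> bisize_le (n * m) (f ^+ n).
Proof.
move=> fm; elim: n => [|n IH]; last by rewrite exprS mulSn bisize_leM.
by rewrite expr0 /bisize_le rmorph1 !size_poly1.
Qed.

Lemma bisize_leW m n f : (m <= n)%N -> bisize_le m f -> bisize_le n f.
Proof. by move=> mn /andP[f1 f2]; rewrite /bisize_le (leq_trans f1) ?(leq_trans f2). Qed.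

Lemma bisize_le_max f : exists n, bisize_le n f.
Proof. by exists (size f + size (swapXY f))%N; rewrite /bisize_le !leqW ?leq_addr ?leq_addl. Qed.

Lemma coef_bisize n f i j : bisize_le n f -> (n < i)%N || (n < j)%N -> f`_i`_j = 0.
Proof.
move=> /andP[f1 f2] /orP[ni|nj]; first by rewrite [f`_i]nth_default ?coef0 // (leq_trans f1).
by rewrite -coef_swapXY [(swapXY f)`_j]nth_default ?coef0 // (leq_trans f2).
Qed.

(* Counting monomials: those of degree less than [m] in each variable number [m ^ 3],
   while their values live in a space of dimension [O(m ^ 2)]. *)
Lemma three_dependent (a b c : C) : exists m (x : 'I_m * 'I_m * 'I_m -> L),
  (exists t, x t != 0) /\ \sum_t bicst (x t) * (a ^+ t.1.1 * b ^+ t.1.2 * c ^+ t.2) = 0.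
Proof.
have [[da ha] [db hb] [dc hc]] := And3 (bisize_le_max a) (bisize_le_max b) (bisize_le_max c).
pose d := (da + db + dc)%N.
have {}ha : bisize_le d a by apply: bisize_leW ha; rewrite /d; lia.
have {}hb : bisize_le d b by apply: bisize_leW hb; rewrite /d; lia.
have {}hc : bisize_le d c by apply: bisize_leW hc; rewrite /d; lia.
(* Exponents stay below [m], so [N] bounds both degrees of each product. As [N + 1 <= m (3d + 1)],
   at most [m^2 (3d + 1)^2 < m^3] coefficients have to vanish. *)
pose m := ((3 * d + 1) ^ 2).+1; pose N := (3 * (m * d))%N.
pose mon (t : 'I_m * 'I_m * 'I_m) : C := a ^+ t.1.1 * b ^+ t.1.2 * c ^+ t.2.
have monN t : bisize_le N (mon t).
  case: t => -[i j] l; apply: (@bisize_leW (i * d + j * d + l * d)).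
    have h (k : 'I_m) : (k * d <= m * d)%N by rewrite leq_mul2r ltnW ?orbT.
    by have := h i; have := h j; have := h l; rewrite /N; lia.
  by rewrite !bisize_leM ?bisize_leX.
pose f t (p : 'I_N.+1 * 'I_N.+1) := (mon t)`_p.1`_p.2.
have [|x xt xf] := @wide_system_ker L _ _ f.
  rewrite !card_prod !card_ord; have : (N.+1 <= m * (3 * d + 1))%N by rewrite /N /m; nia.
  move=> le1; apply: (@leq_ltn_trans ((m * (3 * d + 1)) * (m * (3 * d + 1)))).
    exact: leq_mul.
  have -> : (m * (3 * d + 1) * (m * (3 * d + 1)) = m * m * ((3 * d + 1) ^ 2))%N by ring.
  by rewrite ltn_pmul2l // muln_gt0.
exists m, x; split=> //; apply/polyP => i; apply/polyP => j; rewrite !coef0 coef_sum coef_sum.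
have [/andP[iN jN]|] := boolP ((i < N.+1)%N && (j < N.+1)%N).
  have := xf (Ordinal iN, Ordinal jN); rewrite /f /= => xf0.
  by rewrite -[RHS]xf0; apply: eq_bigr => t _; rewrite !coefCM.
rewrite negb_and -!leqNgt => out; rewrite big1 // => t _.
by rewrite !coefCM (coef_bisize (monN t)) ?mulr0.
Qed.
End Dependence.

Lemma bidegreeB_bicst (L : fieldType) (f : {poly {poly L}}) c :
  (bidegree (f - bicst c) <= bidegree f)%N.
Proof.
have h (S : idomainType) (q : {poly S}) d : ((size (q - d%:P)%R).-1 <= (size q).-1)%N.
  have := size_polyD q (- d%:P); rewrite size_polyN size_polyC leq_max.
  case: (d != 0) => /orP[] le; do ?by rewrite -!subn1 leq_sub2r.
    by move: le; case: (size _) => [|[]].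
  by move: le; case: (size _).
rewrite /bidegree leq_add ?h // !sizeYE raddfB /= swapXY_polyC map_polyC /=; exact: h.
Qed.

(** * The kernel of the derivation over the fraction field *)

Section Kernel.
Variables (R : idomainType) (B : comAlgType R) (K : fieldType) (fr : {rmorphism R -> K}).
Hypothesis fr_eq0 : forall r, (fr r == 0) = (r == 0).
Hypothesis fr_repr : forall x, exists a s, s != 0 /\ x = fr a / fr s.
Local Notation C := {poly {poly K}}.
Variable g : {rmorphism B -> C}.
Hypothesis g_inj : injective g.
Hypothesis gZ : forall r b, g (r *: b) = bicst (fr r) * g b.
Hypothesis g_surj : forall c, exists s b, s != 0 /\ bicst (fr s) * c = g b.
Hypothesis char0 : forall n, n.+1%:R != 0 :> R.
Variable D : derivation B.
Hypothesis D_nilpotent : locally_nilpotent D.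

Lemma g_eq0 b : (g b == 0) = (b == 0).
Proof. by rewrite -(inj_eq g_inj) rmorph0. Qed.

Lemma alg_mulf_eq0 (x y : B) : (x * y == 0) = (x == 0) || (y == 0).
Proof. by rewrite -g_eq0 rmorphM mulf_eq0 !g_eq0. Qed.

Lemma alg_scaler_eq0 r (x : B) : (r *: x == 0) = (r == 0) || (x == 0).
Proof. by rewrite -g_eq0 gZ mulf_eq0 g_eq0 bicst_eq0 fr_eq0. Qed.

Lemma alg_mulrn_eq0 (x : B) n : (x *+ n.+1 == 0) = (x == 0).
Proof. by rewrite -scaler_nat alg_scaler_eq0 (negPf (char0 n)). Qed.

Lemma iter_der0 n : iter n D 0 = 0.
Proof. by elim: n => //= n ->; rewrite raddf0. Qed.

Lemma iter_derD n x y : iter n D (x + y) = iter n D x + iter n D y.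
Proof. by elim: n => //= n ->; rewrite raddfD. Qed.

Lemma iter_derB n x y : iter n D (x - y) = iter n D x - iter n D y.
Proof. by elim: n => //= n ->; rewrite raddfB. Qed.

Lemma iter_derMl n a x : D a = 0 -> iter n D (a * x) = a * iter n D x.
Proof. by move=> a0; elim: n => //= n ->; rewrite der_leibniz a0 mul0r add0r. Qed.

(** All other terms of the Leibniz expansion vanish; the induction is Pascal's rule. In
    characteristic zero this makes the nilpotency degree additive on products. *)
Lemma leibniz_top m n x y : iter m.+1 D x = 0 -> iter n.+1 D y = 0 ->
  iter (m + n) D (x * y) = (iter m D x * iter n D y) *+ 'C(m + n, m).
Proof.
move: {2}(m + n)%N (erefl (m + n)%N) => k; elim: k m n x y => [|k IH] [|m] [|n] x y //.
- by move=> _ x0 y0; rewrite add0n iter_derMl // bin0 mulr1n.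
- by move=> _ x0 y0; rewrite addn0 binn mulr1n [x * y]mulrC iter_derMl // mulrC.
move=> [e] x0 y0; rewrite addSn iterSr der_leibniz iter_derD.
have -> : iter (m + n.+1) D (D x * y) = (iter m.+1 D x * iter n.+1 D y) *+ 'C(m + n.+1, m).
  by rewrite (IH m n.+1 (D x) y e) -?iterSr.
have -> : iter (m + n.+1) D (x * D y) = (iter m.+1 D x * iter n.+1 D y) *+ 'C(m + n.+1, m.+1).
  by rewrite -addSnnS (IH m.+1 n x (D y)) -?iterSr // addSnnS.
by rewrite -mulrnDr addnC -binS.
Qed.

Lemma der_degree b : b != 0 -> exists n, iter n D b != 0 /\ iter n.+1 D b = 0.
Proof.
move=> b0; have exn : exists n, iter n D b == 0.
  by have [n /eqP] := D_nilpotent b; exists n.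
case: (ex_minnP exn) => -[|n] /eqP bn minn; first by rewrite /= in bn; rewrite bn eqxx in b0.
by exists n; split=> //; apply/eqP => /eqP /minn; rewrite ltnn.
Qed.

(** Nilpotency degrees add up on a nonzero product, since the binomial coefficient is nonzero in
    [R]; a product of degree zero therefore has factors of degree zero. *)
Lemma der_factorial_closed x y : x * y != 0 -> D (x * y) = 0 -> D x = 0.
Proof.
move=> xy0 Dxy; move: (xy0); rewrite alg_mulf_eq0 negb_or => /andP[x0 y0].
have [[m [mx mx1]] [n [ny ny1]]] := (der_degree x0, der_degree y0).
have := leibniz_top mx1 ny1; case: m mx mx1 => [|m] mx mx1; first by [].
rewrite addSn iterSr Dxy iter_der0 => /esym/eqP.
have : (0 < 'C((m + n).+1, m.+1))%N by rewrite bin_gt0; lia.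
case: ('C(_, _)) => // k _; rewrite alg_mulrn_eq0 alg_mulf_eq0.
by rewrite (negPf mx) (negPf ny).
Qed.

Lemma der_scale_eq0 r x : r != 0 -> D (r *: x) = 0 -> D x = 0.
Proof.
by move=> r0 /eqP; rewrite linearZ alg_scaler_eq0 (negPf r0) => /eqP.
Qed.

Lemma der1 : D 1 = 0.
Proof. by apply: (addrI (D 1)); rewrite addr0 -{3}[1]mulr1 der_leibniz mulr1 mul1r. Qed.

Lemma der_exp a n : D a = 0 -> D (a ^+ n) = 0.
Proof.
move=> a0; elim: n => [|n IH]; first by rewrite expr0 der1.
by rewrite exprS der_leibniz a0 IH mul0r mulr0 addr0.
Qed.

Lemma der_mul a b : D a = 0 -> D b = 0 -> D (a * b) = 0.
Proof. by move=> a0 b0; rewrite der_leibniz a0 b0 mul0r mulr0 addr0. Qed.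

(** In a relation over the kernel, the part divisible by [c] equals minus the constant term and so
    lies in the kernel; were it nonzero, factorial closedness would put [c] in the kernel too. *)
Lemma der_transcendental (q : {poly B}) c : D c != 0 -> (forall i, D q`_i = 0) ->
  q.[c] = 0 -> q = 0.
Proof.
move=> Dc; elim/poly_ind: q => // q a IH Dq.
have Dq' i : D q`_i = 0 by have := Dq i.+1; rewrite coefD coefMX coefC /= addr0.
have Da : D a = 0 by have := Dq 0; rewrite coefD coefMX coefC /= add0r.
rewrite hornerMXaddC => /eqP; rewrite addr_eq0 => /eqP e.
have qc0 : q.[c] = 0.
  apply/eqP/negPn/negP => qc0; suff : D c = 0 by apply/eqP.
  have nz : c * q.[c] != 0.
    rewrite alg_mulf_eq0 (negPf qc0) orbF; by apply: contraNneq Dc => ->; rewrite raddf0.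
  by apply: der_factorial_closed nz _; rewrite mulrC e raddfN /= Da oppr0.
have q0 := IH Dq' qc0; move: e; rewrite q0 horner0 !mul0r => /esym/eqP.
by rewrite oppr_eq0 => /eqP->; rewrite addr0.
Qed.

Definition generic_kernel (f : C) : Prop :=
  exists s b, [/\ s != 0, D b = 0 & bicst (fr s) * f = g b].

Lemma generic_kernel_g a : D a = 0 -> generic_kernel (g a).
Proof. by move=> Da; exists 1, a; rewrite oner_neq0 rmorph1 rmorph1 mul1r. Qed.

Lemma gC r : g r%:A = bicst (fr r).
Proof. by rewrite gZ rmorph1 mulr1. Qed.

Lemma generic_kernelC c : generic_kernel (bicst c).
Proof.
have [a [s [s0 ->]]] := fr_repr c; exists s, a%:A; split=> //.
  by rewrite linearZ /= der1 scaler0.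
by rewrite gC -rmorphM mulrC divfK // fr_eq0.
Qed.

Lemma generic_kernelD f h : generic_kernel f -> generic_kernel h -> generic_kernel (f + h).
Proof.
move=> [s [a [s0 Da fE]]] [t [b [t0 Db hE]]].
exists (s * t), (t *: a + s *: b); split; first by rewrite mulf_neq0.
  by rewrite raddfD /= !linearZ /= Da Db !scaler0 addr0.
by rewrite rmorphD !gZ -fE -hE !rmorphM /=; ring.
Qed.

Lemma generic_kernel_factor f h : f * h != 0 -> generic_kernel (f * h) -> generic_kernel f.
Proof.
move=> fh0 [s [a [s0 Da fhE]]].
have [t [b [t0 fE]]] := g_surj f; have [u [c [u0 hE]]] := g_surj h.
exists t, b; split=> //.
have e : s *: (b * c) = (t * u) *: a.
  by apply: g_inj; rewrite !gZ (rmorphM g) -fE -hE -fhE !rmorphM /=; ring.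
have bc0 : b * c != 0.
  by rewrite -g_eq0 (rmorphM g) -fE -hE mulrACA mulf_neq0 // mulf_neq0 // bicst_eq0 fr_eq0.
apply: (@der_factorial_closed b c bc0); apply: (der_scale_eq0 s0).
by rewrite e linearZ /= Da scaler0.
Qed.

(** The value [P(f, h)]: the outer variable goes to [f], the inner one to [h]. *)
Definition eval2 (f h : C) (P : {poly {poly K}}) : C :=
  (map_poly (horner_eval h \o map_poly (@bicst K)) P).[f].

Lemma eval2_MXaddC f h P c : eval2 f h (P * 'X + c%:P) = eval2 f h P * f + (map_poly (@bicst K) c).[h].
Proof. by rewrite /eval2 rmorphD rmorphM /= map_polyX map_polyC /= hornerMXaddC. Qed.

Lemma eval2_sum f h (J : finType) (p : pred J) (c : J -> K) (i j : J -> nat) :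
  eval2 f h (\sum_(t | p t) ((c t)%:P * 'X^(j t))%:P * 'X^(i t))
  = \sum_(t | p t) bicst (c t) * h ^+ j t * f ^+ i t.
Proof.
rewrite /eval2 rmorph_sum horner_sum; apply: eq_bigr => t _.
rewrite rmorphM /= map_polyC map_polyXn /= hornerM hornerC hornerXn; congr (_ * _).
by rewrite rmorphM /= map_polyC map_polyXn /= /horner_eval hornerM hornerC hornerXn.
Qed.

Hypothesis D_nonzero : exists b, D b != 0.

(** Three elements of [K[X, Y]] are always dependent. In a relation between two kernel elements and
    some [c] outside the kernel, the transcendence of [c] over the kernel separates the powers of
    [c] and leaves a relation between the first two. *)
Lemma kernel_dependent f h : generic_kernel f -> generic_kernel h ->
  exists2 P, P != 0 & eval2 f h P = 0.
Proof.
move=> [s [a [s0 Da fE]]] [t [b [t0 Db hE]]]; have [c Dc] := D_nonzero.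
have [m [x [[i0 xi0] dep]]] := three_dependent (g a) (g b) (g c).
(* A common denominator brings the relation into [B], where [D] acts. *)
have [d [d0 dx]] : exists d : R, d != 0 /\ forall i, exists r, fr d * x i = fr r.
  have /choice[n nP] i := fr_repr (x i); have /choice[e eP] i := nP i.
  exists (\prod_i e i); split; first by apply/prodf_neq0 => i _; case: (eP i).
  move=> i; exists (n i * \prod_(j | j != i) e j); rewrite (eP i).2 (bigD1 i) //= !(rmorphM fr).
  by rewrite mulrAC [X in X * _]mulrC divfK ?fr_eq0 ?(eP i).1.
have [r rE] := choice dx.
pose q : {poly B} := \sum_i (r i *: (a ^+ i.1.1 * b ^+ i.1.2))%:P * 'X^(i.2 : 'I_m).
have coef_q l : q`_l = \sum_(i : 'I_m * 'I_m * 'I_m | (i.2 : nat) == l) r i *: (a ^+ i.1.1 * b ^+ i.1.2).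
  rewrite coef_sum [RHS]big_mkcond; apply: eq_bigr => i _.
  by rewrite coefCM coefXn eq_sym; case: eqP => _; rewrite ?mulr1 ?mulr0.
have q0 : q = 0.
  apply: (der_transcendental Dc) => [l|].
    rewrite coef_q raddf_sum big1 //= => i _.
    by rewrite linearZ /= der_mul ?scaler0 ?der_exp.
  apply: g_inj; rewrite horner_sum !rmorph_sum rmorph0 -[RHS](mulr0 (bicst (fr d))) -[X in _ = _ * X]dep.
  rewrite mulr_sumr; apply: eq_bigr => i _.
  by rewrite hornerM hornerC hornerXn rmorphM gZ !rmorphM !rmorphXn -rE rmorphM /= !mulrA.
have ddep : \sum_(i : 'I_m * 'I_m * 'I_m | (i.2 : nat) == i0.2) bicst (x i) * (g a ^+ i.1.1 * g b ^+ i.1.2) = 0.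
  apply/eqP; have dC0 : bicst (fr d) != 0 by rewrite bicst_eq0 fr_eq0.
  rewrite -(mulrI_eq0 _ (mulfI dC0)) mulr_sumr; apply/eqP.
  have := congr1 g (coef_q i0.2); rewrite q0 coef0 rmorph0 rmorph_sum => e.
  rewrite [RHS]e; apply: eq_bigr => i _.
  by rewrite gZ !rmorphM !rmorphXn -rE rmorphM /= !mulrA.
(* [g a] and [g b] are [s f] and [t h], so powers of [s] and [t] enter the coefficients. The index
   [i0], whose coefficient is nonzero, selects the power of [c] that is read off. *)
pose w i := x i * fr s ^+ i.1.1 * fr t ^+ i.1.2.
pose P : {poly {poly K}} := \sum_(i : 'I_m * 'I_m * 'I_m | (i.2 : nat) == i0.2)
  ((w i)%:P * 'X^(i.1.2 : 'I_m))%:P * 'X^(i.1.1 : 'I_m).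
exists P; last first.
  rewrite /P eval2_sum -[RHS]ddep; apply: eq_bigr => i _.
  rewrite -fE -hE !rmorphM !rmorphXn /= !exprMn.
  by ring.
have : P`_i0.1.1`_i0.1.2 = w i0.
  rewrite /P !coef_sum (bigD1 i0) //= !(coefCM, coefXn) !eqxx mulr1 coefCM coefXn eqxx mulr1.
  rewrite big1 ?addr0 // => i /andP[/eqP i2 ii0].
  rewrite coefCM coefXn; have [e1|] := eqVneq (i0.1.1 : nat) i.1.1; last by rewrite mulr0 coef0.
  rewrite mulr1 coefCM coefXn; have [e2|] := eqVneq (i0.1.2 : nat) i.1.2; last by rewrite mulr0.
  case/eqP: ii0; move: i2 e1 e2; case: i => [[i j] k]; case: (i0) => [[i' j'] k'] /=.
  by move=> /val_inj -> /val_inj -> /val_inj ->.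
move=> Pw; apply: contraTneq xi0 => P0; move: Pw; rewrite P0 !coef0 => /esym/eqP.
by rewrite !mulf_eq0 !expf_eq0 !fr_eq0 (negPf s0) (negPf t0) !andbF !orbF negbK.
Qed.
(** While the constant term of [P] is zero, a factor [f] can be cancelled from the relation; the
    first nonzero constant term is the wanted [c]. *)
Lemma eval2_root_divides f h P : f != 0 -> P != 0 -> eval2 f h P = 0 ->
  exists2 c : {poly K}, c != 0 & divides f (map_poly (@bicst K) c).[h].
Proof.
move=> f0; elim/poly_ind: P => [/eqP//|P c IH]; rewrite eval2_MXaddC.
have [-> P0|c0 _ e] := eqVneq c 0.
  rewrite rmorph0 horner0 addr0 => /eqP; rewrite mulf_eq0 (negPf f0) orbF => /eqP.
  by apply: IH; apply: contraNneq P0 => ->; rewrite mul0r addr0.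
exists c => //; exists (- eval2 f h P).
by apply/eqP; rewrite mulrN -addr_eq0 addrC mulrC e.
Qed.

Definition origin (f : C) : K := f.[0].[0].
HB.instance Definition _ := GRing.RMorphism.copy origin (horner_eval 0 \o horner_eval (0 : {poly K})).

Lemma origin_bicst c : origin (bicst c) = c.
Proof. by rewrite /origin !hornerC. Qed.

(** At the origin [c(h)] takes the value of the constant term of [c], which must be zero because [F]
    vanishes there. So a factor [h] splits off, and the prime [F] divides it or the rest. *)
Lemma indecomposable_dvd_root F h (c : {poly K}) : indecomposable F ->
  origin F = 0 -> origin h = 0 -> c != 0 -> divides F (map_poly (@bicst K) c).[h] -> divides F h.
Proof.
move=> indF F0 h0; elim/poly_ind: c => [/eqP//|c x IH].
rewrite rmorphD rmorphM /= map_polyX map_polyC /= hornerMXaddC => c0 dvd.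
have x0 : x = 0.
  have [y e] := dvd; have := congr1 origin e.
  by rewrite rmorphD !rmorphM /= h0 F0 mulr0 mul0r add0r origin_bicst.
move: dvd c0; rewrite x0 rmorph0 !addr0 => /(indecomposable_prime indF)[dvd c0|//].
by apply: IH dvd; apply: contraNneq c0 => ->; rewrite mul0r.
Qed.

Lemma generic_kernelB_bicst f c : generic_kernel f -> generic_kernel (f - bicst c).
Proof. by move=> kf; rewrite -rmorphN; apply: generic_kernelD => //; apply: generic_kernelC. Qed.

(* The minimal degree makes [F] irreducible, hence prime; a relation between [F] and
   [h], both vanishing at the origin, then forces [F] to divide [h]. *)
Lemma generic_kernel_generator : (exists2 f, generic_kernel f & (0 < bidegree f)%N) ->
  exists F, [/\ generic_kernel F, (0 < bidegree F)%N &
    forall h, generic_kernel h -> exists q : {poly K}, h = (map_poly (@bicst K) q).[F]].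
Proof.
move=> exf; pose P n := `[< exists f, [/\ generic_kernel f, bidegree f = n.+1 & origin f = 0] >].
have exP : exists n, P n.
  have [f kf f1] := exf; exists (bidegree (f - bicst (origin f))).-1.
  apply/asboolP; exists (f - bicst (origin f)); split.
  - exact: generic_kernelB_bicst.
  - rewrite prednK // bidegree_gt0P // => c e; move: f1.
    by rewrite -[f](subrK (bicst (origin f))) e -rmorphD bidegree_bicst.
  - by rewrite rmorphB /= origin_bicst subrr.
case: (ex_minnP exP) => n /asboolP[F [kF Fn F0]] minn.
have F1 : (0 < bidegree F)%N by rewrite Fn.
have nzF : F != 0 by apply: contraTneq F1 => ->; rewrite -(rmorph0 (@bicst K)) bidegree_bicst.
(* One factor vanishes at the origin and is in the kernel, so by minimality its degree is at least
   that of [F]; the other factor is constant. *)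
have indF : indecomposable F.
  split=> // a b FE; have := nzF; rewrite FE mulf_eq0 negb_or => /andP[a0 b0].
  have ka : generic_kernel a by apply: (@generic_kernel_factor a b); rewrite -FE.
  have kb : generic_kernel b by apply: (@generic_kernel_factor b a); rewrite mulrC -FE.
  have small x : x != 0 -> generic_kernel x -> origin x = 0 -> (bidegree F <= bidegree x)%N.
    move=> x0 kx ox; have [d [xE|xd]] : exists d, bidegree x = 0%N \/ bidegree x = d.+1.
    - by case: (bidegree x) => [|d]; [exists 0%N; left | exists d; right].
    - have [c cE] := bidegree_eq0 xE; case/eqP: x0.
      by rewrite cE; move: ox; rewrite cE origin_bicst => ->; rewrite rmorph0.
    - by rewrite Fn xd ltnS; apply: minn; apply/asboolP; exists x.
  have := F0; rewrite FE rmorphM => /eqP; rewrite mulf_eq0 => /orP[] /eqP o0; [right|left].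
  - by have := small _ a0 ka o0; rewrite FE bidegreeM //; lia.
  - by have := small _ b0 kb o0; rewrite FE bidegreeM //; lia.
exists F; split=> // h kh.
have [m] := ubnP (bidegree h); elim: m h kh => // m IH h kh hm.
pose h0 := h - bicst (origin h).
have hE : h = h0 + bicst (origin h) by rewrite subrK.
have kh0 : generic_kernel h0 by apply: generic_kernelB_bicst.
have oh0 : origin h0 = 0 by rewrite rmorphB /= origin_bicst subrr.
have [h00|nzh0] := eqVneq h0 0.
  by exists (origin h)%:P; rewrite {1}hE h00 add0r map_polyC hornerC.
have [P2 P20 eP2] := kernel_dependent kF kh0.
have [c c0 dvd] := eval2_root_divides nzF P20 eP2.
(* The quotient [h'] of [h0] by [F] stays in the kernel by factorial closedness and has smaller
   degree, so the induction applies to it. *)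
have [h' h'E] := indecomposable_dvd_root indF F0 oh0 c0 dvd.
have nzh' : h' != 0 by apply: contraNneq nzh0 => h'0; rewrite h'E h'0 mulr0.
have kh' : generic_kernel h' by apply: (@generic_kernel_factor h' F); rewrite mulrC -h'E.
have [|q qE] := IH h' kh'.
  have := bidegreeM nzF nzh'; rewrite -h'E.
  have := bidegreeB_bicst h (origin h); rewrite -/h0; lia.
exists (q * 'X + (origin h)%:P).
by rewrite {1}hE h'E qE rmorphD rmorphM /= map_polyX map_polyC /= hornerMXaddC mulrC.
Qed.

Lemma iter_der_exp s n : D (D s) = 0 -> iter n D (s ^+ n) = D s ^+ n *+ n`!.
Proof.
move=> DDs; suff : iter n.+1 D (s ^+ n) = 0 /\ iter n D (s ^+ n) = D s ^+ n *+ n`! by case.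
elim: n => [|n [IH0 IH]]; first by rewrite expr0 /= der1 mulr1n.
have e : iter n.+1 D (s ^+ n.+1) = D s ^+ n.+1 *+ n.+1`!.
  have := leibniz_top (m := n) (n := 1) IH0 DDs; rewrite addn1 -exprSr => -> /=.
  by rewrite IH binSn mulrnAl -exprSr -mulrnA factS mulnC.
by split=> //; rewrite iterS e raddfMn /= der_exp // mul0rn.
Qed.

(** If the kernel were only constants, some [s] would have a nonzero constant derivative, and
    subtracting multiples of its powers would make every element a polynomial in [s]. The two
    variables cannot both be polynomials in one element. *)
Lemma exists_nonconstant_kernel : exists2 f, generic_kernel f & (0 < bidegree f)%N.
Proof.
apply: contrapT => noker.
have const a : D a = 0 -> exists c, g a = bicst c.
  move=> Da; apply: bidegree_eq0; apply/eqP; rewrite -leqn0 leqNgt; apply/negP => a1.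
  by apply: noker; exists (g a) => //; apply: generic_kernel_g.
have [s [Ds DDs]] : exists s, D s != 0 /\ D (D s) = 0.
  have [b Db] := D_nonzero; have [n [bn bn1]] := der_degree Db.
  have e : D (iter n D b) = iter n D (D b) by rewrite -iterSr.
  by exists (iter n D b); rewrite e.
have [phi phiE] := const _ DDs.
have phi0 : phi != 0 by rewrite -bicst_eq0 -phiE g_eq0.
have charK n : n.+1%:R != 0 :> K by rewrite -(rmorph_nat fr) fr_eq0.
have span n b : iter n D b = 0 -> exists q : {poly K}, g b = (map_poly (@bicst K) q).[g s].
  elim: n b => [|n IH] b bn; first by exists 0; rewrite [b]bn !rmorph0 horner0.
  have [gam gamE] := const _ bn.
  (* [D^n] sends [s^n] to [n! (D s)^n], so with these multipliers the [n]-th derivatives cancel. *)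
  pose b' := (D s ^+ n *+ n`!) * b - iter n D b * s ^+ n.
  have [|q qE] := IH b'.
    rewrite iter_derB (iter_derMl _ _ bn) iter_der_exp // iter_derMl.
      by rewrite mulrC subrr.
    by rewrite raddfMn /= der_exp // mul0rn.
  pose d := phi ^+ n * n`!%:R.
  have d0 : d != 0.
    by rewrite mulf_neq0 ?expf_neq0 //; have := fact_gt0 n; case: (n`!).
  have dE : bicst d = bicst phi ^+ n *+ n`!.
    by rewrite /d rmorphM rmorphXn rmorph_nat mulr_natr.
  have gb' : g b' = bicst d * g b - bicst gam * g s ^+ n.
    by rewrite /b' (rmorphB g) !(rmorphM g) (rmorphMn g) !(rmorphXn g) phiE gamE dE.
  exists (d^-1 *: (q + gam *: 'X^n)).
  rewrite map_polyZ hornerZ rmorphD /= map_polyZ map_polyXn hornerD hornerZ hornerXn -qE.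
  by rewrite gb' subrK mulrA -rmorphM mulVf // rmorph1 mul1r.
have all c : exists q : {poly K}, c = (map_poly (@bicst K) q).[g s].
  have [t [b [t0 e]]] := g_surj c; have [n /span[q qE]] := D_nilpotent b.
  exists ((fr t)^-1 *: q); rewrite map_polyZ hornerZ -qE -e mulrA -rmorphM.
  by rewrite mulVf ?fr_eq0 // rmorph1 mul1r.
have [P PE] := all 'X%:P; have [Q QE] := all 'X.
(* If [g s] is free of the outer variable, then so is every polynomial in it. Otherwise the inner
   variable, up to a constant, would be a multiple of [g s] and have positive outer degree. *)
have [s1|s1] := leqP (size (g s)) 1.
  have : (size ('X : C) <= 1)%N; last by rewrite size_polyX.
  rewrite QE (size1_polyC s1); set y := (g s)`_0.
  suff -> : (map_poly (@bicst K) Q).[y%:P] = (map_poly polyC Q).[y]%:P by apply: size_polyC_leq1.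
  by elim/poly_ind: Q {QE} => [|Q c IH]; rewrite ?rmorph0 ?horner0 // !rmorphD !rmorphM /=
    !map_polyX !map_polyC /= !hornerMXaddC IH polyCD polyCM.
move: PE; elim/poly_ind: P => [|P c _].
  by rewrite rmorph0 horner0 => /eqP; rewrite polyC_eq0 polyX_eq0.
rewrite rmorphD rmorphM /= map_polyX map_polyC /= hornerMXaddC => e0.
have e : ('X - c%:P)%:P = (map_poly (@bicst K) P).[g s] * g s.
  by apply/eqP; rewrite polyCB subr_eq e0.
have Pgs : ((map_poly (@bicst K) P).[g s] * g s) != 0.
  by rewrite -e polyC_eq0 polyXsubC_eq0.
have := Pgs; rewrite mulf_eq0 negb_or => /andP[P0 gs0].
have := size_mul P0 gs0; rewrite -e => e'.
have := size_polyC_leq1 ('X - c%:P : {poly K}); rewrite e'.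
have aux (k l : nat) : (0 < k -> 1 < l -> ~ (k + l).-1 <= 1)%N by lia.
by move/aux; apply; rewrite ?size_poly_gt0.
Qed.

Lemma kernel_generator : exists F, [/\ D F = 0, (0 < bidegree (g F))%N &
  forall a, D a = 0 -> exists q : {poly K}, g a = (map_poly (@bicst K) q).[g F]].
Proof.
have [F [[s [b [s0 Db FE]]] F1 gen]] := generic_kernel_generator exists_nonconstant_kernel.
have sF0 : bicst (fr s) != 0 by rewrite bicst_eq0 fr_eq0.
have nzF : F != 0 by apply: contraTneq F1 => ->; rewrite -(rmorph0 (@bicst K)) bidegree_bicst.
exists b; split=> //; first by rewrite -FE bidegreeM // bidegree_bicst.
move=> a /generic_kernel_g /gen[q ->].
exists (q \Po ((fr s)^-1 *: 'X)); rewrite map_comp_poly /= horner_comp map_polyZ map_polyX hornerZ hornerX.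
by rewrite -FE mulrA -rmorphM mulVf ?fr_eq0 // rmorph1 mul1r.
Qed.
End Kernel.

(** * Partial derivatives and bounds on denominators *)

Section PartialDerivatives.
Variable K : fieldType.
Hypothesis charK : forall n, n.+1%:R != 0 :> K.
Local Notation C := {poly {poly K}}.

Definition pderiv (b : bool) (f : C) : C := if b then swapXY (swapXY f)^`() else f^`().

Lemma pderivD b f h : pderiv b (f + h) = pderiv b f + pderiv b h.
Proof. by case: b; rewrite /pderiv ?rmorphD /= derivD ?rmorphD. Qed.

Lemma pderivM b f h : pderiv b (f * h) = pderiv b f * h + f * pderiv b h.
Proof. by case: b; rewrite /pderiv ?rmorphM /= derivM // rmorphD !rmorphM /= !swapXYK. Qed.

Lemma pderiv_bicst b c : pderiv b (bicst c) = 0.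
Proof. by case: b; rewrite /pderiv ?swapXY_polyC ?map_polyC /= derivC ?rmorph0. Qed.

Lemma pderivMl b c f : pderiv b (bicst c * f) = bicst c * pderiv b f.
Proof. by rewrite pderivM pderiv_bicst mul0r add0r. Qed.

Lemma bidegree_swapXY (f : C) : bidegree (swapXY f) = bidegree f.
Proof. by rewrite /bidegree !sizeYE swapXYK addnC. Qed.

Lemma bidegree_deriv (f : C) : (1 < size f)%N ->
  f^`() != 0 /\ (bidegree f^`() < bidegree f)%N.
Proof.
move=> f1; have f0 : f != 0 by rewrite -size_poly_gt0 ltnW.
have df0 : f^`() != 0.
  apply/negP => /eqP/polyP/(_ (size f).-2); rewrite coef_deriv coef0.
  have -> : (size f).-2.+1 = (size f).-1 by case: (size f) f1 => [|[|]].
  rewrite -/(lead_coef f) => /eqP; rewrite -scaler_nat scaler_eq0 lead_coef_eq0 (negPf f0) orbF.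
  by case: (size f) f1 => [|[|n]] // _; apply/negP; apply: charK.
split=> //; rewrite /bidegree.
have le1 := lt_size_deriv f0; have s1 : (0 < size f^`())%N by rewrite size_poly_gt0.
suff le2 : (sizeY f^`() <= sizeY f)%N.
  have aux (k l m n : nat) : (0 < k -> k < l -> m <= n -> k.-1 + m.-1 < l.-1 + n.-1)%N by lia.
  exact: aux.
apply/bigmax_leqP => i _; rewrite coef_deriv; apply: leq_trans (max_size_coefXY f i.+1).
by rewrite -scaler_nat; apply: size_scale_leq.
Qed.

Lemma bidegree_pderiv f : (0 < bidegree f)%N ->
  exists b, pderiv b f != 0 /\ (bidegree (pderiv b f) < bidegree f)%N.
Proof.
have [f1 _|f1 f2] := ltnP 1 (size f).
  by exists false; apply: bidegree_deriv.
have s1 : (1 < size (swapXY f))%N.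
  by move: f2; rewrite /bidegree sizeYE; case: (size f) f1 (size (swapXY f)) => [|[]] // _ [|[]].
exists true; have [d0 lt] := bidegree_deriv s1.
by rewrite /pderiv swapXY_eq0 bidegree_swapXY -(bidegree_swapXY f).
Qed.

Definition pderivs (s : seq bool) (f : C) : C := foldr pderiv f s.

Lemma pderivsD s f h : pderivs s (f + h) = pderivs s f + pderivs s h.
Proof. by elim: s => //= b s ->; rewrite pderivD. Qed.

Lemma pderivsMl s c f : pderivs s (bicst c * f) = bicst c * pderivs s f.
Proof. by elim: s => //= b s ->; rewrite pderivMl. Qed.

Lemma pderivsN s f : pderivs s (- f) = - pderivs s f.
Proof.
have N (x : C) : - x = bicst (-1) * x by rewrite /bicst !polyCN mulN1r.
by rewrite [- f]N pderivsMl -N.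
Qed.

Lemma pderivs_bicst s c : s != [::] -> pderivs s (bicst c) = 0.
Proof.
elim: s => //= b [|b' s] IH _; first exact: pderiv_bicst.
by rewrite IH // -(rmorph0 (@bicst K)) pderiv_bicst.
Qed.

(** In characteristic zero, differentiating along a variable that occurs lowers the degree without
    giving zero. For nonconstant [f] the list is nonempty, so the same derivatives kill
    constants. *)
Lemma pderivs_to_constant f : f != 0 -> exists s c,
  [/\ c != 0, pderivs s f = bicst c & (0 < bidegree f)%N -> s != [::]].
Proof.
have [n] := ubnP (bidegree f); elim: n f => // n IH f; rewrite ltnS => fn f0.
have [/bidegree_eq0[c fE]|f1] := posnP (bidegree f).
  by exists [::], c; split=> //; rewrite -bicst_eq0 -fE.
have [b [d0 lt]] := bidegree_pderiv f1.
have [s [c [c0 sE _]]] := IH _ (leq_trans lt fn) d0.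
exists (rcons s b), c; split=> //; last by case: (s).
by rewrite /pderivs foldr_rcons.
Qed.
End PartialDerivatives.

Section Denominators.
Variables (R : idomainType) (B : comAlgType R) (K : fieldType) (fr : {rmorphism R -> K}).
Hypothesis fr_eq0 : forall r, (fr r == 0) = (r == 0).
Hypothesis fr_repr : forall x, exists a s, s != 0 /\ x = fr a / fr s.
Hypothesis charK : forall n, n.+1%:R != 0 :> K.
Local Notation C := {poly {poly K}}.
Variable g : {rmorphism B -> C}.
Hypothesis g_inj : injective g.
Hypothesis gZ : forall r b, g (r *: b) = bicst (fr r) * g b.
Hypothesis g_surj : forall c, exists s b, s != 0 /\ bicst (fr s) * c = g b.
Hypothesis B_fg : finitely_generated_alg B.
Hypothesis B_pure : forall a b (y : B), a%:A = b *: y -> exists r, a = b * r.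

(** By the Leibniz rule it is enough to clear the denominators of the derivatives of finitely many
    generators. *)
Lemma pderiv_denominator b : exists2 s, s != 0 & forall x, exists y, bicst (fr s) * pderiv b (g x) = g y.
Proof.
have [n [e eP]] := B_fg.
have /choice[d dP] i := g_surj (pderiv b (g (e i))); have /choice[z zP] i := dP i.
pose s := \prod_i d i; exists s; first by apply/prodf_neq0 => i _; case: (zP i).
pose ok x := exists y, bicst (fr s) * pderiv b (g x) = g y.
have ok0 : ok 0.
  by exists 0; rewrite rmorph0 -(rmorph0 (@bicst K)) pderiv_bicst rmorph0 mulr0.
have okD x y : ok x -> ok y -> ok (x + y).
  by move=> [x' xE] [y' yE]; exists (x' + y'); rewrite !(rmorphD g) pderivD mulrDr xE yE.
have okM x y : ok x -> ok y -> ok (x * y).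
  move=> [x' xE] [y' yE]; exists (x' * y + x * y').
  by rewrite (rmorphD g) !(rmorphM g) pderivM -xE -yE; ring.
have okC r : ok r%:A.
  exists 0; rewrite gZ rmorph1 mulr1 pderiv_bicst mulr0 rmorph0 //.
have ok_e i : ok (e i).
  exists ((\prod_(j | j != i) d j) *: z i); rewrite gZ -(zP i).2 /s (bigD1 i) //=.
  by rewrite [in LHS]mulrC !rmorphM /= mulrCA mulrA mulrC mulrA.
move=> x; have [P ->] := eP x; rewrite /mmap.
apply: (big_ind ok) => [||m _]; [exact: ok0 | exact: okD | ].
apply: (okM); first exact: okC.
rewrite /mmap1; apply: (big_ind ok) => [||i _]; [|exact: (okM)|].
  by rewrite -[1]scale1r; apply: okC.
elim: (m i) => [|k IH]; first by rewrite expr0 -[1]scale1r; apply: okC.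
by rewrite exprS; apply: (okM).
Qed.

Lemma pderivs_denominator l : exists2 s, s != 0 & forall x, exists y, bicst (fr s) * pderivs l (g x) = g y.
Proof.
elim: l => [|b l [s s0 sP]]; first by exists 1; rewrite ?oner_neq0 // => x; exists x; rewrite !rmorph1 mul1r.
have [t t0 tP] := pderiv_denominator b.
exists (t * s); first by rewrite mulf_neq0.
move=> x; have [y yE] := sP x; have [z zE] := tP y; exists z.
by rewrite -zE -yE pderivMl mulrA !rmorphM.
Qed.

(* Differentiating [h] down to a nonzero constant turns divisibility statements about
   [h] in [B] into divisibility statements in [R]. *)
Lemma denominator_bound h : h != 0 -> exists2 k, k != 0 &
  forall u r b y, (0 < bidegree (g h))%N \/ r = 0 -> u *: h - r%:A = b *: y ->
  exists t, k * u = b * t.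
Proof.
move=> h0; have gh0 : g h != 0 by rewrite -(rmorph0 g) (inj_eq g_inj).
have [l [c [c0 lE l_neq0]]] := pderivs_to_constant charK gh0.
have [s s0 sP] := pderivs_denominator l.
have [a [d [d0 cE]]] := fr_repr c.
have a0 : a != 0 by apply: contraNneq c0 => a0; rewrite cE a0 rmorph0 mul0r.
exists (a * s); first by rewrite mulf_neq0.
move=> u r b y h_or_r e; have [z zE] := sP y.
(* Either some derivative is taken and kills [r], or [r] is zero from the start. The second case
   serves constant [h], such as [T^0]. *)
have lr : pderivs l (bicst (fr r)) = 0.
  case: h_or_r => [/l_neq0 h1|->]; first exact: pderivs_bicst.
  have -> : bicst (fr 0) = bicst 0 * 0 by rewrite mulr0 rmorph0 (rmorph0 (@bicst K)).
  by rewrite pderivsMl (rmorph0 (@bicst K)) mul0r.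
have e1 : bicst (fr u) * bicst c = bicst (fr b) * pderivs l (g y).
  have := congr1 (pderivs l \o g) e; rewrite /= gZ (rmorphB g) !gZ rmorph1 mulr1.
  by rewrite pderivsMl pderivsD pderivsMl lE pderivsN lr subr0.
(* Here [c = a / d]. The differentiated equation multiplied by [s] reads [s u a / d = b z]; clearing
   [d] leaves an element of [R] divisible by [b] in [B]. *)
have [|t tE] := @B_pure (u * (a * s)) b (d *: z).
  apply: g_inj; rewrite !gZ rmorph1 mulr1 -zE.
  have -> : bicst (fr (u * (a * s))) = bicst (fr s) * bicst (fr d) * (bicst (fr u) * bicst c).
    rewrite -!rmorphM /=; congr bicst.
    by rewrite cE !rmorphM /=; field; rewrite fr_eq0.
  by rewrite e1; ring.
by exists t; rewrite mulrC.
Qed.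
End Denominators.

(** * Polynomials in one element of [B] and their reduction to the fibres *)

Definition alg_eval (R : comNzRingType) (B : comAlgType R) (q : {poly R}) (t : B) : B :=
  (map_poly (in_alg B) q).[t].

Section AlgScale.
Variables (R : comNzRingType) (B : comAlgType R).

(* Turns scalars into factors, so that [ring] applies. *)
Lemma scale_in_alg a (x : B) : a *: x = in_alg B a * x.
Proof. by rewrite mulr_algl. Qed.
End AlgScale.

Section AlgEval.
Variables (R : comNzRingType) (B : comAlgType R) (t : B).

Lemma alg_evalZ (q : {poly R}) a : alg_eval (a *: q) t = a *: alg_eval q t.
Proof. by rewrite /alg_eval map_polyZ hornerZ mulr_algl. Qed.

Lemma alg_eval_sum (q : {poly R}) n : (size q <= n)%N ->
  alg_eval q t = \sum_(i < n) q`_i *: t ^+ i.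
Proof.
move=> qn; rewrite /alg_eval (horner_coef_wide t (n := n)).
  by apply: eq_bigr => i _; rewrite coef_map mulr_algl.
exact: leq_trans (size_poly _ _) qn.
Qed.

Lemma alg_evalMXaddC (q : {poly R}) c : alg_eval (q * 'X + c%:P) t = alg_eval q t * t + c%:A.
Proof. by rewrite /alg_eval rmorphD rmorphM /= map_polyX map_polyC /= hornerMXaddC. Qed.

Lemma alg_evalC c : alg_eval c%:P t = c%:A.
Proof. by rewrite /alg_eval map_polyC hornerC. Qed.

Lemma alg_evalD q q' : alg_eval (q + q') t = alg_eval q t + alg_eval q' t.
Proof. by rewrite /alg_eval rmorphD hornerD. Qed.

Lemma alg_eval_shift (q : {poly R}) r :
  alg_eval q (t + r%:A) = alg_eval (q \Po ('X + r%:P)) t.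
Proof.
elim/poly_ind: q => [|q c IH]; first by rewrite comp_poly0 /alg_eval rmorph0 !horner0.
rewrite /alg_eval in IH *.
rewrite comp_polyD comp_polyM comp_polyX comp_polyC !rmorphD !rmorphM /= !map_polyX !map_polyC /=.
rewrite hornerMXaddC IH hornerD hornerM rmorphD /= map_polyX map_polyC /= hornerD hornerX !hornerC.
by [].
Qed.
End AlgEval.

(** The image of [t] in the fibre is a constant, hence a fraction [r / v], or has positive degree
    and is transcendental over the residue field. *)
Lemma fibre_dichotomy (R : idomainType) (B : comAlgType R) : affine_fibration 2 B ->
  forall (p : prime_idealr R) (t : B),
    (exists v r, v \notin p /\ extended p (v *: t - r%:A)) \/
    (forall q, extended p (alg_eval q t) -> forall i, q`_i \in p).
Proof.
move=> B_fib p t; have [L [ib [phi [phiZ ib0 ib_repr phi_ker]]]] := fibre_kernel B_fib p.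
have [/bidegree_eq0[c phit]|t1] := posnP (bidegree (phi t)); [left|right].
  have [a [s [ps e]]] := ib_repr c; exists s, a; split=> //; apply/phi_ker.
  rewrite rmorphB !phiZ rmorph1 mulr1 phit /= -!polyCM e.
  exact: subrr.
move=> q /phi_ker q0 i; apply/ib0.
have phi_eval : phi (alg_eval q t) = (map_poly (@bicst L) (map_poly ib q)).[phi t].
  elim/poly_ind: {q0} q => [|q c IH]; first by rewrite /alg_eval !rmorph0 !horner0 rmorph0.
  rewrite alg_evalMXaddC rmorphD rmorphM IH phiZ rmorph1 mulr1.
  by rewrite !rmorphD !rmorphM /= !map_polyX !map_polyC /= hornerMXaddC.
have := @horner_bicst_transcendental _ _ (map_poly ib q) t1; rewrite -phi_eval => /(_ q0) /polyP/(_ i).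
by rewrite coef_map coef0.
Qed.

Lemma fibre_faithful (R : idomainType) (B : comAlgType R) : affine_fibration 2 B ->
  forall p : prime_idealr R, ~ extended p (1 : B).
Proof.
move=> B_fib p; have [L [ib [phi [_ _ _ phi_ker]]]] := fibre_kernel B_fib p.
by move=> /phi_ker /eqP; rewrite rmorph1 oner_eq0.
Qed.

(** * The common origin and the generators at height-one primes *)

Section Local.
Variables (R : idomainType) (B : comAlgType R) (D : derivation B).
Hypotheses (R_noetherian : noetherian R) (R_normal : normal_domain R).
Hypothesis B_scaler_eq0 : forall r (x : B), (r *: x == 0) = (r == 0) || (x == 0).
Hypothesis B_pure : forall a b (y : B), a%:A = b *: y -> exists r, a = b * r.
Hypothesis B_solve : forall n m (A : 'M[R]_(n, m)) (v : 'cV[R]_n) (b : 'I_m -> B),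
  (forall i, \sum_j A i j *: b j = (v i 0)%:A) -> exists x, A *m x = v.
Hypothesis B_local : forall a (b : B), a != 0 ->
    (forall p, good_prime p -> exists s y, s \notin p /\ s *: b = a *: y) ->
  exists y, b = a *: y.
Hypothesis B_dichotomy : forall (p : prime_idealr R) (t : B),
    (exists v r, v \notin p /\ extended p (v *: t - r%:A)) \/
    (forall q, extended p (alg_eval q t) -> forall i, q`_i \in p).

Lemma scaler_inj r (x y : B) : r != 0 -> r *: x = r *: y -> x = y.
Proof.
move=> r0 /eqP; rewrite -subr_eq0 -scalerBr B_scaler_eq0 (negPf r0) /= subr_eq0.
by move/eqP.
Qed.

Variable F : B.
Hypothesis DF : D F = 0.
Hypothesis F_bound : exists2 k, k != 0 &
  forall u r b y, u *: F - r%:A = b *: y -> exists t, k * u = b * t.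
Hypothesis F_gen : forall a, D a = 0 -> exists s q, s != 0 /\ s *: a = alg_eval q F.

Lemma der_alg r : D r%:A = 0.
Proof. by rewrite linearZ /= (der1 D) scaler0. Qed.

(** Let [I] be the ideal of the [x] with [x F] in [R + kB]. For its finitely many generators the
    constants [r_i] are reconciled by solving [x_i c - k z_i = r_i] over [R], which is possible
    because [F] and the [y_i] solve it in [B]. A general modulus [s] is then reduced to [k] by the
    bound. *)
Lemma origin_shift : exists c, forall a s r y, s != 0 -> a *: F - r%:A = s *: y ->
  exists y', a *: (F - c%:A) = s *: y'.
Proof.
have [k k0 kP] := F_bound; pose I x := exists r y, x *: F - r%:A = k *: y.
have I_ideal : ideal_closed I.
  split; first by exists 0, 0; rewrite !scale0r subr0 scaler0.
  move=> a x x' [r [y e]] [r' [y' e']]; exists (a * r + r'), (a *: y + y').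
  rewrite scalerDr !scalerA [k * a]mulrC -!scalerA -e -e' scalerBr !scalerA.
  by rewrite !scalerDl opprD addrACA.
have [n [x [Ix gen]]] := ideal_closed_fg I_ideal R_noetherian.
have [r rP] := choice Ix; have [y yP] := choice rP.
pose A : 'M[R]_(n, 1 + n) := row_mx (\col_i x i) (- k%:M).
pose b (j : 'I_(1 + n)) := if fintype.split j is inr i then y i else F.
have bl j : b (lshift n j) = F by rewrite /b (fintype.unsplitK (inl j)).
have br j : b (rshift 1 j) = y j by rewrite /b (fintype.unsplitK (inr j)).
have [|z zE] := @B_solve _ _ A (\col_i r i) b.
  move=> i; rewrite big_split_ord /= big_ord1 row_mxEl !mxE bl (bigD1 i) //=.
  rewrite row_mxEr br !mxE eqxx scaleNr big1 ?addr0 => [|j ji].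
    by rewrite -yP opprB addrC subrK.
  by rewrite row_mxEr !mxE eq_sym (negPf ji) oppr0 scale0r.
pose c := z (lshift n ord0) 0; exists c.
have xc i : exists w, x i *: (F - c%:A) = k *: w.
  exists (y i - (z (rshift 1 i) 0)%:A).
  have e : x i * c - k * z (rshift 1 i) 0 = r i.
    have /colP/(_ i) := zE; rewrite -{1}[z]vsubmxK mul_row_col mulNmx mul_scalar_mx.
    by rewrite !mxE big_ord1 !mxE.
  rewrite !scalerBr -yP -e !scalerA.
  by rewrite scalerBl opprB -!addrA; congr (_ + _); rewrite addrCA subrr addr0.
(* The bound gives [k a = s t]; once [t] is shown to lie in [I], [t (F - c)] is divisible by [k],
   and cancelling [k] gives the claim for [a] and [s]. *)
move=> a s r0 y0 s0 e; have [t kat] := kP _ _ _ _ e.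
have [r' [y' te]] : I t.
  have [|r' r'E] := @B_pure (k * r0) s (t *: F - k *: y0).
    rewrite scalerBr !scalerA -kat -!scalerA [s *: (k *: y0)]scalerA mulrC -scalerA -e.
    by rewrite scalerBr !scalerA opprB addrC subrK.
  exists r', y0; apply: (scaler_inj s0).
  by rewrite scalerBr !scalerA -kat -r'E [s * k]mulrC -!scalerA -e scalerBr !scalerA.
have [d tE] := gen t (ex_intro _ r' (ex_intro _ y' te)).
have /choice[w wP] := xc.
exists (\sum_i d i *: w i); apply: (scaler_inj k0).
transitivity (s *: (t *: (F - c%:A))); first by rewrite !scalerA kat.
transitivity (s *: (k *: \sum_i d i *: w i)); last by rewrite !scalerA mulrC.
congr (_ *: _); rewrite tE scaler_suml scaler_sumr; apply: eq_bigr => i _.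
by rewrite -scalerA wP !scalerA mulrC.
Qed.

Section LocalGenerator.
Variable c : R.
Local Notation T := (F - c%:A).
Hypothesis c_origin : forall a s r y, s != 0 -> a *: F - r%:A = s *: y ->
  exists y', a *: T = s *: y'.

Lemma alg_eval_shift_origin q : exists q', alg_eval q F = alg_eval q' T.
Proof. by exists (q \Po ('X + c%:P)); rewrite -alg_eval_shift subrK. Qed.

Lemma shift_gen a : D a = 0 -> exists s q, s != 0 /\ s *: a = alg_eval q T.
Proof.
move=> /F_gen[s [q [s0 e]]]; have [q' qE] := alg_eval_shift_origin q.
by exists s, q'; rewrite e.
Qed.

(** Subtracting constants from [F] and dividing by [pi] as often as possible gives an element
    transcendental modulo [p]. A kernel element is a polynomial in it up to a power of [pi], and
    this power divides out because a polynomial value in [pB] has all its coefficients in [p]. *)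
Lemma good_prime_generator p : good_prime p -> exists v w t,
  [/\ v != 0, w != 0, D t = 0, v *: T = w *: t &
    forall a, D a = 0 -> exists s q, s \notin p /\ s *: a = alg_eval q t].
Proof.
move=> good_p.
have [pi [u [pi0 ppi pu pi_gen]]] := good_prime_uniformizer R_noetherian R_normal good_p.
have ext_pi b : extended p b -> exists y, u *: b = pi *: y.
  move=> [s [sP ->]]; rewrite scaler_sumr big_seq.
  apply: (big_ind (fun x => exists y, x = pi *: y)) => [|_ _ [y ->] [y' ->]|d /sP pd].
  - by exists 0; rewrite scaler0.
  - by exists (y + y'); rewrite scalerDr.
  - by have [z e] := pi_gen _ pd; exists (z *: d.2); rewrite !scalerA e.
pose Q n := `[< exists v r t, v \notin p /\ v *: F - r%:A = pi ^+ n *: t >].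
have Q0 : exists n, Q n.
  exists 0%N; apply/asboolP; exists 1, 0, F.
  by rewrite idealr1 expr0 !scale1r scale0r subr0.
have [k k0 kP] := F_bound.
have [m [v' [w' [pv' pw' ek]]]] := uniformizer_valuation R_noetherian ppi pu pi_gen k0.
(* If [pi^n] divides [v F - r], then it divides [k v], so [n] is at most the valuation [m] of
   [k]. *)
have Qm n : Q n -> (n <= m)%N.
  move=> /asboolP[v [r [t [pv e]]]]; have [z kz] := kP _ _ _ _ e.
  apply: (uniformizer_exp_dvd ppi pi0 (w := w' * v) (y := v' * z)).
    by rewrite prime_idealrM negb_or pw'.
  by rewrite mulrCA -kz mulrA ek mulrA.
case: (ex_maxnP Q0 Qm) => n /asboolP[v [r [t [pv e]]]] maxn.
have pin0 : pi ^+ n != 0 by rewrite expf_neq0.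
have Dt : D t = 0.
  have /eqP := congr1 D e; rewrite raddfB /= der_alg !linearZ /= DF scaler0 subrr eq_sym.
  by rewrite B_scaler_eq0 (negPf pin0) => /eqP.
have transc : forall q, extended p (alg_eval q t) -> forall i, q`_i \in p.
  (* If [t] were constant modulo [p], one more division by [pi] would be possible, against the
     maximality of [n]. *)
  have [[d [r' [pd /ext_pi[y ey]]]]|//] := B_dichotomy p t.
  suff /maxn : Q n.+1 by rewrite ltnn.
  apply/asboolP; exists (u * d * v), (u * d * r + u * pi ^+ n * r'), y; split.
    by rewrite !prime_idealrM !negb_or pu pd.
  transitivity ((u * d) *: (v *: F - r%:A) - (u * pi ^+ n * r')%:A).
    by rewrite !scale_in_alg; ring.
  rewrite e; transitivity (pi ^+ n *: (u *: (d *: t - r'%:A))).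
    by rewrite !scale_in_alg; ring.
  by rewrite ey scalerA exprSr.
(* The common origin allows [v T] to be divided by the same power of [pi]. The quotient [t'] is a
   pure scaling of [T] and differs from [t] by an element of [R]. *)
have [t' t'E] : exists t', v *: T = pi ^+ n *: t' by apply: c_origin e.
have [r' r'E] : exists r', t = t' + r'%:A.
  have [|r' r'E] := @B_pure (v * c - r) (pi ^+ n) (t - t').
    rewrite scalerBr -e -t'E !scale_in_alg; ring.
  exists r'; apply: (scaler_inj pin0); rewrite scalerDr scalerA -r'E -e -t'E.
  by rewrite !scale_in_alg; ring.
have Dt' : D t' = 0.
  by move: Dt; rewrite r'E raddfD /= der_alg addr0.
exists v, (pi ^+ n), t'; split=> //; first by apply: contraNneq pv => ->; rewrite rpred0.
have eval_F q : exists N h, v ^+ N *: alg_eval q F = alg_eval h t.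
  elim/poly_ind: q => [|q b [N [h hE]]]; first by exists 0%N, 0; rewrite /alg_eval !rmorph0 !horner0 scaler0.
  exists N.+1, (h * (pi ^+ n *: 'X + r%:P) + (v ^+ N.+1 * b)%:P).
  have hM x y : alg_eval (x * y) t = alg_eval x t * alg_eval y t.
    by rewrite /alg_eval rmorphM hornerM.
  rewrite alg_evalMXaddC [RHS]alg_evalD alg_evalC hM -hE.
  have -> : alg_eval (pi ^+ n *: 'X + r%:P) t = v *: F.
    by rewrite -mul_polyC alg_evalMXaddC alg_evalC mulr_algl -e subrK.
  rewrite exprS !scale_in_alg !rmorphM /=; ring.
(* Each step removes one factor [pi]: the coefficients lie in [p], hence are multiples of [pi] after
   multiplication by [u]. *)
have descend m' q b : alg_eval q t = pi ^+ m' *: b ->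
    exists s h, s \notin p /\ s *: b = alg_eval h t.
  elim: m' q b => [|m' IH] q b eq.
    by exists 1, q; rewrite idealr1 scale1r eq expr0 scale1r.
  have qp : forall i, q`_i \in p.
    apply: transc; exists [:: (pi, pi ^+ m' *: b)].
    split=> [d|]; first by rewrite inE => /eqP->.
    by rewrite big_seq1 eq exprS scalerA.
  have /choice[f fP] i := pi_gen _ (qp i).
  pose h := \poly_(i < size q) f i.
  have uq : u *: q = pi *: h.
    apply/polyP => i; rewrite !coefZ coef_poly; case: ltnP => [_|qi]; first exact: fP.
    by rewrite nth_default // !mulr0.
  have [|s [h' [ps sE]]] := IH h (u *: b).
    apply: (scaler_inj pi0); rewrite -alg_evalZ -uq alg_evalZ eq exprS !scale_in_alg; ring.
  by exists (s * u), h'; rewrite prime_idealrM negb_or ps -scalerA.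
move=> a Da; have [s [q [s0 sE]]] := F_gen Da.
have [N [h hE]] := eval_F q.
have [m1 [x [y [px py xs]]]] := uniformizer_valuation R_noetherian ppi pu pi_gen s0.
have [|d [h1 [pd dE]]] := descend m1 (x *: h) ((v ^+ N * y) *: a).
  rewrite alg_evalZ -hE -sE !scalerA; congr (_ *: _).
  by transitivity (v ^+ N * (x * s)); [ring | rewrite xs; ring].
exists (d * (v ^+ N * y)), (h1 \Po ('X + r'%:P)); split.
  by rewrite !prime_idealrM !negb_or pd py exp_notin_prime.
by rewrite -scalerA dE r'E alg_eval_shift.
Qed.

Hypothesis T_transcendental : forall q, alg_eval q T = 0 -> q = 0.

Lemma DT : D T = 0.
Proof. by rewrite raddfB /= DF der_alg subrr. Qed.

(** Over [K] the element [t] is a scalar multiple of [T], so both sides are polynomials in [T] and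
    their coefficients agree by transcendence. The factor [w^n] clears the denominators of all [t^i]
    at once. *)
Lemma proportional_components v w t s sigma (q h : {poly R}) : w != 0 -> v *: T = w *: t ->
  s *: alg_eval q T = sigma *: alg_eval h t ->
  forall i, s *: (q`_i *: T ^+ i) = sigma *: (h`_i *: t ^+ i).
Proof.
move=> w0 vT e; pose n := maxn (size q) (size h).
pose f := \poly_(i < n) (s * w ^+ n * q`_i - sigma * h`_i * w ^+ (n - i) * v ^+ i).
have vwX i : v ^+ i *: T ^+ i = w ^+ i *: t ^+ i.
  by rewrite -!exprZn vT.
have wn i : (i < n)%N -> w ^+ n = w ^+ (n - i) * w ^+ i.
  by move=> lt_in; rewrite -exprD subnK // ltnW.
have f0 : f = 0.
  apply: T_transcendental; rewrite (alg_eval_sum _ (size_poly _ _)).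
  transitivity (w ^+ n *: (s *: alg_eval q T - sigma *: alg_eval h t)); last first.
    by rewrite e subrr scaler0.
  rewrite (alg_eval_sum _ (leq_maxl _ _ : size q <= n)%N).
  rewrite (alg_eval_sum _ (leq_maxr _ _ : size h <= n)%N).
  rewrite !scaler_sumr -sumrB scaler_sumr; apply: eq_bigr => i _.
  rewrite coef_poly ltn_ord scalerBl scalerBr; congr (_ - _).
    by rewrite !scalerA; congr (_ *: _); ring.
  rewrite -scalerA vwX !scalerA; congr (_ *: _).
  by rewrite (wn i (ltn_ord i)); ring.
move=> i; have [lt_in|le_ni] := ltnP i n; last first.
  rewrite !nth_default ?scale0r ?scaler0 //.
    by apply: leq_trans le_ni; apply: leq_maxr.
  by apply: leq_trans le_ni; apply: leq_maxl.
have /eqP := congr1 (fun p : {poly R} => p`_i) f0.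
rewrite coef_poly lt_in coef0 subr_eq0 => /eqP ei.
apply: (scaler_inj (r := w ^+ n)); first exact: expf_neq0.
transitivity ((s * w ^+ n * q`_i) *: T ^+ i); first by rewrite !scale_in_alg; ring.
rewrite ei -scalerA vwX !scalerA; congr (_ *: _).
by rewrite (wn i lt_in); ring.
Qed.

(** Divisibility by [sigma] is tested at good primes. There [y] is, up to a multiplier outside [p],
    a polynomial in [t], and its part of degree [i] is a term [h_i t^i], visibly in [B]. *)
Lemma homogeneous_components sigma q y : sigma != 0 -> sigma *: y = alg_eval q T ->
  forall i, exists z, q`_i *: T ^+ i = sigma *: z.
Proof.
move=> s0 e i; apply: B_local => // p /good_prime_generator[v [w [t [_ w0 _ vT gen]]]].
have Dy : D y = 0.
  apply/eqP; have := congr1 D e; rewrite linearZ /= => /eqP.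
  have -> : D (alg_eval q T) = 0.
    elim/poly_ind: (q) => [|q' b IH]; first by rewrite /alg_eval rmorph0 horner0 raddf0.
    by rewrite alg_evalMXaddC raddfD /= der_leibniz IH DT mul0r mulr0 !add0r der_alg.
  by rewrite B_scaler_eq0 (negPf s0).
have [s [h [ps sE]]] := gen y Dy.
exists s, (h`_i *: t ^+ i); split=> //.
by apply: (proportional_components w0 vT); rewrite -e scalerA mulrC -scalerA sE.
Qed.

(** At [p], the part of degree [n] is generated by [t^n]: since [t] is proportional to [T], only the
    term of degree [n] matters when [s y] is written as a polynomial in [t]. *)
Lemma local_principal p : good_prime p -> exists v w t,
  [/\ v != 0, w != 0, v *: T = w *: t &
    forall n y a sigma, sigma != 0 -> sigma *: y = a *: T ^+ n ->
      exists s r, s \notin p /\ s *: y = r *: t ^+ n].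
Proof.
move=> /good_prime_generator[v [w [t [v0 w0 _ vT gen]]]]; exists v, w, t; split=> //.
move=> n y a sigma s0 e.
have Dy : D y = 0.
  apply/eqP; have De := congr1 D e; move: De; rewrite [LHS]linearZ [RHS]linearZ /= (der_exp n DT) scaler0 => /eqP.
  by rewrite B_scaler_eq0 (negPf s0).
have [s [h [ps sE]]] := gen y Dy; exists s, h`_n; split=> //.
apply: (scaler_inj s0); rewrite scalerA mulrC -scalerA e.
have eX : alg_eval (a *: 'X^n) T = a *: T ^+ n.
  by rewrite alg_evalZ /alg_eval map_polyXn hornerXn.
rewrite -(@proportional_components v w t s sigma (a *: 'X^n) h) //.
  by rewrite coefZ coefXn eqxx mulr1.
by rewrite eX -e scalerA mulrC -scalerA sE.
Qed.
End LocalGenerator.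
End Local.

(** * The grading of the kernel and the structure of its components *)

Section Graded.
Variables (R : idomainType) (B : comAlgType R) (D : derivation B).
Hypotheses (R_noetherian : noetherian R) (R_normal : normal_domain R).
Hypothesis B_scaler_eq0 : forall r (x : B), (r *: x == 0) = (r == 0) || (x == 0).
Hypothesis B_pure : forall a b (y : B), a%:A = b *: y -> exists r, a = b * r.
Hypothesis B_local : forall a (b : B), a != 0 ->
    (forall p, good_prime p -> exists s y, s \notin p /\ s *: b = a *: y) ->
  exists y, b = a *: y.
Variable T : B.
Hypothesis DT : D T = 0.
Hypothesis T_transcendental : forall q, alg_eval q T = 0 -> q = 0.
Hypothesis T_gen : forall y, D y = 0 -> exists s q, s != 0 /\ s *: y = alg_eval q T.
Hypothesis T_components : forall s q y, s != 0 -> s *: y = alg_eval q T ->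
  forall i, exists z, q`_i *: T ^+ i = s *: z.
Hypothesis T_local : forall p, good_prime p -> exists v w t,
  [/\ v != 0, w != 0, v *: T = w *: t &
    forall n y a s, s != 0 -> s *: y = a *: T ^+ n ->
      exists u r, u \notin p /\ u *: y = r *: t ^+ n].
Hypothesis T_bound : forall n, exists2 k, k != 0 &
  forall a s y, a *: T ^+ n = s *: y -> exists r, k * a = s * r.

Local Notation scaleI := (scaler_inj B_scaler_eq0).

(** The intersection of [B] with [K T^n], that is [J_n T^n] for the fractional ideal [J_n] of the
    [j] in [K] with [j T^n] in [B]. *)
Definition homogeneous n (y : B) : Prop := exists a s, s != 0 /\ s *: y = a *: T ^+ n.

Lemma powT_neq0 n : T ^+ n != 0.
Proof.
apply/eqP => Tn0; have /T_transcendental/eqP : alg_eval 'X^n T = 0.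
  by rewrite /alg_eval map_polyXn hornerXn.
by rewrite -size_poly_eq0 size_polyXn.
Qed.

Lemma scale_neq0_inj (x : B) r r' : x != 0 -> r *: x = r' *: x -> r = r'.
Proof.
move=> x0 /eqP; rewrite -subr_eq0 -scalerBl B_scaler_eq0 (negPf x0) orbF subr_eq0.
by move/eqP.
Qed.

Lemma homogeneous_der n y : homogeneous n y -> D y = 0.
Proof.
move=> [a [s [s0 e]]]; have := congr1 D e; rewrite [LHS]linearZ [RHS]linearZ /=.
by rewrite (der_exp n DT) scaler0 => /eqP; rewrite B_scaler_eq0 (negPf s0) => /eqP.
Qed.

Lemma homogeneous0 n : homogeneous n 0.
Proof. by exists 0, 1; rewrite oner_neq0 scaler0 scale0r. Qed.

Lemma homogeneousP n c x y : homogeneous n x -> homogeneous n y -> homogeneous n (c *: x + y).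
Proof.
move=> [a [s [s0 e]]] [b [t [t0 e']]]; exists (t * c * a + s * b), (s * t).
split; first by rewrite mulf_neq0.
transitivity ((t * c) *: (s *: x) + s *: (t *: y)); first by rewrite !scale_in_alg; ring.
by rewrite e e' !scale_in_alg; ring.
Qed.

Lemma homogeneousM m n x y : homogeneous m x -> homogeneous n y -> homogeneous (m + n) (x * y).
Proof.
move=> [a [s [s0 e]]] [b [t [t0 e']]]; exists (a * b), (s * t).
split; first by rewrite mulf_neq0.
by rewrite -scalerA scalerAr e' scalerAl e -scalerAl -scalerAr scalerA exprD.
Qed.

Lemma homogeneous_powT n : homogeneous n (T ^+ n).
Proof. by exists 1, 1; rewrite oner_neq0. Qed.

Lemma homogeneous_bound n : exists2 k, k != 0 &
  forall y, homogeneous n y -> exists r, k *: y = r *: T ^+ n.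
Proof.
have [k k0 kP] := T_bound n; exists k => // y [a [s [s0 e]]].
have [r rE] := kP a s y (esym e); exists r.
by apply: (scaleI s0); rewrite [RHS]scalerA -rE -[RHS]scalerA -e !scalerA mulrC.
Qed.

Lemma homogeneous_sum y : D y = 0 -> exists n (c : nat -> B),
  (forall i, homogeneous i (c i)) /\ y = \sum_(i < n) c i.
Proof.
move=> /T_gen[s [q [s0 e]]]; have [c cP] := choice (T_components s0 e).
exists (size q), c; split=> [i|]; first by exists q`_i, s; rewrite -cP.
apply: (scaleI s0); rewrite e (alg_eval_sum _ (leqnn _)) scaler_sumr.
by apply: eq_bigr => i _.
Qed.

Lemma homogeneous_direct n (c : nat -> B) : (forall i, homogeneous i (c i)) ->
  \sum_(i < n) c i = 0 -> forall i, (i < n)%N -> c i = 0.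
Proof.
move=> hc c0; have /choice[a /choice[s sP]] := hc.
pose S := \prod_(i < n) s i; pose S' (i : 'I_n) := \prod_(j < n | j != i) s j.
have SE i : S = S' i * s i by rewrite /S (bigD1 i) //= mulrC.
(* [insub] recovers the ordinal needed to index [S']; its default 0 is never reached below [n]. *)
pose q := \poly_(i < n) (if insub i is Some j then S' j * a i else 0).
have q0 : q = 0.
  apply: T_transcendental; rewrite (alg_eval_sum _ (size_poly _ _)).
  rewrite -[RHS](scaler0 _ S) -[in RHS]c0 scaler_sumr; apply: eq_bigr => i _.
  by rewrite coef_poly ltn_ord valK (SE i) -!scalerA (sP i).2.
move=> i lt_in; have := congr1 (fun p : {poly R} => p`_i) q0.
rewrite coef_poly lt_in coef0 insubT => /eqP; rewrite mulf_eq0.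
have /negPf-> : S' (Ordinal lt_in) != 0 by apply/prodf_neq0 => j _; apply: (sP j).1.
move=> /eqP ai; have := (sP i).2; rewrite ai scale0r => /eqP.
by rewrite B_scaler_eq0 (negPf (sP i).1) => /eqP.
Qed.

Definition component_pred (n : nat) : {pred ker D} := fun x => `[< homogeneous n (subalg_val x) >].
Lemma component_submod n : submod_closed (component_pred n).
Proof.
split=> [|c x y /asboolP hx /asboolP hy]; apply/asboolP; first exact: homogeneous0.
exact: homogeneousP.
Qed.
Definition component n : submodClosed (ker D) :=
  HB.pack_for (submodClosed (ker D)) (component_pred n)
    (GRing.isSubmodClosed.Build R (ker D) (component_pred n) (component_submod n)).

Lemma ker_val_inj (x y : ker D) : subalg_val x = subalg_val y -> x = y.
Proof. exact: val_inj. Qed.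

Lemma ker_val_sum n (x : 'I_n -> ker D) : subalg_val (\sum_i x i) = \sum_i subalg_val (x i).
Proof. exact: (raddf_sum (\val : subalg (ker_pred D) -> B)). Qed.

Lemma ker_mem n y : homogeneous n y -> y \in ker_pred D.
Proof. by move=> /homogeneous_der Dy; apply/eqP. Qed.

Lemma component_grading : is_grading component.
Proof.
split.
- by apply/asboolP; apply: homogeneous_powT 0.
- by move=> i j x y /asboolP hx /asboolP hy; apply/asboolP; apply: homogeneousM.
- move=> x; have /eqP Dx := subalg_valP x; have [n [c [hc xE]]] := homogeneous_sum Dx.
  exists n, (fun i => Subalg (ker_mem (hc i))); split=> [i|]; first exact/asboolP.
  apply: ker_val_inj; rewrite xE.
  by rewrite ker_val_sum.
- move=> n c hc c0 i lt_in; apply: ker_val_inj.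
  apply: (@homogeneous_direct n (fun i => subalg_val (c i))) => //.
    by move=> j; apply/asboolP; apply: hc.
  by rewrite -ker_val_sum c0.
Qed.

Lemma component_base : is_base (component 0).
Proof.
split=> [r r' /(congr1 (@subalg_val _ _ _)) /= e|x].
  by apply: (scale_neq0_inj (x := 1 : B)); rewrite // -(expr0 T) powT_neq0.
split=> [/asboolP[a [s [s0]]]|[r ->]].
  rewrite expr0 => e; have [r rE] := B_pure (esym e); exists r.
  apply: ker_val_inj; apply: (scaleI s0); rewrite e rE /= scalerA //.
by apply/asboolP; exists r, 1; rewrite oner_neq0 expr0 scale1r.
Qed.

Section Component.
Variable n : nat.
Local Notation M := (submod (component n)).

Definition component_val (m : M) : B := subalg_val (submod_val m).

Lemma component_val_inj : injective component_val.
Proof. by move=> x y /ker_val_inj/val_inj. Qed.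

Lemma component_valP m : homogeneous n (component_val m).
Proof. exact/asboolP/(submod_valP m). Qed.

Lemma component_val_lin c x y : component_val (c *: x + y) = c *: component_val x + component_val y.
Proof. by []. Qed.

Lemma component_valZ c x : component_val (c *: x) = c *: component_val x.
Proof. by []. Qed.

Lemma component_val_sum k (x : 'I_k -> M) : component_val (\sum_i x i) = \sum_i component_val (x i).
Proof. by apply: big_morph. Qed.

Lemma component_of y : homogeneous n y -> exists m, component_val m = y.
Proof.
move=> hy; have my : Subalg (ker_mem hy) \in component n by apply/asboolP.
by exists (Submod my).
Qed.

(** Multiplication by [k] identifies the component with an ideal of [R], formed by the coefficients
    of [T^n]. *)
Lemma component_generators : exists d (e : 'I_d -> M),
  forall m, exists c : 'I_d -> R, m = \sum_i c i *: e i.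
Proof.
have [k k0 kP] := homogeneous_bound n.
pose I r := exists m, k *: component_val m = r *: T ^+ n.
have I_ideal : ideal_closed I.
  split; first by exists 0; rewrite scale0r scaler0.
  move=> a r r' [m e] [m' e']; exists (a *: m + m').
  by rewrite component_val_lin scalerDr e' scalerA mulrC -scalerA e scalerA -scalerDl.
have [d [r [Ir gen]]] := ideal_closed_fg I_ideal R_noetherian.
have [e eP] := choice Ir; exists d, e => m.
have [x xE] := kP _ (component_valP m).
have [|c cE] := gen x; first by exists m.
exists c; apply: component_val_inj; apply: (scaleI k0).
rewrite xE cE component_val_sum scaler_suml scaler_sumr; apply: eq_bigr => i _.
by rewrite component_valZ -scalerA -eP !scalerA mulrC.
Qed.

Lemma component_finite : finite_module M.
Proof. exact: component_generators. Qed.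

Lemma linear_form_mem (f : M -> R) : (forall a x y, f (a *: x + y) = a * f x + f y) ->
  exists phi : dual M, forall m, evaluation m phi = f m.
Proof.
move=> f_lin; have mf : (f : M -> R^o) \in linear_form_pred M by apply/asboolP.
by exists (Submod mf).
Qed.

Lemma form_scale (V : lmodType R) (f : V -> R) : (forall a x y, f (a *: x + y) = a * f x + f y) ->
  forall a x, f (a *: x) = a * f x.
Proof.
move=> f_lin a x; have f0 : f 0 = 0.
  by rewrite -(addNr x) -scaleN1r f_lin mulN1r addNr.
by rewrite -[a *: x]addr0 f_lin f0 addr0.
Qed.

Lemma dual_scale (V : lmodType R) (f : dual V) a x :
  evaluation (a *: x) f = a * evaluation x f :> R.
Proof. by apply: form_scale => b y z; have /asboolP := submod_valP f; apply. Qed.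

(* A form [f] with [k m = f(m) t] for all [m], where [t] is not zero, is automatically
   linear. *)
Lemma proportional_form k (t : B) : t != 0 -> (forall m, exists r, k *: component_val m = r *: t) ->
  exists phi : dual M, forall m, k *: component_val m = (evaluation m phi : R) *: t.
Proof.
move=> t0 /choice[f fP]; have [|phi phiE] := @linear_form_mem f.
  move=> a x y; apply: (scale_neq0_inj t0).
  rewrite -fP component_val_lin scalerDr scalerA mulrC -scalerA !fP scalerDl scalerA //.
by exists phi => m; rewrite fP phiE.
Qed.

Lemma component_form : exists k (phi : dual M), k != 0 /\
  forall m, k *: component_val m = (evaluation m phi : R) *: T ^+ n.
Proof.
have [k k0 kP] := homogeneous_bound n.
have [m|phi phiE] := @proportional_form k _ (powT_neq0 n); first exact: kP (component_valP m).
by exists k, phi.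
Qed.

(** Over [K] all forms are multiples of [phi], which is what [evalB] expresses. An element [Phi] of
    the bidual is thus determined by [Phi(phi)], and its only possible preimage is
    [Phi(phi) T^n / k]. That this lies in [B] is checked at good primes, where [t^n] generates. *)
Lemma component_reflexive : reflexive_module M.
Proof.
have [k [phi [k0 phiE]]] := component_form.
have [x0 x0E] := component_of (homogeneous_powT n).
have evalB (f : dual M) m : k * evaluation m f = evaluation m phi * evaluation x0 f :> R.
  rewrite -!dual_scale; congr (evaluation _ f : R).
  by apply: component_val_inj; rewrite !component_valZ phiE x0E.
have inj : injective (@biduality R M).
  move=> m m' e; apply: component_val_inj; apply: (scaleI k0); rewrite !phiE.
  by have /(congr1 (fun F : dual (dual M) => submod_val F phi)) /= -> := e.
have surj (Phi : dual (dual M)) : exists m, biduality m = Phi.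
  pose ev (f : dual M) : R := submod_val Phi f.
  have evB f : k * ev f = evaluation x0 f * ev phi.
    rewrite -!(@dual_scale _ Phi); congr (evaluation _ Phi : R).
    apply: val_inj; apply/funext => m; have := evalB f m; rewrite mulrC => e.
    by rewrite /= [LHS]mulrC e mulrC.
  have [y yE] : exists y, ev phi *: T ^+ n = k *: y.
    apply: B_local => // p /T_local[v [w [t [v0 w0 vT loc]]]].
    have t0 : t ^+ n != 0.
      apply/eqP => tn0; have /eqP : v ^+ n *: T ^+ n = 0 by rewrite -exprZn vT exprZn tn0 scaler0.
      by rewrite B_scaler_eq0 (negPf (expf_neq0 _ v0)) (negPf (powT_neq0 n)).
    have [d [e gen]] := component_generators.
    have /choice[u /choice[r urP]] i : exists u r, u \notin p /\ u *: component_val (e i) = r *: t ^+ n.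
      by have [a [s [s0 /(loc _ _ _ _ s0)]]] := component_valP (e i).
    pose s := \prod_i u i.
    (* The coordinate along the local generator [t^n], multiplied by [s] to clear the denominators
       of finitely many generators, is a form on the whole component, so [Phi] can be applied to
       it. *)
    have [|f fE] := @proportional_form s _ t0.
      move=> m; have [c ->] := gen m; exists (\sum_i c i * (\prod_(j | j != i) u j) * r i).
      rewrite component_val_sum scaler_sumr scaler_suml; apply: eq_bigr => i _.
      rewrite component_valZ -[RHS]scalerA -(urP i).2 !scalerA; congr (_ *: _).
      by rewrite /s (bigD1 i) //=; ring.
    exists s, (ev f *: t ^+ n); split; first by apply: prod_notin_prime => i; case: (urP i).
    rewrite [LHS]scalerA mulrC -scalerA -x0E fE !scalerA; congr (_ *: _).
    by rewrite evB mulrC.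
  have [m mE] : exists m, component_val m = y.
    by apply: component_of; exists (ev phi), k; rewrite yE.
  exists m; apply: val_inj; apply/funext => f; apply: (mulfI k0).
  transitivity (evaluation m phi * evaluation x0 f : R); first exact: evalB.
  rewrite [RHS](evB f) mulrC; congr (_ * _); apply: (scale_neq0_inj (powT_neq0 n)).
  by rewrite -phiE mE yE.
have [h hP] := choice surj.
exists h => [m|Phi]; last exact: hP.
by apply: inj; rewrite hP.
Qed.

(** The isomorphism sends the tensor of [x] and [m] to [x phi(m)]. Since [k m = phi(m) T^n], every
    tensor is a multiple of [T^n]; the division by [k] in the inverse reflects [phi(T^n) = k]. *)
Lemma component_rank : rank_eq M 1.
Proof.
have [k [phi [k0 phiE]]] := component_form.
have [x0 x0E] := component_of (homogeneous_powT n).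
pose fphi m : R := evaluation m phi.
have phi_lin a x y : fphi (a *: x + y) = a * fphi x + fphi y.
  by have /asboolP := submod_valP phi; apply.
have phi_x0 : fphi x0 = k.
  by apply: (scale_neq0_inj (powT_neq0 n)); rewrite -phiE x0E.
pose b (x : scalar_restr (@FracField.tofrac R)) (m : M) : 'rV[{fraction R}]_1 :=
  const_mx ((x : {fraction R}) * (fphi m)%:F).
have bb : balanced b.
  split=> [x x' m|x m m'|a x m].
  - by apply/rowP => i; rewrite !mxE mulrDl.
  - by apply/rowP => i; rewrite !mxE -[m]scale1r phi_lin mul1r tofracD mulrDr scale1r.
  - by apply/rowP => i; rewrite !mxE (form_scale phi_lin) tofracM mulrA [X in X * _]mulrC.
pose F0 : base_change (@FracField.tofrac R) M -> 'rV[{fraction R}]_1 := tensor_lift b.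
have F0D x y : F0 (x + y) = F0 x + F0 y := tensor_liftD bb x y.
have F0p x m : F0 (pure x m) = b x m := tensor_lift_pure bb x m.
have F00 : F0 0 = 0 := tensor_lift0 bb.
have F0Z c x : F0 (c *: x) = c *: F0 x.
  elim/base_change_ind: x => [|x y IH IH'|x m]; first by rewrite scaler0 F00 scaler0.
    by rewrite scalerDr !F0D IH IH' scalerDr.
  rewrite [c *: _](bc_scale_pure c x m) !F0p; apply/rowP => i; rewrite !mxE mulrA //.
have F_lin : linear F0 by move=> c x y; rewrite F0D F0Z.
have kF : k%:F != 0 by rewrite tofrac_eq0.
have span z : exists c : scalar_restr (@FracField.tofrac R), z = pure c x0.
  elim/base_change_ind: z => [|z z' [c ->] [c' ->]|x m].
  - by exists 0; apply/esym; exact: pure0l.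
  - by exists (c + c'); apply/esym; exact: pureDl.
  - pose y : scalar_restr (@FracField.tofrac R) := k%:F^-1 * (x : {fraction R}).
    exists (fphi m *: y).
    have -> : x = k *: y by rewrite [RHS]mulVKf.
    rewrite [LHS]pureZ [RHS]pureZ; congr (pure _ _).
    by apply: component_val_inj; rewrite !component_valZ phiE x0E.
pose F1 : {linear base_change (@FracField.tofrac R) M -> 'rV[{fraction R}]_1} :=
  HB.pack_for {linear base_change (@FracField.tofrac R) M -> 'rV[{fraction R}]_1} F0
    (GRing.isLinear.Build _ _ _ _ F0 F_lin).
exists F1; exists (fun v : 'rV[{fraction R}]_1 =>
    pure (v 0 0 / k%:F : scalar_restr (@FracField.tofrac R)) x0).
  move=> z; have [c ->] := span z; rewrite /= F0p mxE phi_x0.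
  by congr (pure _ _); rewrite mulfK.
by move=> v; rewrite /= F0p; apply/rowP => i; rewrite mxE phi_x0 divfK // (ord1 i).
Qed.
End Component.

(** A bound [k] already puts [k J_1] inside [R]. The additional nonunit [z], which exists because
    [R] is not a field, makes the ideal proper, as [idealr] requires: if [T = k z y], the bound
    gives [k = k z r]. *)
Lemma exists_conductor : ~ GRing.field_axiom R -> exists x, [/\ x != 0,
  forall a s y, a *: T = s *: y -> exists r, x * a = s * r & ~ exists y, T = x *: y].
Proof.
move=> nf; have [k k0 kP] := T_bound 1.
have [z [z0 zU]] : exists z : R, z != 0 /\ z \isn't a GRing.unit.
  apply: contrapT => h; apply: nf => z z0; apply/negPn/negP => zU.
  by apply: h; exists z.
exists (k * z); split; first by rewrite mulf_neq0.
  move=> a s y; rewrite -[T]expr1 => /kP[r e]; exists (z * r).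
  by rewrite mulrAC e -mulrA [r * z]mulrC.
move=> [y e]; have [|r] := kP 1 (k * z) y; first by rewrite expr1 scale1r.
rewrite mulr1 -{1}[k]mulr1 -mulrA => /(mulfI k0) e1.
by move/negP: zU; apply; apply/unitrPr; exists r.
Qed.

(** * The ideal [I], its symbolic powers and the Rees algebra *)

Section ReesIdeal.
Variable x : R.
Hypothesis x_neq0 : x != 0.
Hypothesis x_bound : forall a s y, a *: T = s *: y -> exists r, x * a = s * r.
Hypothesis x_proper : ~ exists y, T = x *: y.

(** The elements of [R] in [x^n J_n], where [J_n T^n] is the part of degree [n] of the kernel. *)
Definition rees_component n (r : R) : Prop := exists y, r *: T ^+ n = x ^+ n *: y.

Lemma rees_component_ideal n : ideal_closed (rees_component n).
Proof.
split=> [|a r r' [y e] [y' e']]; first by exists 0; rewrite scale0r scaler0.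
by exists (a *: y + y'); rewrite scalerDl -scalerA e e' scalerDr !scalerA mulrC.
Qed.

Lemma rees_componentM m n r r' : rees_component m r -> rees_component n r' ->
  rees_component (m + n) (r * r').
Proof.
move=> [y e] [y' e']; exists (y * y').
by rewrite exprD -scalerA scalerAr e' scalerAl e -scalerAl -scalerAr scalerA exprD.
Qed.

Lemma rees_component_local n r : (forall p, good_prime p -> exists2 s, s \notin p & rees_component n (s * r)) ->
  rees_component n r.
Proof.
move=> loc; apply: B_local; first exact: expf_neq0.
by move=> p /loc[s ps [y e]]; exists s, y; rewrite scalerA.
Qed.

Definition rees_ideal_pred : {pred R} := fun r => `[< rees_component 1 r >].

Lemma rees_ideal_closed : idealr_closed rees_ideal_pred.
Proof.
have [c0 cP] := rees_component_ideal 1; split; first exact/asboolP.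
  apply/asboolP => -[y]; rewrite !expr1 scale1r => e.
  by apply: x_proper; exists y.
by move=> a r r' /asboolP hr /asboolP hr'; apply/asboolP; apply: cP.
Qed.

Definition rees_ideal : idealr R := HB.pack_for (idealr R) rees_ideal_pred
  (GRing.isZmodClosed.Build R rees_ideal_pred (idealr_closedB rees_ideal_closed))
  (isProperIdeal.Build R rees_ideal_pred (idealr_closed_nontrivial rees_ideal_closed)).
Local Notation I := rees_ideal.

Lemma rees_idealP r : r \in I <-> rees_component 1 r.
Proof. by split=> /asboolP. Qed.

Lemma rees_ideal_x : x \in I.
Proof. by apply/rees_idealP; exists T; rewrite !expr1. Qed.

Lemma rees_ideal_pow n r : r \in ideal_pow I n -> rees_component n r.
Proof.
have [c0 cP] := rees_component_ideal n.
move=> rI; elim/ideal_gen_sub: r / rI => [//|a r r' [t [/allP It ->]] hr']; apply: cP => //.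
elim: n t It {c0 hr'} => [|n IH] t It.
  by rewrite tuple0 big_nil; exists 1; rewrite !expr0.
case/tupleP: t It => y t It; rewrite big_cons -add1n.
apply: rees_componentM; first by apply/rees_idealP/It; rewrite inE eqxx.
by apply: IH => z zt; apply: It; rewrite inE zt orbT.
Qed.

Lemma ideal_powX n r : r \in I -> r ^+ n \in ideal_pow I n.
Proof.
move=> rI; apply: ideal_gen_mem; exists [tuple of nseq n r]; split.
  by apply/allP => y /nseqP[->].
by rewrite big_nseq iter_mulr_1.
Qed.

(** The local generator [t = (v / w) T] corresponds to [i0 = x v / w], which lies in [R] by the
    choice of [x]. Its powers generate because those of [t] do. *)
Lemma rees_local_generator p : good_prime p -> exists2 i0, i0 \in I &
  forall n r, rees_component n r -> exists s c, s \notin p /\ s * r = c * i0 ^+ n.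
Proof.
move=> /T_local[v [w [t [v0 w0 vT loc]]]].
have [i0 i0E] := x_bound vT.
have i0T : i0 *: T = x *: t.
  by apply: (scaleI w0); rewrite scalerA -i0E -scalerA vT !scalerA mulrC.
exists i0; first by apply/rees_idealP; exists t; rewrite !expr1.
move=> n r [y e]; have [s [c [ps sE]]] := loc _ _ _ _ (expf_neq0 n x_neq0) (esym e).
exists s, c; split=> //; apply: (scale_neq0_inj (powT_neq0 n)).
rewrite -scalerA e scalerA mulrC -scalerA sE -scalerA.
by rewrite -exprZn i0T exprZn !scalerA mulrC.
Qed.

(** Let [p = (I : z)]. As [z] is not in [I] and membership in [I] is tested at good primes, some
    good prime [q] contains [p]. Now [p] contains the nonzero [x], and no nonzero prime is strictly
    inside [q]. *)
Lemma associated_prime_good p : associated_prime I p -> good_prime p.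
Proof.
move=> [z0 zE]; have [z zz0] : exists z, \pi_{ideal_quot I} z = z0 by exists (repr z0); rewrite reprK.
have zI r : r \in p <-> r * z \in I.
  rewrite zE -zz0 -rmorphM -[X in _ == X](raddf0 \pi_{ideal_quot I}) -Quotient.idealrBE subr0.
  by [].
have nzI : z \notin I by apply/negP; rewrite -[z]mul1r => /zI; rewrite idealr1.
have [q good_q pq] : exists2 q, good_prime q & {subset p <= q}.
  apply: contrapT => h; move/negP: nzI; apply; apply/rees_idealP.
  apply: rees_component_local => q good_q; apply: contrapT => h'.
  apply: h; exists q => // r /zI/rees_idealP rz; apply/negPn/negP => qr.
  by apply: h'; exists r.
have qp : {subset q <= p}.
  apply: (good_prime_min R_noetherian R_normal good_q _ x_neq0 pq).
  by apply/zI; rewrite mulrC idealMr // rees_ideal_x.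
have [a [b [a0 qE]]] := good_q; exists a, b; split=> // r; rewrite -qE.
by split; [apply: pq | apply: qp].
Qed.

(** With [i0] a local generator of [I], the element [z0 = u i0 / pi] works: at [p], [r z0] is a
    multiple of [i0] exactly when [pi] divides [r]. *)
Lemma good_prime_associated p : good_prime p -> {subset I <= p} -> associated_prime I p.
Proof.
move=> good_p Ip; have [i0 i0I gen] := rees_local_generator good_p.
have [pi [u [pi0 ppi pu pi_gen]]] := good_prime_uniformizer R_noetherian R_normal good_p.
have [z0 ez] := pi_gen _ (Ip _ i0I).
have u0 : u != 0 by apply: contraNneq pu => ->; rewrite rpred0.
have i00 : i0 != 0.
  apply/eqP => i00; have [s [c [ps]]] := gen _ _ ((rees_idealP x).1 rees_ideal_x).
  rewrite i00 expr1 mulr0 => /eqP; rewrite mulf_eq0 (negPf x_neq0) orbF => /eqP s0.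
  by rewrite s0 rpred0 in ps.
exists (\pi_{ideal_quot I} z0) => r.
rewrite -rmorphM -[X in _ == X](raddf0 \pi_{ideal_quot I}) -Quotient.idealrBE subr0.
apply/idP/idP => [pr|/rees_idealP rz].
  have [r' er] := pi_gen _ pr.
  have -> : r * z0 = r' * i0.
    by apply: (mulfI u0); rewrite mulrA er mulrAC -ez; ring.
  exact: idealMr.
have [s [c [ps e]]] := gen _ _ rz.
have : s * u * r \in p.
  have -> : s * u * r = pi * c; last by rewrite mulrC idealMr.
  apply: (mulfI i00); transitivity (s * r * (u * i0)); first by ring.
  by rewrite ez; transitivity (pi * (s * (r * z0))); [ring | rewrite e expr1; ring].
by rewrite !prime_idealrM (negPf ps) (negPf pu).
Qed.

Lemma rees_unmixed : unmixed_height_one I.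
Proof.
by move=> p /associated_prime_good; apply: good_prime_height.
Qed.

Lemma extension_to_loc (p : prime_idealr R) (X : R -> Prop) r :
  to_loc p r \in extension (to_loc p) (ideal_gen X) <-> exists2 s, s \notin p & s * r \in ideal_gen X.
Proof.
split=> [rX|[s ps srX]].
  have : exists a s, [/\ a \in ideal_gen X, s \notin p & loc_val (to_loc p r) = a%:F / s%:F].
    elim/ideal_gen_sub: (to_loc p r) / rX => [|c _ y [a aX ->] [b [s [bX ps yE]]]].
      by exists 0, 1; rewrite ideal_gen0 idealr1 tofrac0 mul0r.
    have /asboolP[d [t [pt cE]]] := loc_valP c.
    exists (d * s * a + t * b), (t * s); split.
    - by rewrite ideal_genD // ideal_genMl.
    - by rewrite prime_idealrM negb_or pt.
    - have [s0 t0] := (notin_neq0 ps, notin_neq0 pt).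
      rewrite /= yE cE tofracD !tofracM mulrAC addf_div //.
      by rewrite [d%:F * s%:F * _]mulrAC [t%:F * b%:F]mulrC.
  move=> [a [s [aX ps e]]]; exists s => //.
  have -> // : s * r = a.
  apply/eqP; rewrite -tofrac_eq tofracM mulrC.
  have {}e : r%:F = a%:F / s%:F := e.
  by rewrite e divfK ?(notin_neq0 ps).
have hs : 1%:F / s%:F \in loc_pred p by apply/asboolP; exists 1, s.
have -> : to_loc p r = Localization hs * to_loc p (s * r).
  apply: val_inj; change (r%:F = 1%:F / s%:F * (s * r)%:F).
  by rewrite tofrac1 tofracM mul1r mulKf ?(notin_neq0 ps).
by apply/ideal_genMl/ideal_gen_mem; exists (s * r).
Qed.

(** Both sides are local. At a good prime containing [I], the part of degree [n] and [I^n] are both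
    generated by [i0^n]; at a good prime not containing [I], the power [y^n] of an element of [I]
    outside it is a suitable multiplier. *)
Lemma rees_symbolic_power n r : r \in symbolic_power I n <-> rees_component n r.
Proof.
split=> [/asboolP rn|rn].
  apply: rees_component_local => p good_p.
  have [Ip|/existsNP[y /not_implyP[Iy /negP py]]] := pselect (forall y, y \in I -> y \in p).
    have /extension_to_loc[s ps srI] := rn p (good_prime_associated good_p Ip).
    by exists s => //; apply: rees_ideal_pow.
  exists (y ^+ n); first exact: exp_notin_prime.
  by rewrite mulrC; apply: (ideal_closedM (rees_component_ideal n)); apply: rees_ideal_pow; apply: ideal_powX.
apply/asboolP => p /associated_prime_good/rees_local_generator[i0 i0I gen].
have [s [c [ps e]]] := gen _ _ rn.
apply/extension_to_loc; exists s => //.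
by rewrite e; apply: ideal_genMl; apply: ideal_powX.
Qed.

Section Isomorphism.
Variables (K : fieldType) (fr : {rmorphism R -> K}).
Hypothesis fr_eq0 : forall r, (fr r == 0) = (r == 0).
Variable g : {rmorphism B -> {poly {poly K}}}.
Hypothesis g_inj : injective g.
Hypothesis gZ : forall r b, g (r *: b) = bicst (fr r) * g b.

(** The variable of the Rees algebra goes to [T / x]. This is not in [B], since [x] does not divide
    [T], so the evaluation takes place in [K[X, Y]]. *)
Definition rees_eval (P : {poly R}) : {poly {poly K}} :=
  (map_poly (@bicst K \o fr) P).[bicst (fr x)^-1 * g T].
HB.instance Definition _ := GRing.RMorphism.copy rees_eval
  (horner_eval (bicst (fr x)^-1 * g T) \o map_poly (@bicst K \o fr)).

Lemma rees_evalZ c P : rees_eval (c *: P) = bicst (fr c) * rees_eval P.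
Proof. by rewrite /rees_eval map_polyZ hornerZ. Qed.

Lemma rees_eval_components (P : {poly R}) (y : nat -> B) :
  (forall i, P`_i *: T ^+ i = x ^+ i *: y i) -> rees_eval P = g (\sum_(i < size P) y i).
Proof.
move=> yP; rewrite /rees_eval (horner_coef_wide _ (size_poly _ _)) rmorph_sum.
apply: eq_bigr => i _; rewrite coef_map /= exprMn -rmorphXn /=.
have x0 : fr (x ^+ i) != 0 by rewrite fr_eq0 expf_neq0.
have := congr1 g (yP i); rewrite !gZ (rmorphXn g) => e.
rewrite mulrCA e mulrA -rmorphM /= exprVn -rmorphXn mulVf // rmorph1 mul1r //.
Qed.

Lemma rees_component_homogeneous n r y : r *: T ^+ n = x ^+ n *: y -> homogeneous n y.
Proof. by move=> e; exists r, (x ^+ n); rewrite expf_neq0. Qed.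

Lemma symbolic_reesP (P : {poly R}) : P \in symbolic_rees_pred I <-> forall n, rees_component n P`_n.
Proof.
split=> [/asboolP hP n|hP]; first exact/rees_symbolic_power.
by apply/asboolP => n; apply/rees_symbolic_power.
Qed.

Lemma rees_eval_kernel (P : {poly R}) : P \in symbolic_rees_pred I ->
  exists2 z, D z = 0 & rees_eval P = g z.
Proof.
move=> /symbolic_reesP/choice[y yP]; exists (\sum_(i < size P) y i); last exact: rees_eval_components.
by rewrite raddf_sum big1 // => i _; apply: homogeneous_der (rees_component_homogeneous (yP i)).
Qed.

Lemma rees_eval_inj (P Q : {poly R}) : P \in symbolic_rees_pred I -> Q \in symbolic_rees_pred I ->
  rees_eval P = rees_eval Q -> P = Q.
Proof.
move=> hP hQ e; apply/eqP; rewrite -subr_eq0; apply/eqP.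
have /symbolic_reesP/choice[y yP] : P - Q \in symbolic_rees_pred I by rewrite rpredB.
have y0 : \sum_(i < size (P - Q)) y i = 0.
  by apply: g_inj; rewrite -(rees_eval_components yP) rmorphB /= e subrr rmorph0.
have hy i := rees_component_homogeneous (yP i).
apply/polyP => i; rewrite coef0; have [lt_i|le_i] := ltnP i (size (P - Q)); last exact: nth_default.
have := yP i; rewrite (homogeneous_direct hy y0 lt_i) scaler0 => /eqP.
by rewrite B_scaler_eq0 (negPf (powT_neq0 i)) orbF => /eqP.
Qed.

(** From [s z = q(T)], the preimage must have coefficients [x^i q_i / s]. That they lie in [R] is
    again tested at good primes, inside [B], and brought back to [R] by purity. *)
Lemma rees_eval_surj z : D z = 0 -> exists2 P, P \in symbolic_rees_pred I & rees_eval P = g z.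
Proof.
move=> /T_gen[s [q [s0 e]]]; have /choice[y yP] := T_components s0 e.
have xq i : exists r, x ^+ i * q`_i = s * r.
  have [p good_p|b] := @B_local s (x ^+ i * q`_i)%:A s0; last exact: B_pure.
  have [v [w [t [v0 w0 vT loc]]]] := T_local good_p.
  have [i0 i0E] := x_bound vT.
  have i0T : i0 *: T = x *: t.
    by apply: (scaleI w0); rewrite scalerA -i0E -scalerA vT !scalerA mulrC.
  have [u [c [pu uE]]] := loc _ _ _ _ s0 (esym (yP i)).
  exists u, (c * i0 ^+ i)%:A; split=> //; rewrite !scalerA; congr (_ *: _).
  apply: (scale_neq0_inj (powT_neq0 i)).
  transitivity ((u * x ^+ i) *: (q`_i *: T ^+ i)); first by rewrite scalerA; congr (_ *: _); ring.
  rewrite yP; transitivity ((x ^+ i * s) *: (u *: y i)); first by rewrite !scalerA; congr (_ *: _); ring.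
  rewrite uE; transitivity ((s * c) *: (i0 ^+ i *: T ^+ i)); last by rewrite scalerA; congr (_ *: _); ring.
  by rewrite -exprZn i0T exprZn !scalerA; congr (_ *: _); ring.
have /choice[r rE] := xq.
pose P := \poly_(i < size q) r i.
have PE i : P`_i *: T ^+ i = x ^+ i *: (if (i < size q)%N then y i else 0).
  rewrite coef_poly; case: ltnP => _; last by rewrite scale0r scaler0.
  by apply: (scaleI s0); rewrite scalerA -rE -scalerA yP !scalerA mulrC.
exists P; first by apply/symbolic_reesP => n; exists (if (n < size q)%N then y n else 0).
have sP : (size P <= size q)%N := size_poly _ _.
rewrite (rees_eval_components PE); congr (g _); apply: (scaleI s0).
rewrite e (alg_eval_sum _ (leqnn _)) scaler_sumr.
(* The sum over the size of [P] is extended to that of [q]; the added terms vanish with the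
   coefficients of [P]. *)
rewrite (big_ord_widen _ (fun i => s *: (if (i < size q)%N then y i else 0)) sP).
rewrite big_mkcond; apply: eq_bigr => i _; rewrite ltn_ord yP; case: ltnP => // le_Pi.
have := PE i; rewrite nth_default // scale0r ltn_ord => /esym/eqP.
by rewrite B_scaler_eq0 (negPf (expf_neq0 _ x_neq0)) => /eqP->; rewrite scaler0.
Qed.

(** Both algebras embed in [K[X, Y]], by [g] and by [rees_eval], with the same image. The map is
    chosen pointwise, and injectivity of the embeddings makes it a bijective morphism. *)
Lemma rees_isomorphic : alg_isomorphic (ker D) (symbolic_rees I).
Proof.
have /choice[f fE] : forall z : ker D, exists P : symbolic_rees I,
    rees_eval (subalg_val P) = g (subalg_val z).
  move=> z; have /eqP Dz := subalg_valP z; have [P hP PE] := rees_eval_surj Dz.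
  by exists (Subalg hP).
have f_ext (P Q : symbolic_rees I) : rees_eval (subalg_val P) = rees_eval (subalg_val Q) -> P = Q.
  by move=> e; apply: val_inj; apply: rees_eval_inj e; apply: subalg_valP.
have f_lin : linear f.
  move=> c y z; apply: f_ext; rewrite fE.
  transitivity (g (c *: subalg_val y + subalg_val z)) => //.
  transitivity (rees_eval (c *: subalg_val (f y) + subalg_val (f z))) => //.
  by rewrite (rmorphD g) gZ (rmorphD rees_eval) /= rees_evalZ !fE.
have f_mul : monoid_morphism f.
  split=> [|y z]; apply: f_ext; rewrite fE.
    by transitivity (g 1) => //; transitivity (rees_eval 1); rewrite ?rmorph1.
  transitivity (g (subalg_val y * subalg_val z)) => //.
  transitivity (rees_eval (subalg_val (f y) * subalg_val (f z))) => //.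
  by rewrite (rmorphM g) (rmorphM rees_eval) /= !fE.
pose F : {lrmorphism ker D -> symbolic_rees I} :=
  HB.pack_for {lrmorphism ker D -> symbolic_rees I} f
    (GRing.isLinear.Build _ _ _ _ f f_lin) (GRing.isMonoidMorphism.Build _ _ f f_mul).
have /choice[h hE] : forall P : symbolic_rees I, exists z : ker D,
    g (subalg_val z) = rees_eval (subalg_val P).
  move=> P; have [z Dz PE] := rees_eval_kernel (subalg_valP P).
  by have hz : z \in ker_pred D by [apply/eqP]; exists (Subalg hz).
exists F; exists h => [z|P].
  by apply: ker_val_inj; apply: g_inj; rewrite hE; apply: fE.
by apply: f_ext; apply: (etrans (fE (h P)) (hE P)).
Qed.
End Isomorphism.
End ReesIdeal.
End Graded.

Lemma contains_rat_char0 (R : idomainType) : contains_rat R -> forall n, n.+1%:R != 0 :> R.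
Proof.
move=> [iota] n; apply/eqP => n0.
have /eqP : iota (n.+1%:R^-1 * n.+1%:R) = 0 by rewrite rmorphM rmorph_nat n0 mulr0.
by rewrite mulVf ?rmorph1 ?oner_eq0 // Num.Theory.pnatr_eq0.
Qed.

(** * The kernel of a derivation of the fibration *)

Section Assembly.
Variables (R : idomainType) (B : comAlgType R) (D : derivation B).
Hypotheses (R_noetherian : noetherian R) (R_normal : normal_domain R).
Hypothesis char0 : forall n, n.+1%:R != 0 :> R.
Hypothesis B_fibration : affine_fibration 2 B.
Hypotheses (D_nilpotent : locally_nilpotent D) (D_nonzero : exists b, D b != 0).
Variables (K : fieldType) (fr : {rmorphism R -> K}).
Hypothesis fr_eq0 : forall r, (fr r == 0) = (r == 0).
Hypothesis fr_repr : forall x, exists a s, s != 0 /\ x = fr a / fr s.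
Variable g : {rmorphism B -> {poly {poly K}}}.
Hypothesis g_inj : injective g.
Hypothesis gZ : forall r b, g (r *: b) = bicst (fr r) * g b.
Hypothesis g_surj : forall c, exists s b, s != 0 /\ bicst (fr s) * c = g b.

Lemma g_alg_eval (q : {poly R}) t : g (alg_eval q t) = (map_poly (@bicst K) (map_poly fr q)).[g t].
Proof.
elim/poly_ind: q => [|q c IH]; first by rewrite /alg_eval !rmorph0 !horner0 rmorph0.
rewrite alg_evalMXaddC (rmorphD g) (rmorphM g) IH gZ rmorph1 mulr1.
by rewrite !rmorphD !rmorphM /= !map_polyX !map_polyC /= hornerMXaddC.
Qed.

Lemma clear_denominators (q : {poly K}) : exists s (p : {poly R}), s != 0 /\ fr s *: q = map_poly fr p.
Proof.
elim/poly_ind: q => [|q c [s [p [s0 e]]]].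
  by exists 1, 0; rewrite oner_neq0 !rmorph0 scaler0.
have [a [d [d0 ->]]] := fr_repr c.
exists (s * d), (d *: p * 'X + (s * a)%:P); split; first by rewrite mulf_neq0.
rewrite rmorphD [in RHS](rmorphM (map_poly fr)) /= map_polyX map_polyC /= map_polyZ -e.
rewrite scalerDr; congr (_ + _).
  by rewrite scalerA -scalerAl -rmorphM mulrC.
by rewrite -mul_polyC -polyCM !(rmorphM fr); congr (_%:P); field; rewrite fr_eq0.
Qed.

Lemma graded_kernel :
  (exists A_ : nat -> submodClosed (ker D),
    [/\ is_grading A_,
        is_base (A_ 0%N) &
        forall i : nat, (1 <= i)%N ->
          [/\ finite_module (submod (A_ i)),
              reflexive_module (submod (A_ i)) &
              rank_eq (submod (A_ i)) 1]]) /\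
  (~ GRing.field_axiom R ->
    exists I : idealr R,
      unmixed_height_one I /\ alg_isomorphic (ker D) (symbolic_rees I)).
Proof.
have [B_fg B_flat _] := B_fibration.
have faithful := fibre_faithful B_fibration.
have B_solve := solve_system R_noetherian B_flat faithful.
have B_pure := pure_subring R_noetherian B_flat faithful.
have B_local := dvd_of_good_primes R_noetherian B_flat.
have charK n : n.+1%:R != 0 :> K by rewrite -(rmorph_nat fr) fr_eq0.
have B_scaler_eq0 := alg_scaler_eq0 fr_eq0 g_inj gZ.
have bound h := denominator_bound fr_eq0 fr_repr charK g_inj gZ g_surj B_fg B_pure (h := h).
have [F [DF F1 gen]] :=
  kernel_generator fr_eq0 fr_repr g_inj gZ g_surj char0 D_nilpotent D_nonzero.
have F_gen a : D a = 0 -> exists s q, s != 0 /\ s *: a = alg_eval q F.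
  move=> /gen[q qE]; have [s [p [s0 e]]] := clear_denominators q; exists s, p; split=> //.
  by apply: g_inj; rewrite gZ qE g_alg_eval -e map_polyZ hornerZ.
have F0 : F != 0.
  by apply: contraTneq F1 => ->; rewrite rmorph0 -(rmorph0 (@bicst K)) bidegree_bicst.
have F_bound : exists2 k, k != 0 &
    forall u r b y, u *: F - r%:A = b *: y -> exists t, k * u = b * t.
  have [k k0 kP] := bound F F0; exists k => // u r b y; apply: kP; by left.
have [c cP] := origin_shift R_noetherian B_scaler_eq0 B_pure B_solve F_bound.
pose T := F - c%:A.
have T1 : (0 < bidegree (g T))%N.
  rewrite bidegree_gt0P // => x e; move: F1.
  by rewrite -[F](subrK c%:A) (rmorphD g) e gZ rmorph1 mulr1 -rmorphD bidegree_bicst.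
have T_transc q : alg_eval q T = 0 -> q = 0.
  move=> /(congr1 g); rewrite g_alg_eval rmorph0 => /(horner_bicst_transcendental T1) q0.
  apply/polyP => i; have /polyP/(_ i) := q0; rewrite coef_map !coef0 => /eqP.
  by rewrite fr_eq0 => /eqP.
have DT := DT DF c.
have dichotomy := fibre_dichotomy B_fibration.
have T_gen := shift_gen F_gen c.
have T_components := homogeneous_components R_noetherian R_normal B_scaler_eq0 B_pure B_local
  dichotomy DF F_bound F_gen cP T_transc.
have T_local := local_principal R_noetherian R_normal B_scaler_eq0 B_pure dichotomy DF F_bound
  F_gen cP T_transc.
(* No constant is subtracted here, so the bound applies also to [T^0]. *)
have T_bound n : exists2 k, k != 0 &
    forall a s y, a *: T ^+ n = s *: y -> exists r, k * a = s * r.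
  have [k k0 kP] := bound _ (powT_neq0 T_transc n); exists k => // a s y e.
  by apply: (kP a 0 s y); [right | rewrite scale0r subr0].
split; last first.
  move=> nf; have [x [x0 x_bound x_proper]] := exists_conductor T_bound nf.
  exists (rees_ideal x_proper); split.
    exact: (rees_unmixed R_noetherian R_normal B_local).
  exact: (rees_isomorphic R_noetherian R_normal B_scaler_eq0 B_pure B_local DT T_transc T_gen
    T_components T_local x0 x_bound x_proper fr_eq0 g_inj gZ).
exists (component D T); split.
- exact: component_grading.
- exact: component_base.
- move=> i _; split.
  + exact: component_finite.
  + exact: component_reflexive.
  + exact: component_rank.
Qed.
End Assembly.

Theorem theoremB (R : idomainType) (B : comAlgType R) (D : derivation B)
    (R_noetherian : noetherian R) (R_normal : normal_domain R)
    (R_rat : contains_rat R) (B_fibration : affine_fibration 2 B)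
    (D_nilpotent : locally_nilpotent D) (D_nonzero : exists b : B, D b != 0) :
  (exists A_ : nat -> submodClosed (ker D),
    [/\ is_grading A_,
        is_base (A_ 0%N) &
        forall i : nat, (1 <= i)%N ->
          [/\ finite_module (submod (A_ i)),
              reflexive_module (submod (A_ i)) &
              rank_eq (submod (A_ i)) 1]]) /\
  (~ GRing.field_axiom R ->
    exists I : idealr R,
      unmixed_height_one I /\ alg_isomorphic (ker D) (symbolic_rees I)).
Proof.
have [g [g_inj gZ g_surj]] := generic_fibre B_fibration.
exact: (graded_kernel R_noetherian R_normal (contains_rat_char0 R_rat) B_fibration D_nilpotent
  D_nonzero (@tofrac_eq0 R) (@fraction_repr R) g_inj gZ g_surj).
Qed.
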